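(* Given $d \geq 2$ and $\rho \in (0,1)$ sufficiently small, there exist constants $0 < a_\rho < b_\rho < 1$ and $\varepsilon_\rho > 0$, depending only on $d$ and $\rho$, with the following property. Let $E \subseteq [0,1]^d$ be any Borel set whose $s$-dimensional Hausdorff measure $\mathbb H^s(E)$ is positive for some $s > d - \varepsilon_\rho$. Let $\mathcal D_\rho(E;s)$ denote the collection of all dyadic cubes $Q$ contained in $[0,1]^d$ such that $$\mathcal H^s_\infty(E \cap Q) > (1-\rho)\,\ell(Q)^s .$$ Then $$\Delta(E) \supseteq \bigcup\big\{\ell(Q)[a_\rho, b_\rho] : Q \in \mathcal D_\rho(E;s)\big\}.$$
   Context: $\Delta(E) = \{|x-y| : x,y \in E\}$ is the distance set of $E$ ($|\cdot|$ Euclidean norm). Dyadic cubes are closed; $\mathcal Q_d$ is the collection of all closed dyadic cubes in $\mathbb R^d$, and $\ell(Q)$ is the side-length of $Q$. $\mathbb H^s$ is the standard $s$-dimensional Hausdorff measure. For $s \in (0,d]$ the $s$-dimensional dyadic Hausdorff content is $\mathcal H^s_\infty(E) = \inf\{\sum_{i} \ell(Q_i)^s : E \subseteq \bigcup_{i=1}^\infty Q_i,\ Q_i \in \mathcal Q_d\}$. For an interval $[a,b]$ and $\ell>0$, $\ell[a,b] = [\ell a, \ell b]$. *)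

(* Defs.v *)
From HB Require Import structures.
From mathcomp Require Import all_boot all_order all_algebra.
From mathcomp Require Import all_classical all_reals all_analysis.

Set Implicit Arguments.
Unset Strict Implicit.
Unset Printing Implicit Defensive.

Import Order.TTheory GRing.Theory Num.Theory.
Import numFieldNormedType.Exports.

Local Open Scope classical_set_scope.
Local Open Scope ring_scope.

(* The canonical norm of 'rV[R]_d in the library is the sup norm, hence a
   separate Euclidean norm; both induce the same topology. *)
Definition enorm (R : realType) (d : nat) (x : 'rV[R]_d) : R :=
  Num.sqrt (\sum_(i < d) x 0 i ^+ 2).

Definition distance_set (R : realType) (d : nat) (E : set 'rV[R]_d) : set R :=
  [set enorm (xy.1 - xy.2) | xy in E `*` E].

Definition borel_set (R : realType) (d : nat) (E : set 'rV[R]_d) : Prop :=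
  (<<s [set U : set 'rV[R]_d | open U] >>) E.

Definition unit_cube (R : realType) (d : nat) : set 'rV[R]_d :=
  [set x | forall i, 0 <= x 0 i <= 1].
Arguments unit_cube R d : clear implicits.

(* [DyadicCube j k] stands for the closed cube
   \prod_i [2^j k_i, 2^j (k_i + 1)]; all scales j : int are allowed. *)
Record dyadic_cube (d : nat) : Type :=
  DyadicCube { dyadic_scale : int; dyadic_index : 'I_d -> int }.

Definition side (R : realType) (d : nat) (Q : dyadic_cube d) : R :=
  2 ^ dyadic_scale Q.
Arguments side R {d} Q.

Definition cube_set (R : realType) (d : nat) (Q : dyadic_cube d) :
    set 'rV[R]_d :=
  [set x | forall i, side R Q * (dyadic_index Q i)%:~R <= x 0 i
                     <= side R Q * (dyadic_index Q i + 1)%:~R].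
Arguments cube_set R {d} Q.

Definition dyadic_content (R : realType) (d : nat) (s : R)
    (E : set 'rV[R]_d) : \bar R :=
  ereal_inf [set (\sum_(i <oo) (side R (Q i) `^ s)%:E)%E
    | Q in [set Q : nat -> dyadic_cube d
            | E `<=` \bigcup_i cube_set R (Q i)]].

(* The element 0 is added so that the empty set has diameter 0, not -oo. *)
Definition diameter (R : realType) (d : nat) (U : set 'rV[R]_d) : \bar R :=
  ereal_sup ([set 0%E] `|` [set r%:E | r in distance_set U]).

Definition hausdorff_premeasure (R : realType) (d : nat) (s delta : R)
    (E : set 'rV[R]_d) : \bar R :=
  ereal_inf [set (\sum_(i <oo) (diameter (U i) `^ s))%E
    | U in [set U : nat -> set 'rV[R]_d
            | E `<=` \bigcup_i U i /\
              forall i, (diameter (U i) <= delta%:E)%E]].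

(* No normalizing constant. For s > 0, [0 `^ s = 0], so empty sets and
   points in a cover cost nothing. *)
Definition hausdorff_measure (R : realType) (d : nat) (s : R)
    (E : set 'rV[R]_d) : \bar R :=
  ereal_sup [set hausdorff_premeasure s delta E
            | delta in [set delta : R | 0 < delta]].

Definition dense_cubes (R : realType) (d : nat) (rho : R) (E : set 'rV[R]_d)
    (s : R) : set (dyadic_cube d) :=
  [set Q | cube_set R Q `<=` unit_cube R d /\
           (((1 - rho) * side R Q `^ s)%:E
              < dyadic_content s (E `&` cube_set R Q))%E].

(* Main.v *)
Require Import Defs.
From HB Require Import structures.
From mathcomp Require Import all_boot all_order all_algebra.
From mathcomp Require Import all_classical all_reals all_analysis.
From mathcomp Require Import ring lra zify ssrAC.

(** Fix a dense cube [Q] and put [d = k + 1], [lam = 2 ^ (- s)].  After rescaling [Q] to the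
    unit cube the claim is that every [t] in [1/8, 1/4] is a distance of [E].  The
    argument is a discrete form of the classical fact that averages over a sphere smooth
    functions: a set which is nearly full at a coarse scale cannot lose the correlation with
    its own spherical average at finer scales, provided that its dimension is close to [d].

    The dyadic subcubes of [Q] form a tree whose nodes are words of digits, a node of depth
    [K] having weight [lam ^ K].  The content of a set is bounded ([dyadic_content_le]) by a
    tree content: the least value at the root of a superadditive function on nodes that
    reaches the weight at some node on the branch of each point of the set.  Two facts are
    used about it.
    It is continuous along increasing unions ([tree_content_bigcup]), as for the content in
    Choquet's theory, so that a Borel set, being Suslin, can be replaced by sets [A_n] of
    content still greater than [1 - rho] whose points have their limits in [E]
    ([bounded_approx], [bounded_part_limit]).  And it is the value of a maximal flow: for
    each depth [n] there is a measure on the nodes of depth [n], charging only nodes that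
    meet the set, with total mass greater than [1 - rho] and with mass at most [lam ^ K] on
    each node of depth [K] ([frostman]).  It remains to find, for each [N], two nodes charged
    by the measure of [A_N] whose difference is within about [2 ^- N] of a vector of length
    [t] ([discrete_pair]); a limit along an ultrafilter then gives two points of [E].

    The measure is spread on a finite torus, and one studies the correlation of the density
    [f1] of one corner subcube with the average of the density [f] of the whole measure over a
    cap of the sphere of radius [t].  A charged pair exists as soon as this correlation,
    computed at a fine scale, is positive.  Let [S_r] be the average over boxes with [k] sides
    [2 ^- (72 r)] and one side [2 ^- (64 r)].  Near the pole the cap is a parabola, and
    expanding the square of the average over a short arc of it shows that the
    average almost kills [S_(r+1) g - S_r S_(r+1) g]: the gain is a constant times [4 ^- r]
    ([smooth_gain]).  On the other hand [S_r f] is at most [2 ^ d theta ^ (72 r)] with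
    [theta = 2 ^ d lam], and [theta] is close to [1] because [s] is close to [d]; so the norm
    of [S_r f] grows at most like [(5/4) ^ r], the changes of the correlation from scale
    to scale sum to something of size [2 ^- r0] ([corr_tower]), and one may compute at the
    coarse scale [r0].

    At that scale the smoothed densities are at most [1 + eta], since a cell of
    depth [K] has mass at most [lam ^ K], and they have masses at least [2 ^- d - rho - eta] and
    [1 - rho].  Two functions with values at most [c] satisfy [(c - u) (c - v) >= 0], which
    bounds the correlation from below by [c] times (the sum of the masses minus [c]), hence by
    a positive constant as soon as [rho] and [eta] are at most [2 ^- d / 8] ([corr_pos]). *)

Set Implicit Arguments.
Unset Strict Implicit.
Unset Printing Implicit Defensive.

Import Order.TTheory GRing.Theory Num.Theory.
Import numFieldNormedType.Exports.

Local Open Scope classical_set_scope.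
Local Open Scope ring_scope.

(** * Superadditive functions on a tree and tree content *)

Section SupSum.
Variable R : realType.
Implicit Types (u : nat -> R).

Lemma sup_range_ge u c n : (forall m, u m <= c) -> u n <= sup (range u).
Proof.
move=> H; apply: ub_le_sup; last by exists n.
by exists c => _ [m _ <-].
Qed.

Lemma sup_range_le u c : (forall m, u m <= c) -> sup (range u) <= c.
Proof.
by move=> H; apply: ge_sup => [|_ [m _ <-]]; first by exists (u 0), 0%N.
Qed.

(** Suprema of finitely many nondecreasing sequences are nearly attained at a common index, so a
    bound on the sums passes to the sum of the suprema. *)
Lemma sum_sup_le (D : finType) (a : nat -> D -> R) c :
  (forall n i, a n i <= a n.+1 i) -> (forall n i, 0 <= a n i) ->
  (forall n, \sum_i a n i <= c) -> \sum_i sup (range (a ^~ i)) <= c.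
Proof.
move=> mono a0 H; have mono' n m i : (n <= m)%N -> a n i <= a m i.
  move=> /subnK <-; elim: (m - n)%N => [|l IH] //.
  by rewrite addSn (le_trans IH).
have ac n i : a n i <= c.
  by apply: le_trans (H n); rewrite (bigD1 i) //= lerDl sumr_ge0.
apply/ler_addgt0Pr => e e0.
have [d d0 de] : exists2 d : R, 0 < d & #|D|%:R * d <= e.
  exists (e / (#|D|%:R + 1)); first by rewrite divr_gt0 // ltr_wpDl.
  by rewrite mulrCA ger_pMr // ler_pdivrMr ?ltr_wpDl // mul1r lerDl.
have /choice[N HN] i : exists n, sup (range (a ^~ i)) < a n i + d.
  have [|_ [n _ <-] Hn] := @sup_adherent R (range (a ^~ i)) d d0.
    by split; [exists (a 0%N i), 0%N | exists c => _ [m _ <-]].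
  by exists n; rewrite -ltrBlDr.
pose M := \max_i N i.
apply: (@le_trans _ _ (\sum_i (a M i + d))).
  apply: ler_sum => i _; apply: le_trans (ltW (HN i)) _.
  by rewrite lerD2r mono' // leq_bigmax.
by rewrite big_split /= sumr_const -[d *+ _]mulr_natl lerD.
Qed.
End SupSum.

Section Tree.
Variables (R : realType) (D : finType) (lam : R) (X : Type) (digit : X -> nat -> D).
Hypothesis lam0 : 0 < lam.
Implicit Types (q r : seq D) (al : seq D -> R) (E : set X) (x : X).

(** The deepest digit comes first, so that the ancestors of a node are its suffixes and its
    children are [i :: q]. *)
Fixpoint code x k : seq D := if k is j.+1 then digit x j :: code x j else [::].

Definition wt q : R := lam ^+ size q.

(** A fractional way of choosing subtrees: the value of [al] at a node pays for all that is chosen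
    below it. *)
Definition flow al := (forall q, 0 <= al q) /\ (forall q, \sum_i al (i :: q) <= al q).

(** Superadditivity is only required where the weight has not been reached: a node that has
    reached it is chosen itself, and nothing below it has to be paid for. *)
Definition weak_flow al := (forall q, 0 <= al q) /\
  (forall q, wt q <= al q \/ \sum_i al (i :: q) <= al q).

Definition covers E q al := forall x, E x -> code x (size q) = q ->
  exists2 k, (size q <= k)%N & wt (code x k) <= al (code x k).

Definition tree_content E q : R := inf [set al q | al in [set al | flow al /\ covers E q al]].

Lemma size_code x k : size (code x k) = k.
Proof. by elim: k => //= k ->. Qed.

Lemma wt_gt0 q : 0 < wt q. Proof. exact: exprn_gt0. Qed.

Lemma flow_cons al i q : flow al -> al (i :: q) <= al q.
Proof.
move=> [a0 aS]; apply: le_trans (aS q).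
by rewrite (bigD1 i) //= lerDl sumr_ge0.
Qed.

Lemma flow_root al q : flow al -> al q <= al [::].
Proof.
by move=> fa; elim: q => // i q; apply: le_trans; apply: flow_cons.
Qed.

Lemma flow0 : flow (fun=> 0).
Proof. by split=> // q; rewrite big1. Qed.

(** The flow that chooses the single node [q], and so charges [wt q] to each ancestor of [q]. *)
Definition branch q r : R := if r == drop (size q - size r) q then wt q else 0.

Lemma branch_flow q : flow (branch q).
Proof.
split=> r; rewrite /branch; first by case: ifP => // _; apply: ltW (wt_gt0 _).
have [[i Hi]|no] := pselect (exists i, i :: r = drop (size q - (size r).+1) q); last first.
  rewrite big1 => [|i _]; first by case: ifP => // _; apply: ltW (wt_gt0 _).
  by rewrite /=; case: eqP => // Hi; case: no; exists i.
rewrite (bigD1 i) //= {1}Hi eqxx big1 ?addr0 => [|j ji]; last first.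
  by case: eqP => //; rewrite -Hi => -[ij]; rewrite ij eqxx in ji.
have rq : (size r < size q)%N.
  have := congr1 size Hi; rewrite size_drop /=; lia.
have -> : r = drop (size q - size r) q; last by rewrite size_drop subKn ?eqxx //; lia.
have -> : (size q - size r = 1 + (size q - (size r).+1))%N by lia.
by rewrite -drop_drop -Hi /= drop0.
Qed.

Lemma branch_self q : branch q q = wt q.
Proof. by rewrite /branch subnn drop0 eqxx. Qed.

Lemma tree_content_has_inf E q :
  has_inf [set al q | al in [set al | flow al /\ covers E q al]].
Proof.
split; last by exists 0 => _ [al [[a0 _] _] <-].
exists (branch q q), (branch q) => //; split; first exact: branch_flow.
by move=> x _ xq; exists (size q) => //; rewrite xq branch_self.
Qed.

Lemma tree_content_le E q al : flow al -> covers E q al -> tree_content E q <= al q.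
Proof.
move=> fa ca; apply: ge_inf; first by have [] := tree_content_has_inf E q.
by exists al.
Qed.

Lemma tree_content_lt E q c : tree_content E q < c ->
  exists al, [/\ flow al, covers E q al & al q < c].
Proof.
by move=> /inf_lt[|_ [al [fa ca] <-] H]; [have [] := tree_content_has_inf E q | exists al].
Qed.

Lemma tree_content_ge0 E q : 0 <= tree_content E q.
Proof.
apply: lb_le_inf; first by have [] := tree_content_has_inf E q.
by move=> _ [al [[a0 _] _] <-].
Qed.

Lemma tree_content_le_wt E q : tree_content E q <= wt q.
Proof.
rewrite -[leRHS]branch_self; apply: tree_content_le; first exact: branch_flow.
by move=> x _ xq; exists (size q) => //; rewrite xq branch_self.
Qed.

Lemma tree_content_mono E F q : E `<=` F -> tree_content E q <= tree_content F q.
Proof.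
move=> EF; apply: lb_le_inf; first by have [] := tree_content_has_inf F q.
move=> _ [al [fa ca] <-]; apply: tree_content_le => // x Ex; exact: ca (EF _ Ex).
Qed.

Lemma tree_content_empty E q : (forall x, E x -> code x (size q) <> q) -> tree_content E q = 0.
Proof.
move=> H; apply/eqP; rewrite eq_le tree_content_ge0 andbT.
by apply: (@tree_content_le E q (fun=> 0)) flow0 _ => x Ex /(H _ Ex).
Qed.

(** Below its weight the content is superadditive, because a flow that covers [E] at [q] without
    stopping at [q] covers [E] at every child of [q]. *)
Lemma tree_content_children E q : tree_content E q < wt q ->
  \sum_i tree_content E (i :: q) <= tree_content E q.
Proof.
move=> lt; rewrite leNgt; apply/negP => lt2.
have : tree_content E q < Num.min (wt q) (\sum_i tree_content E (i :: q)) by rewrite lt_min lt.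
move=> /tree_content_lt[al [fa ca]]; rewrite lt_min => /andP[a1 a2].
suff : \sum_i tree_content E (i :: q) <= al q by rewrite leNgt a2.
apply: le_trans (fa.2 q); apply: ler_sum => i _; apply: tree_content_le => //.
move=> x Ex xq; have xq' : code x (size q) = q by case: xq.
have [k qk Hk] := ca x Ex xq'; exists k => //=.
rewrite ltn_neqAle qk andbT; apply: contraTneq Hk => <-.
by rewrite xq' -ltNge.
Qed.

Fixpoint stopped al q :=
  if q is _ :: q' then (wt q' <= al q') || stopped al q' else false.

Definition truncate al q := if stopped al q then 0 else al q.

(** Cutting a weak flow below the nodes where it first reaches the weight removes the places where
    superadditivity may fail; by [truncate_stop] the points that were covered remain covered. *)
Lemma truncate_flow al : weak_flow al -> flow (truncate al).
Proof.
move=> [a0 aw]; split=> q; rewrite /truncate; first by case: ifP.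
rewrite /=; case: (boolP (wt q <= al q)) => [st|nst] /=.
  by rewrite big1 //; case: ifP.
by case: ifP => _; [rewrite big1 | case: (aw q) => // /(negP nst)].
Qed.

Lemma stopped_code al x k :
  stopped al (code x k) -> exists2 j, (j < k)%N & wt (code x j) <= al (code x j).
Proof.
elim: k => //= k IH /orP[H|/IH[j jk H]]; first by exists k.
by exists j => //; rewrite ltnS ltnW.
Qed.

Lemma truncate_stop al x : (exists k, wt (code x k) <= al (code x k)) ->
  exists k, wt (code x k) <= truncate al (code x k).
Proof.
move=> ex; case: (ex_minnP (P := fun k => wt (code x k) <= al (code x k)) ex) => k Hk kmin.
exists k; rewrite /truncate; case: ifP => // /stopped_code[j jk Hj].
by have := kmin j Hj; rewrite leqNgt jk.
Qed.

Fixpoint first_stop al q : option (seq D) :=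
  if q is _ :: q' then
    if first_stop al q' is Some p then Some p
    else if wt q <= al q then Some q else None
  else if wt q <= al q then Some q else None.

(** A covering strategy in two stages: follow [th * al] until [al] reaches the weight at a node
    [p], then continue with the strategy [B p] below [p]. *)
Definition glue (th : R) al (B : seq D -> seq D -> R) q : R :=
  if first_stop al q is Some p then B p q else th * al q.

Lemma glue_flow th al B : 0 <= th -> flow al -> (forall p, flow (B p)) ->
  (forall p, B p p <= th * wt p) -> flow (glue th al B).
Proof.
move=> th0 [a0 aS] fB HB; split=> q; rewrite /glue.
  by case: first_stop => [p|]; [case: (fB p) | rewrite mulr_ge0].
rewrite /=; case: (first_stop al q) => [p|]; first by case: (fB p).
apply: le_trans (ler_wpM2l th0 (aS q)); rewrite mulr_sumr; apply: ler_sum => i _.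
by case: ifP => // H; apply: le_trans (HB _) _; rewrite ler_wpM2l.
Qed.

Lemma first_stop_code al x : (exists k, wt (code x k) <= al (code x k)) ->
  exists j, forall m, (j <= m)%N -> first_stop al (code x m) = Some (code x j).
Proof.
move=> ex; case: (ex_minnP (P := fun k => wt (code x k) <= al (code x k)) ex) => j Hj jmin.
exists j => m /subnK <-; elim: (m - j)%N => [|l /= -> //]; rewrite add0n.
case: j Hj jmin => [|j] Hj jmin /=; first by rewrite Hj.
case E : (first_stop al (code x j)) => [p|]; last by rewrite Hj.
suff [i ij] : exists2 i, (i <= j)%N & wt (code x i) <= al (code x i).
  by move=> /jmin; rewrite leqNgt ltnS ij.
elim: j E {Hj jmin} => [|j IH] /=; first by case: ifP => // H _; exists 0%N.
case: (first_stop al (code x j)) IH => [r|] IH; last first.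
  by case: ifP => // H _; exists j.+1.
by move=> [pr]; have [|i ij Hi] := IH; [rewrite pr | exists i => //; apply: leqW].
Qed.

(** A set with content at most [th < 1] times the weight at every node can be covered more cheaply
    by refining, with [glue], any given cover: its content [c] satisfies [c <= th' * c] for some
    [th' < 1]. *)
Lemma tree_content_null E (th : R) : 0 <= th < 1 -> (forall q, tree_content E q <= th * wt q) ->
  tree_content E [::] = 0.
Proof.
move=> /andP[th0 th1] H; apply/eqP; rewrite eq_le tree_content_ge0 andbT.
set th' := (th + 1) / 2; have th'1 : th < th' < 1 by rewrite /th'; lra.
have th'0 : 0 <= th' by lra.
have /choice[B HB] p : exists B, [/\ flow B, covers E p B & B p <= th' * wt p].
  have : tree_content E p < th' * wt p.
    by apply: le_lt_trans (H p) _; rewrite ltr_pM2r ?wt_gt0 //; lra.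
  by move=> /tree_content_lt[B [? ? /ltW ?]]; exists B.
suff : tree_content E [::] <= th' * tree_content E [::] by have := tree_content_ge0 E [::]; nra.
rewrite -ler_pdivrMl; last by lra.
apply: lb_le_inf; first by have [] := tree_content_has_inf E [::].
move=> _ [al [fa ca] <-]; rewrite ler_pdivrMl; last by lra.
apply: (@le_trans _ _ (glue th' al B [::])); last first.
  rewrite /glue /=; case: ifP => // Ha.
  by have [_ _ HB0] := HB [::]; apply: le_trans HB0 _; rewrite ler_wpM2l.
apply: tree_content_le; first by apply: glue_flow => // p; have [] := HB p.
move=> x Ex _; have [k _ Hk] := ca x Ex erefl.
have [j Hj] := first_stop_code (ex_intro (fun k => wt (code x k) <= al (code x k)) k Hk).
have [fB cB _] := HB (code x j).
have [|m jm Hm] := cB x Ex; first by rewrite size_code.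
rewrite size_code in jm.
by exists m => //; rewrite /glue Hj.
Qed.

Lemma flow_series (z : nat -> seq D -> R) c : (forall n, flow (z n)) ->
  (forall n, \sum_(0 <= m < n) z m [::] <= c) ->
  exists al, [/\ flow al, forall n q, z n q <= al q & al [::] <= c].
Proof.
move=> fz Hc; pose S q n := \sum_(0 <= m < n) z m q.
have S0 n q : 0 <= S q n by apply: sumr_ge0 => m _; case: (fz m).
have Sc n q : S q n <= c.
  by apply: le_trans (Hc n); apply: ler_sum => m _; apply: flow_root.
exists (fun q => sup (range (S q))); split.
- split=> q; first by apply: le_trans (S0 0%N q) _; apply: (sup_range_ge (c := c)).
  apply: (@sum_sup_le R D (fun n i => S (i :: q) n)) => // [n i|n].
    by rewrite /S big_nat_recr //= lerDl; case: (fz n).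
  apply: le_trans (sup_range_ge n (Sc^~ q)); rewrite /S exchange_big /=.
  by apply: ler_sum => m _; case: (fz m).
- move=> n q; apply: le_trans (sup_range_ge n.+1 (Sc^~ q)).
  by rewrite /S big_nat_recr //= lerDr; apply: S0.
- by apply: sup_range_le => m; apply: Sc.
Qed.

Lemma flowD al be : flow al -> flow be -> flow (fun q => al q + be q).
Proof.
move=> [a0 aS] [b0 bS]; split=> q; first by rewrite addr_ge0.
by rewrite big_split lerD.
Qed.

Lemma sum_halves (d : R) n : 0 <= d -> \sum_(0 <= m < n) d / 2 ^+ m.+1 <= d.
Proof.
move=> d0; suff -> : \sum_(0 <= m < n) d / 2 ^+ m.+1 = d - d / 2 ^+ n.
  by rewrite gerBl mulr_ge0 // invr_ge0 exprn_ge0.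
elim: n => [|n IH]; first by rewrite big_geq // expr0 divr1 subrr.
by rewrite big_nat_recr //= IH exprS; field; rewrite expf_eq0 pnatr_eq0 andbF.
Qed.

(** The increasing-sets property of the content.  The supremum [be] of the contents of the [E n]
    is superadditive wherever it is below the weight, hence so is [be / th] with [th] slightly
    below [1].  Stopping where [be / th] reaches the weight covers all points except those at
    which each content stays below [th] times the weight; these form null sets by
    [tree_content_null] and cost arbitrarily little. *)
Lemma tree_content_bigcup (E : nat -> set X) c : (forall n, E n `<=` E n.+1) ->
  (forall n, tree_content (E n) [::] <= c) -> tree_content (\bigcup_n E n) [::] <= c.
Proof.
move=> mono Hc; have c0 : 0 <= c by apply: le_trans (Hc 0%N); apply: tree_content_ge0.
apply/ler_addgt0Pr => e e0; set d := e / 3.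
have d0 : 0 < d by rewrite /d; lra.
(* Chosen so that dividing the bound [c] by [th] costs less than [2 d]. *)
set th := (c + d) / (c + 2 * d).
have den : 0 < c + 2 * d by lra.
have th0 : 0 < th by rewrite divr_gt0 //; lra.
have th1 : th < 1 by rewrite ltr_pdivrMr // mul1r; lra.
pose be q := sup (range (fun n => tree_content (E n) q)).
have leb n q : tree_content (E n) q <= be q.
  by apply: (sup_range_ge (c := wt q)) => m; apply: tree_content_le_wt.
have be0 q : 0 <= be q by apply: le_trans (leb 0%N q); apply: tree_content_ge0.
pose al0 q := be q / th.
have thal q : be q = th * al0 q by rewrite /al0 mulrCA divff ?mulr1 // gt_eqF.
have al00 q : 0 <= al0 q by rewrite divr_ge0 // ltW.
have wf : weak_flow al0.
  split=> q; first by rewrite divr_ge0 // ltW.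
  have [|lt] := leP (wt q) (al0 q); first by left.
  right; rewrite -mulr_suml ler_wpM2r ?invr_ge0 ?(ltW th0) //.
  apply: (@sum_sup_le R D (fun n i => tree_content (E n) (i :: q))).
  - by move=> n i; apply: tree_content_mono.
  - by move=> n i; apply: tree_content_ge0.
  move=> n; apply: le_trans (leb n q); apply: tree_content_children.
  apply: le_lt_trans (leb n q) _; rewrite thal.
  by apply: le_lt_trans lt; rewrite ler_piMl // ltW.
(* The points of [E n] at which the lowered threshold is never reached. *)
pose Z n := [set x | E n x /\ forall k, al0 (code x k) < wt (code x k)].
have Z0 n : tree_content (Z n) [::] = 0.
  apply: (@tree_content_null _ th); first by rewrite ltW.
  move=> q; have [[x [[Ex Hx] xq]]|no] := pselect (exists x, Z n x /\ code x (size q) = q).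
    apply: (@le_trans _ _ (tree_content (E n) q)); first by apply: tree_content_mono => y [].
    apply: le_trans (leb n q) _; rewrite thal ler_wpM2l ?(ltW th0) //.
    by have := Hx (size q); rewrite xq => /ltW.
  rewrite tree_content_empty => [|x Zx xq]; last by apply: no; exists x.
  by apply: mulr_ge0; apply: ltW => //; apply: wt_gt0.
have /choice[z Hz] n : exists al, [/\ flow al, covers (Z n) [::] al & al [::] < d / 2 ^+ n.+1].
  by apply: tree_content_lt; rewrite Z0 divr_gt0 // exprn_gt0.
have [|m|al [fal zal ald]] := @flow_series z d.
- by move=> n; have [] := Hz n.
- apply: le_trans (sum_halves m (ltW d0)); apply: ler_sum => n _.
  by have [_ _ /ltW] := Hz n.
apply: (@le_trans _ _ (truncate al0 [::] + al [::])).
  apply: (@tree_content_le _ [::] (fun q => truncate al0 q + al q)).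
    by apply: flowD => //; apply: truncate_flow.
  move=> x [n _ Ex] _.
  have [st|nst] := pselect (exists k, wt (code x k) <= al0 (code x k)).
    have [k Hk] := truncate_stop st; exists k => //.
    by rewrite (le_trans Hk) // lerDl; case: fal.
  have [_ cz _] := Hz n; have [|k _ Hk] := cz x _ erefl.
    by split=> // k; rewrite ltNge; apply/negP => Hk; apply: nst; exists k.
  exists k => //; apply: le_trans Hk _; apply: le_trans (zal n _) _.
  by rewrite lerDr; case: (truncate_flow wf).
rewrite [truncate _ _]/=.
have bec : be [::] <= c by apply: sup_range_le.
have : be [::] / th <= c + 2 * d.
  rewrite ler_pdivrMr //; apply: le_trans bec _.
  rewrite /th mulrCA divff ?mulr1 ?gt_eqF //; lra.
rewrite /truncate /= -/(al0 [::]).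
have -> : e = 3 * d by rewrite /d; field.
rewrite /al0; lra.
Qed.
End Tree.

(** * Maximal flows: measures dominated by the weight *)

Section Levels.
Variables (D : finType).

Fixpoint level n : seq (seq D) :=
  if n is m.+1 then [seq i :: q | q <- level m, i <- enum D] else [:: [::]].

Lemma sum_levelS (V : nmodType) n (F : seq D -> V) :
  \sum_(q <- level n.+1) F q = \sum_(q <- level n) \sum_i F (i :: q).
Proof. by rewrite big_allpairs_dep; apply: eq_bigr => q _; rewrite big_enum. Qed.

Lemma mem_level n q : (q \in level n) = (size q == n).
Proof.
elim: n q => [|n IH] q; first by rewrite inE size_eq0.
apply/allpairsPdep/eqP => [[p [i [pn _ ->]]]|] /=; first by move: pn; rewrite IH => /eqP ->.
by case: q => // i q [qn]; exists q, i; rewrite IH qn eqxx mem_enum.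
Qed.

Lemma uniq_level n : uniq (level n).
Proof.
elim: n => // n IH; apply: allpairs_uniq => //; first exact: enum_uniq.
by move=> [p i] [q j] _ _ /= [-> ->].
Qed.

Lemma sum_level_drop (R : pzRingType) n j (mu : seq D -> R) (phi : seq D -> R) :
  (forall q, (size q < n)%N -> \sum_i mu (i :: q) = mu q) -> (j <= n)%N ->
  \sum_(q <- level n) mu q * phi (drop (n - j) q) = \sum_(p <- level j) mu p * phi p.
Proof.
elim: n => [|n IH] Hmu; first by rewrite leqn0 => /eqP ->; apply: eq_bigr => q _; rewrite drop0.
rewrite leq_eqVlt => /orP[/eqP ->|].
  by rewrite subnn; apply: eq_bigr => q _; rewrite drop0.
rewrite ltnS => jn; rewrite -IH // => [|q qn]; last by rewrite Hmu // ltnW.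
rewrite sum_levelS big_seq [RHS]big_seq; apply: eq_bigr => q; rewrite mem_level => /eqP qn.
by rewrite subSn //= -mulr_suml Hmu // qn.
Qed.
End Levels.

Section Frostman.
Variables (R : realType) (D : finType) (lam : R) (X : Type) (digit : X -> nat -> D).
Hypothesis lam0 : 0 < lam.
Variable A : set X.
Implicit Types (q : seq D).

Let wt := wt lam (D := D).

(** The capacity of a minimal cut between [q] and the nodes [m] levels below [q] that meet [A]. *)
Fixpoint cut m q : R :=
  if m is m'.+1 then Num.min (wt q) (\sum_i cut m' (i :: q))
  else if `[< exists2 x, A x & code digit x (size q) = q >] then wt q else 0.

Lemma cut_ge0 m q : 0 <= cut m q.
Proof.
elim: m q => [|m IH] q /=; first by case: ifP => // _; apply: ltW (wt_gt0 _ _).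
by rewrite le_min (ltW (wt_gt0 _ _)) // sumr_ge0.
Qed.

Lemma cut_le m q : cut m q <= wt q.
Proof.
case: m => [|m] /=; last by rewrite ge_min lexx.
by case: ifP => // _; apply: ltW (wt_gt0 _ _).
Qed.

(** The capacities form a weak flow that reaches the weight at every node of depth [n] meeting
    [A], so they compete in the infimum that defines the content. *)
Lemma tree_content_le_cut n : tree_content lam digit A [::] <= cut n [::].
Proof.
pose al q := if (size q <= n)%N then cut (n - size q) q else 0.
have -> : cut n [::] = truncate lam al [::] by rewrite /truncate /= /al subn0.
apply: tree_content_le => //.
  have al0 q : 0 <= al q by rewrite /al; case: ifP => // _; apply: cut_ge0.
  apply: truncate_flow => //; split=> // q.
  have [qn|qn] := leqP n (size q).
    right; rewrite big1 // => i _; rewrite /al ifN //=; lia.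
  rewrite /al (ltnW qn); case E : (n - size q)%N => [|m]; first lia.
  rewrite (eq_bigr (fun i => cut m (i :: q))) => [|i _]; last first.
    have -> : (size (i :: q) <= n)%N by rewrite /=; lia.
    by congr (cut _ _); rewrite /=; lia.
  rewrite /=; set S := \sum_i _; case: (leP (wt q) S) => H; [by left | by right].
move=> x Ax _; have [|k Hk] := @truncate_stop R D lam X digit al x; last by exists k.
exists n; rewrite /al size_code leqnn subnn /= asboolT //.
by exists x => //; rewrite size_code.
Qed.

(** The flow that realises the cut: the mass of a node is shared among its children in proportion
    to their capacities. *)
Fixpoint mass n q : R :=
  if q is i :: p then
    mass n p * (cut (n - size q) q / \sum_j cut (n - size q) (j :: p))
  else cut n [::].

Lemma mass_bounds n q : (size q <= n)%N -> 0 <= mass n q <= cut (n - size q) q.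
Proof.
elim: q => [|i p IH] /= pn; first by rewrite subn0 lexx cut_ge0.
have /andP[m0 m1] := IH (ltnW pn).
set S := \sum_j _; have S0 : 0 <= S by apply: sumr_ge0 => j _; apply: cut_ge0.
have mS : mass n p <= S.
  apply: le_trans m1 _; have -> : (n - size p)%N = (n - (size p).+1).+1 by lia.
  by rewrite /= ge_min lexx orbT.
set c := cut _ _; have c0 : 0 <= c by apply: cut_ge0.
rewrite mulr_ge0 ?divr_ge0 //=.
have [S00|Sn0] := eqVneq S 0; first by rewrite S00 invr0 !mulr0.
have Sp : 0 < S by rewrite lt0r Sn0.
by rewrite mulrCA ler_piMr // ler_pdivrMr // mul1r.
Qed.

Lemma mass_children n q : (size q < n)%N -> \sum_i mass n (i :: q) = mass n q.
Proof.
move=> qn /=; pose S := \sum_j cut (n - (size q).+1) (j :: q).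
rewrite -mulr_sumr -mulr_suml -/S.
have [S0|Sn0] := eqVneq S 0; last by rewrite divff ?mulr1.
rewrite S0 mul0r mulr0.
have /andP[m0] := mass_bounds (ltnW qn).
have -> : (n - size q)%N = (n - (size q).+1).+1 by lia.
rewrite /= -/S S0 => m1; apply/eqP; rewrite eq_le m0 /=.
by apply: le_trans m1 _; rewrite ge_min lexx orbT.
Qed.

(** A finite form of Frostman's lemma: the maximal flow attains the minimal cut, and it only
    charges nodes of depth [n] which meet [A]. *)
Lemma frostman n : exists mu : seq D -> R,
  [/\ forall q, (size q <= n)%N -> 0 <= mu q <= wt q,
     forall q, (size q < n)%N -> \sum_i mu (i :: q) = mu q,
     tree_content lam digit A [::] <= mu [::] &
     forall q, size q = n -> 0 < mu q -> exists2 x, A x & code digit x n = q].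
Proof.
exists (mass n); split.
- move=> q qn; have /andP[-> /= H] := mass_bounds qn.
  exact: le_trans H (cut_le _ _).
- exact: mass_children.
- exact: tree_content_le_cut.
move=> q qn; have /andP[_] := mass_bounds (eq_leq qn).
rewrite qn subnn /=; case: ifPn => [/asboolP[x Ax]|_ le0].
  by rewrite qn => xq _ _; exists x.
by move=> /lt_le_trans /(_ le0); rewrite ltxx.
Qed.
End Frostman.

(** * Dyadic cubes: the content is at most the tree content *)

Section Antichain.
Variables (R : realType) (D : finType) (lam : R).
Hypothesis lam0 : 0 < lam.
Variable al : seq D -> R.
Hypothesis fal : flow al.
Implicit Types (p q r : seq D).

Let wt := wt lam (D := D).

Definition first_stop_at q := (wt q <= al q) && ~~ stopped lam al q.

Lemma stopped_cat r p : wt p <= al p -> r != [::] -> stopped lam al (r ++ p).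
Proof.
move=> st; elim: r => // i [|j r] IH _; first by rewrite /= st.
by rewrite -[stopped lam al _]/((wt ((j :: r) ++ p) <= al ((j :: r) ++ p))
  || stopped lam al ((j :: r) ++ p)) IH ?orbT.
Qed.

Lemma antichain_mem m p (s : seq (seq D)) : uniq s -> all first_stop_at s ->
  (forall q, q \in s -> exists2 r, (size r <= m)%N & q = r ++ p) -> p \in s ->
  \sum_(q <- s) wt q <= al p.
Proof.
move=> us fs Hs ps; have /andP[stp _] := allP fs p ps.
have sE q : q \in s -> q = p.
  move=> qs; have [[|i r] _ qE] := Hs q qs => //.
  by have /andP[_ /negP[]] := allP fs q qs; rewrite qE; apply: stopped_cat.
have pe : perm_eq s [:: p].
  by apply: uniq_perm => // q; rewrite inE; apply/idP/eqP => [/sE //|->].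
by rewrite (perm_big _ pe) big_seq1.
Qed.

(** The nodes at which a flow first reaches the weight are pairwise incomparable, so by
    superadditivity the value at a common ancestor pays for all of them. *)
Lemma antichain_sum m p (s : seq (seq D)) : uniq s -> all first_stop_at s ->
  (forall q, q \in s -> exists2 r, (size r <= m)%N & q = r ++ p) ->
  \sum_(q <- s) wt q <= al p.
Proof.
elim: m p s => [|m IH] p s us fs Hs; have [ps|ps] := boolP (p \in s).
- exact: antichain_mem us fs Hs ps.
- case: s us fs Hs ps => [|q s] us fs Hs ps; first by rewrite big_nil; case: fal.
  have [|[|i r] // _ qE] := Hs q; first exact: mem_head.
  by case/negP: ps; rewrite -[p]/([::] ++ p) -qE mem_head.
- exact: antichain_mem us fs Hs ps.
have Hs' q : q \in s -> exists i, exists2 r, (size r <= m)%N & q = r ++ i :: p.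
  move=> qs; have [r rm qE] := Hs q qs.
  case/lastP: r rm qE => [|r i] rm qE; first by rewrite qE in qs; rewrite qs in ps.
  by exists i, r; [move: rm; rewrite size_rcons | rewrite qE cat_rcons].
apply: le_trans (fal.2 p).
apply: (@le_trans _ _ (\sum_(q <- s) \sum_i (if suffix (i :: p) q then wt q else 0))).
  rewrite big_seq [leRHS]big_seq; apply: ler_sum => q qs.
  have [i [r _ qE]] := Hs' q qs.
  rewrite (bigD1 i) //= {2}qE suffix_suffix lerDl sumr_ge0 // => j _.
  by case: ifP => // _; apply: ltW (wt_gt0 _ _).
rewrite exchange_big /=; apply: ler_sum => i _; rewrite -big_mkcond -big_filter.
apply: IH; first exact: filter_uniq.
  by apply/allP => q; rewrite mem_filter => /andP[_] /(allP fs).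
move=> q; rewrite mem_filter => /andP[/suffixP[r' qE] qs].
have [j [r rm qE']] := Hs' q qs; exists r' => //.
have := congr1 size qE; rewrite qE' !size_cat /=; lia.
Qed.

End Antichain.

Lemma truncn_half (R : realType) (z : R) : 0 <= z -> Num.truncn z = (Num.truncn (2 * z))./2.
Proof.
move=> z0; apply: truncn_def; have z2 : 0 <= 2 * z by rewrite mulr_ge0.
have /andP[] := truncn_itv z2; set n := Num.truncn _.
have := odd_double_half n; set m := n./2; set b := odd n => nE.
rewrite -nE -!natr1 natrD -muln2 natrM; case: b {nE} => /=; lra.
Qed.

Section Cubes.
Variables (R : realType) (d : nat) (Q : dyadic_cube d).
Implicit Types (x : 'rV[R]_d) (i : 'I_d).
Let D := {ffun 'I_d -> bool}.
Implicit Types (q : seq D).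

(** Coordinates in which [Q] is the unit cube. *)
Definition ncoord x i : R := x 0 i / side R Q - (dyadic_index Q i)%:~R.

(** The minimum puts the points of the upper faces of [Q], where the truncation would be [2 ^ k],
    into the last cell. *)
Definition cell x k i : nat := minn (Num.truncn (2 ^+ k * ncoord x i)) (2 ^ k).-1.

Definition digits x k : D := [ffun i => odd (cell x k.+1 i)].

(** The integer whose binary expansion is the [i]-th coordinate of the word, the head of the word
    being the units digit. *)
Fixpoint idx q i : nat := if q is b :: p then (idx p i).*2 + b i else 0.

Lemma side_gt0 (Q' : dyadic_cube d) : 0 < side R Q'.
Proof. exact: exprz_gt0. Qed.

Lemma ncoord_itv x i : cube_set R Q x -> 0 <= ncoord x i <= 1.
Proof.
move=> /(_ i) /andP[x0 x1]; have s0 := side_gt0 Q; rewrite /ncoord.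
rewrite subr_ge0 lerBlDl ler_pdivlMr // ler_pdivrMr // mulrC x0 /= mulrC.
by rewrite intrD in x1.
Qed.

Lemma cell0 x i : cell x 0 i = 0%N.
Proof. by rewrite /cell expn0 minn0. Qed.

Lemma cell_half x k i : cube_set R Q x -> cell x k i = (cell x k.+1 i)./2.
Proof.
move=> /(ncoord_itv i) /andP[y0 y1]; rewrite /cell.
rewrite truncn_half ?mulr_ge0 ?exprn_ge0 // mulrA -exprS.
set n := Num.truncn _; have : (0 < 2 ^ k)%N by rewrite expn_gt0.
rewrite expnS; move: (2 ^ k)%N => M M0; rewrite /minn.
by case: ltnP => H1; case: ltnP => H2; lia.
Qed.

Lemma idx_code x k i : cube_set R Q x -> idx (code digits x k) i = cell x k i.
Proof.
move=> Qx; elim: k => [|k IH]; first by rewrite cell0.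
by rewrite /= IH ffunE (cell_half k i Qx) addnC odd_double_half.
Qed.

Lemma cell_itv x k i : cube_set R Q x ->
  (cell x k i)%:R <= 2 ^+ k * ncoord x i <= (cell x k i).+1%:R.
Proof.
move=> /(ncoord_itv i) /andP[y0 y1].
have z0 : 0 <= 2 ^+ k * ncoord x i by rewrite mulr_ge0 // exprn_ge0.
have /andP[t0 t1] := truncn_itv z0; rewrite /cell; set n := Num.truncn _ in t0 t1 *.
apply/andP; split; first by apply: le_trans t0; rewrite ler_nat geq_minl.
rewrite /minn; case: ifP => _; first exact: ltW.
rewrite prednK ?expn_gt0 // natrX; rewrite -[leRHS]mulr1 ler_wpM2l // exprn_ge0 //.
Qed.

Definition subcube q : dyadic_cube d := DyadicCube (dyadic_scale Q - (size q)%:Z)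
  (fun i => 2 ^+ size q * dyadic_index Q i + (idx q i)%:Z).

Lemma side_subcube q : side R (subcube q) = side R Q / 2 ^+ size q.
Proof. by rewrite /side /= expfzDr // -exprnN. Qed.

Lemma mem_subcube x k : cube_set R Q x -> cube_set R (subcube (code digits x k)) x.
Proof.
move=> Qx i; rewrite side_subcube /= size_code idx_code //.
have /andP[] := cell_itv k i Qx; rewrite /ncoord -natr1.
set c := cell x k i; set s := side R Q; have s0 : 0 < s := side_gt0 Q.
have p0 : 0 < 2 ^+ k :> R by rewrite exprn_gt0.
rewrite !intrD intrM rmorphXn /=; set l := _%:~R; set P := 2 ^+ k in p0 *.
have -> : P * (x 0 i / s - l) = (P * x 0 i) / s - P * l by ring.
rewrite lerBrDl lerBlDl ler_pdivlMr // ler_pdivrMr // => H1 H2.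
rewrite mulrAC ler_pdivrMr // mulrAC ler_pdivlMr //.
apply/andP; split; move: H1 H2; rewrite -!pmulrn; nra.
Qed.

Lemma powR_side (s : R) q : side R (subcube q) `^ s = side R Q `^ s * wt (2 `^ (- s)) q.
Proof.
have s0 := side_gt0 Q.
rewrite side_subcube powRM ?invr_ge0 ?exprn_ge0 ?(ltW s0) //; congr (_ * _).
have -> : (2 ^+ size q)^-1 = 2 `^ (- (size q)%:R) :> R by rewrite powRN powR_mulrn.
transitivity ((2 `^ (- s)) `^ (size q)%:R : R); last by apply: powR_mulrn; apply: powR_ge0.
rewrite -[LHS]powRrM -[RHS]powRrM; congr (_ `^ _).
by rewrite mulrC mulrN mulNr mulrC.
Qed.

(** Cubes for filling the unused indices of a countable cover at a negligible cost. *)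
Definition tiny N : dyadic_cube d := DyadicCube (- N%:Z) (fun=> 0).

Lemma powR_tiny (s : R) N : 1 <= s -> side R (tiny N) `^ s <= 2 ^- N.
Proof.
move=> s1; have -> : side R (tiny N) = 2 ^- N by rewrite /side /= exprnN.
have -> : 2 ^- N = 2 `^ (- N%:R) :> R by rewrite powRN powR_mulrn.
rewrite -powRrM ler_powR //; first by lra.
by rewrite mulNr lerN2 ler_peMr.
Qed.

(** The nodes at which a nearly optimal flow first reaches the weight give a cover of [E] by
    subcubes of [Q], and their weights are summed by [antichain_sum]. *)
Lemma dyadic_content_le (s : R) (E : set 'rV[R]_d) : 1 <= s ->
  (dyadic_content s (E `&` cube_set R Q) <=
   (side R Q `^ s * tree_content (2 `^ (- s)) digits (E `&` cube_set R Q) [::])%:E)%E.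
Proof.
move=> s1; set lam := 2 `^ (- s); have lam0 : 0 < lam by rewrite powR_gt0.
set A := E `&` _; set l := side R Q `^ s; have l0 : 0 < l by rewrite powR_gt0 // side_gt0.
apply/lee_addgt0Pr => e e0.
have [al [fal cal alc]] : exists al, [/\ flow al, covers lam digits A [::] al
    & al [::] < tree_content lam digits A [::] + e / 2 / l].
  by apply: tree_content_lt => //; rewrite ltrDl !divr_gt0.
have [M HM] : exists M : nat, 2 ^- M <= e / 4.
  exists (Num.truncn (4 / e)); apply: ltW.
  have : 4 / e < (2 ^ Num.truncn (4 / e))%:R.
    apply: lt_le_trans (truncnS_gt _) _; rewrite ler_nat; exact: ltn_expl.
  rewrite natrX => H; rewrite -[ltRHS]invrK ltf_pV2 ?posrE ?invr_gt0 ?divr_gt0 ?exprn_gt0 //.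
  by rewrite invf_div.
(* The cover is indexed by all integers: [n] stands for the node that it encodes when this is a
   first stop, and receives a tiny cube otherwise. *)
pose sel n : option (seq D) := if pickle_inv n is Some q then
  (if first_stop_at lam al q then Some q else None) else None.
pose C n := if sel n is Some q then subcube q else tiny (n + M).
apply: ge_ereal_inf; exists (\sum_(i <oo) (side R (C i) `^ s)%:E)%E.
  exists C => //= x Ax; have [k _ Hk] := cal x Ax erefl.
  have ex : exists k, wt lam (code digits x k) <= al (code digits x k) by exists k.
  case: (ex_minnP (P := fun k => wt lam (code digits x k) <= al (code digits x k)) ex).
  move=> j Hj jmin; exists (pickle (code digits x j)) => //.
  rewrite /C /sel pickleK_inv ifT; first by apply: mem_subcube; case: Ax.
  rewrite /first_stop_at Hj /=; apply/negP => st.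
  have [m mj Hm] := @stopped_code R D lam _ digits al x j st.
  by have := jmin m Hm; rewrite leqNgt mj.
apply: lime_le.
  by apply: is_cvg_nneseries => n _ _; rewrite lee_fin powR_ge0.
apply: nearW => n; rewrite sumEFin lee_fin.
pose nodes := pmap sel (iota 0 n).
have sumsel : \sum_(q <- nodes) wt lam q <= al [::].
  pose m := \max_(q <- nodes) size q.
  apply: (@antichain_sum _ _ _ lam0 _ fal m) => //.
  - apply: (pmap_uniq (g := pickle)) (iota_uniq 0 n) => i.
    rewrite /sel; have := pickle_invK (T := seq D) i.
    by case: pickle_inv => [q|] //=; case: ifP.
  - apply/allP => q; rewrite mem_pmap => /mapP[i _]; rewrite /sel.
    by case: pickle_inv => // r; case: ifP => // fs [->].
  - by move=> q qn; exists q; rewrite ?cats0 // leq_bigmax_seq.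
have sumE (r : seq nat) : \sum_(i <- r) (if sel i is Some q then l * wt lam q else 0) =
    l * \sum_(q <- pmap sel r) wt lam q.
  elim: r => [|i r IH]; first by rewrite !big_nil mulr0.
  by rewrite big_cons IH /=; case: (sel i) => [q|] /=; rewrite ?big_cons ?mulrDr ?add0r.
apply: (@le_trans _ _ (\sum_(0 <= i < n) ((if sel i is Some q then l * wt lam q else 0)
    + e / 2 / 2 ^+ i.+1))).
  apply: ler_sum => i _; rewrite /C; case: (sel i) => [q|].
    by rewrite powR_side lerDl !divr_ge0 ?exprn_ge0 // ltW.
  rewrite add0r; apply: le_trans (powR_tiny _ s1) _.
  rewrite exprD invfM exprS invfM.
  have : 0 <= 2 ^- i :> R by rewrite invr_ge0 exprn_ge0.
  nra.
rewrite big_split /= /index_iota subn0 sumE -/nodes.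
have H2 := sum_halves n (ltW (divr_gt0 e0 (ltr0Sn R 1))).
rewrite /index_iota subn0 in H2.
have := ler_wpM2l (ltW l0) (le_trans sumsel (ltW alc)).
have -> : l * (tree_content lam digits A [::] + e / 2 / l) = l * tree_content lam digits A [::] + e / 2.
  by field; rewrite gt_eqF.
by move=> H1; apply: le_trans (lerD H1 H2) _; lra.
Qed.

End Cubes.

(** * Suslin sets and approximation from inside *)

Section Suslin.
Local Open Scope nat_scope.
Variable (T : topologicalType).
Implicit Types (A : set T) (F : seq nat -> set T) (sg : nat -> nat).

Definition suslin_op F : set T := [set x | exists sg, forall n, F (mkseq sg n) x].

Definition suslin A := exists F, (forall s, closed (F s)) /\ A = suslin_op F.

Lemma closed_suslin A : closed A -> suslin A.
Proof.
move=> cA; exists (fun=> A); split=> //; apply/seteqP; split=> x.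
  by move=> Ax; exists (fun=> 0).
by case=> _ /(_ 0).
Qed.

Lemma mkseq_cons sg n : mkseq sg n.+1 = sg 0 :: mkseq (fun i => sg i.+1) n.
Proof. by rewrite /mkseq /= -[1]addn0 iotaDl -map_comp. Qed.

Lemma suslin_bigcup (A : nat -> set T) :
  (forall n, suslin (A n)) -> suslin (\bigcup_n A n).
Proof.
move=> /choice[F HF]; exists (fun s => if s is i :: s' then F i s' else setT); split.
  move=> [|i s]; first exact: closedT.
  by have [cF _] := HF i; apply: cF.
apply/seteqP; split=> x.
  move=> [i _]; have [_ ->] := HF i; move=> [sg Hsg].
  exists (fun m => if m is m'.+1 then sg m' else i) => -[//|n].
  by rewrite mkseq_cons; apply: Hsg.
move=> [sg Hsg]; exists (sg 0) => //; have [_ ->] := HF (sg 0).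
exists (fun i => sg i.+1) => n.
rewrite (_ : mkseq _ n = map sg (iota 1 n)); first exact: (Hsg n.+1).
by rewrite -[1]addn0 iotaDl -map_comp.
Qed.

(** One sequence of integers encodes, through a pairing function, a whole sequence of them: one
    witness for each of the sets intersected. *)
Lemma suslin_bigcap (A : nat -> set T) :
  (forall n, suslin (A n)) -> suslin (\bigcap_n A n).
Proof.
move=> /choice[F HF]; pose c (i k : nat) := pickle (i, k).
(* [G s] keeps the conditions on the [i]-th witness that only involve terms encoded in [s]. *)
pose G s := \bigcap_i \bigcap_(n in [set n | forall k, k < n -> c i k < size s])
   F i (mkseq (fun k => nth 0 s (c i k)) n).
exists G; split.
  move=> s; apply: closed_bigI => i _; apply: closed_bigI => n _.
  by have [cF _] := HF i; apply: cF.
apply/seteqP; split=> x.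
  move=> Ax; have /choice[sg Hsg] i : exists sg, forall n, F i (mkseq sg n) x.
    by have := Ax i I; have [_ ->] := HF i.
  exists (fun m => if unpickle m is Some (i, k) then sg i k else 0).
  move=> N i _ n Hn; rewrite (_ : mkseq _ n = mkseq (sg i) n) //.
  apply/eq_in_map => k; rewrite mem_iota add0n => /andP[_ kn].
  have := Hn k kn; rewrite size_mkseq => cN.
  by rewrite nth_mkseq // /c pickleK.
move=> [sg Hsg] i _; have [_ ->] := HF i; exists (fun k => sg (c i k)) => n.
have [N cN] : exists N, forall k, k < n -> c i k < N.
  exists (\max_(k < n) c i k).+1 => k kn; rewrite ltnS.
  exact: (leq_bigmax (Ordinal kn)).
have := Hsg N i I n; rewrite /= size_mkseq => /(_ cN).
rewrite (_ : mkseq _ n = mkseq (fun k => sg (c i k)) n) //.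
apply/eq_in_map => k; rewrite mem_iota add0n => /andP[_ kn].
by rewrite nth_mkseq // cN.
Qed.

(** The sets which are Suslin together with their complement form a sigma-algebra. *)
Lemma smallest_suslin (G : set (set T)) :
  (forall A, G A -> suslin A /\ suslin (~` A)) ->
  forall A, (<<s G >>) A -> suslin A.
Proof.
move=> HG A; suff : <<s G >> `<=` [set A | suslin A /\ suslin (~` A)].
  by move=> H /H[].
apply: smallest_sub => //; split.
- split; first by apply: closed_suslin; apply: closed0.
  by rewrite setC0; apply: closed_suslin; apply: closedT.
- by move=> B [sB sB']; rewrite /= setTD setCK.
- move=> B HB; split; first by apply: suslin_bigcup => n; case: (HB n).
  by rewrite setC_bigcup; apply: suslin_bigcap => n; case: (HB n).
Qed.

Definition bounded_part F (b : nat -> nat) n : set T :=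
  [set x | exists sg, (forall i, i < n -> sg i <= b i) /\ forall m, F (mkseq sg m) x].

(** Allowing the next term of the witness to be at most [N] gives a set that increases with [N] to
    the set without this restriction; if [h] is continuous along increasing unions, a large enough
    [N] keeps [h] above [c], and the bounds are chosen one after the other. *)
Lemma bounded_approx (R : realType) (h : set T -> R) F (c : R) :
  (forall (E : nat -> set T) c', (forall n, E n `<=` E n.+1) ->
      (forall n, h (E n) <= c')%R -> (h (\bigcup_n E n) <= c')%R) ->
  (c < h (suslin_op F))%R ->
  exists b, forall n, (c < h (bounded_part F b n))%R.
Proof.
move=> hcup Hc.
pose P s := bounded_part F (nth 0 s) (size s).
have step s : exists N, (c < h (P s))%R -> (c < h (P (rcons s N)))%R.
  have [[N HN]|no] := pselect (exists N, (c < h (P (rcons s N)))%R); first by exists N.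
  exists 0 => Hs; exfalso; suff : (h (P s) <= c)%R by rewrite leNgt Hs.
  have -> : P s = \bigcup_N P (rcons s N).
    apply/seteqP; split=> x.
      move=> [sg [Hsg HF]]; exists (sg (size s)) => //; exists sg; split=> // i.
      rewrite size_rcons ltnS leq_eqVlt nth_rcons => /orP[/eqP ->|is'].
        by rewrite ltnn eqxx.
      by rewrite is' Hsg.
    move=> [N _ [sg [Hsg HF]]]; exists sg; split=> // i is'.
    by have := Hsg i; rewrite size_rcons nth_rcons is' => -> //; rewrite ltnS ltnW.
  apply: hcup => [N x|N]; last by rewrite leNgt; apply/negP => H; apply: no; exists N.
  move=> [sg [Hsg HF]]; exists sg; split=> // i; have := Hsg i.
  rewrite !size_rcons !nth_rcons => H /H; case: (i < size s) => //.
  by case: (i == size s) => // /leqW.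
have /choice[g Hg] := step.
(* The bounds found so far, each one chosen from the previous ones. *)
pose S := fix S n := if n is m.+1 then rcons (S m) (g (S m)) else [::].
pose b n := g (S n).
have Sb n : S n = mkseq b n by elim: n => // n IH; rewrite mkseqS -IH.
exists b => n; have : (c < h (P (S n)))%R.
  elim: n => [|n IH] /=; last exact: Hg.
  rewrite (_ : P [::] = suslin_op F) //; apply/seteqP; split=> x.
    by move=> [sg [_ H]]; exists sg.
  by move=> [sg H]; exists sg.
rewrite (_ : P (S n) = bounded_part F b n) //.
apply/seteqP; split=> x [sg [Hsg HF]]; exists sg; split=> // i.
  by move=> i_n; have := Hsg i; rewrite Sb size_mkseq nth_mkseq // => ->.
by rewrite Sb size_mkseq => i_n; rewrite nth_mkseq // Hsg.
Qed.

Lemma compact_ultra_cvg (U : set_system nat) (K : set T) (x : nat -> T) :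
  UltraFilter U -> compact K -> (forall n, K (x n)) ->
  exists2 p, K p & x @ U --> p.
Proof.
move=> UU cK Kx; have PU : ProperFilter U by apply: ultra_proper.
have [|p [Kp clp]] := cK (x @ U) _.
  by apply: (@filterS _ U _ setT) => [n _ /=|]; [apply: Kx | apply: filterT].
exists p => // N Np; have [//|HN] := in_ultra_setVsetC (x @^-1` N) UU.
by have [y [/= nNy Ny]] := clp (~` N) N HN Np.
Qed.

Lemma bounded_ultra (U : set_system nat) (a : nat -> nat) b :
  UltraFilter U -> U [set n | a n <= b] -> exists c, U [set n | a n = c].
Proof.
move=> UU; have PU : ProperFilter U by apply: ultra_proper.
elim: b => [|b IH] Hb.
  by exists 0; apply: filterS Hb => n /=; rewrite leqn0 => /eqP.
case: (in_ultra_setVsetC [set n | a n <= b] UU) => [/IH //|H].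
exists b.+1; apply: filterS (filterI Hb H) => n [/=] H1 /negP; rewrite -ltnNge => H2.
by apply/eqP; rewrite eqn_leq H1.
Qed.

(** Each term of the witnesses is eventually bounded, hence constant along the ultrafilter; the
    constants form a witness for the limit because the sets [F s] are closed. *)
Lemma bounded_part_limit (U : set_system nat) F b (x : nat -> T) p :
  UltraFilter U -> (forall n, U [set m | n <= m]) -> (forall s, closed (F s)) ->
  (forall n, bounded_part F b n (x n)) -> x @ U --> p -> suslin_op F p.
Proof.
move=> UU Uoo cF Hx xp; have PU : ProperFilter U by apply: ultra_proper.
have /choice[s Hs] := Hx.
have /choice[sg Hsg] i : exists c, U [set n | s n i = c].
  apply: (bounded_ultra (b := b i) UU); apply: filterS (Uoo i.+1) => n /= i_n.
  by have [H _] := Hs n; apply: H.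
exists sg => m; apply: (@closed_cvg _ _ U _ x (F (mkseq sg m)) (cF _) _ p xp).
have Hm : U [set n | forall i, i < m -> s n i = sg i].
  elim: m => [|m IH]; first by apply: filterS filterT.
  apply: filterS (filterI IH (Hsg m)) => n [/= H1 H2] i.
  by rewrite ltnS leq_eqVlt => /orP[/eqP ->|/H1].
apply: filterS Hm => n /= Hn; have [_ /(_ m)] := Hs n.
rewrite (_ : mkseq (s n) m = mkseq sg m) //.
by apply/eq_in_map => i; rewrite mem_iota add0n => /andP[_ /Hn].
Qed.
End Suslin.

(** In a space with a metric, an open set is a countable union of closed sets. *)
Lemma open_suslin (R : realType) (T : pseudoMetricType R) (A : set T) :
  open A -> suslin A.
Proof.
move=> oA; pose e n : R := (n.+1%:R^-1)%R.
have e0 n : (0 < e n)%R by rewrite invr_gt0 ltr0n.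
pose Dn n := [set x | ball x (e n) `<=` A].
rewrite (_ : A = \bigcup_n closure (Dn n)).
  by apply: suslin_bigcup => n; apply: closed_suslin; apply: closed_closure.
apply/seteqP; split=> x.
  move=> Ax; have := open_nbhs_nbhs (conj oA Ax); rewrite -nbhs_ballE => -[d /= d0 dA].
  have [n nd] : exists n, (e n < d)%R.
    exists (Num.truncn d^-1)%R; rewrite /e invf_plt ?posrE ?ltr0n //.
    exact: truncnS_gt.
  exists n => //; apply: subset_closure => y xy; apply: dA.
  by apply: le_ball xy; apply: ltW.
move=> [n _] /(_ (ball x (e n))) [|y [Dy xy]]; first exact: nbhsx_ballx.
by apply: Dy; apply: ball_sym.
Qed.

(** * Averages of functions on a finite abelian group *)

Section Translations.
Variables (R : rcfType) (G : finZmodType).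
Implicit Types (f g h : {ffun G -> R^o}) (u v w e : G) (s t : seq G).

Definition ip f g : R := \sum_x (f x : R) * g x.
Definition nrm f : R := Num.sqrt (ip f f).
Definition tau v f : {ffun G -> R^o} := [ffun x => f (x + v)].

Lemma ipC f g : ip f g = ip g f.
Proof. by apply: eq_bigr => x _; rewrite mulrC. Qed.

Lemma ipDl f1 f2 g : ip (f1 + f2) g = ip f1 g + ip f2 g.
Proof. by rewrite -big_split; apply: eq_bigr => x _; rewrite ffunE mulrDl. Qed.

Lemma ipZl a f g : ip (a *: f) g = a * ip f g.
Proof. by rewrite /ip mulr_sumr; apply: eq_bigr => x _; rewrite ffunE mulrA. Qed.

Lemma ipDr f g1 g2 : ip f (g1 + g2) = ip f g1 + ip f g2.
Proof. by rewrite !(ipC f) ipDl. Qed.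

Lemma ipZr a f g : ip f (a *: g) = a * ip f g.
Proof. by rewrite !(ipC f) ipZl. Qed.

Lemma ip0l g : ip 0 g = 0.
Proof. by rewrite -(scale0r g) ipZl mul0r. Qed.

Lemma ip_suml I (r : seq I) (P : pred I) (F : I -> {ffun G -> R^o}) g :
  ip (\sum_(i <- r | P i) F i) g = \sum_(i <- r | P i) ip (F i) g.
Proof.
by elim/big_rec2: _ => [|i y x _ <-]; rewrite ?ip0l ?ipDl.
Qed.

Lemma ip_sumr I (r : seq I) (P : pred I) (F : I -> {ffun G -> R^o}) g :
  ip g (\sum_(i <- r | P i) F i) = \sum_(i <- r | P i) ip g (F i).
Proof. by rewrite ipC ip_suml; apply: eq_bigr => i _; rewrite ipC. Qed.

Lemma ip_ge0 f : 0 <= ip f f.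
Proof. by apply: sumr_ge0 => x _; rewrite -expr2 sqr_ge0. Qed.

Lemma nrm_ge0 f : 0 <= nrm f.
Proof. exact: sqrtr_ge0. Qed.

Lemma nrm_sqr f : nrm f ^+ 2 = ip f f.
Proof. by rewrite sqr_sqrtr ?ip_ge0. Qed.

Lemma ip_eq0 f g : ip f f = 0 -> ip f g = 0.
Proof.
move=> /eqP; rewrite psumr_eq0 => [/allP H|x _]; last by rewrite -expr2 sqr_ge0.
apply: big1 => x _; have := H x (mem_index_enum x).
by rewrite /= mulf_eq0 orbb => /eqP ->; rewrite mul0r.
Qed.

Lemma cauchy_schwarz f g : `|ip f g| <= nrm f * nrm g.
Proof.
rewrite -(@ler_pXn2r _ 2) ?nnegrE ?mulr_ge0 ?nrm_ge0 //.
rewrite exprMn !nrm_sqr real_normK ?num_real //.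
have [f0|f0] := eqVneq (ip f f) 0.
  by rewrite (ip_eq0 _ f0) f0 expr0n /= mul0r.
have fp : 0 < ip f f by rewrite lt0r f0 ip_ge0.
have := ip_ge0 (ip f f *: g + (- ip f g) *: f).
rewrite !ipDl !ipDr !ipZl !ipZr (ipC g f).
set a := ip f f in fp *; set b := ip f g; set c := ip g g => H.
have : 0 <= a * (a * c - b ^+ 2) by move: H; congr (_ <= _); ring.
by rewrite pmulr_rge0 // subr_ge0.
Qed.

Lemma nrmD f g : nrm (f + g) <= nrm f + nrm g.
Proof.
rewrite -(@ler_pXn2r _ 2) ?nnegrE ?addr_ge0 ?nrm_ge0 //.
rewrite nrm_sqr ipDl !ipDr (ipC g f) sqrrD !nrm_sqr.
have := le_trans (ler_norm _) (cauchy_schwarz f g); lra.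
Qed.

Lemma nrmZ a f : nrm (a *: f) = `|a| * nrm f.
Proof.
by rewrite /nrm ipZl ipZr mulrA -expr2 sqrtrM ?sqr_ge0 // sqrtr_sqr.
Qed.

Lemma nrm0 : nrm 0 = 0.
Proof. by rewrite /nrm ip0l sqrtr0. Qed.

Lemma nrmN f : nrm (- f) = nrm f.
Proof. by rewrite -scaleN1r nrmZ normrN1 mul1r. Qed.

Lemma nrmB f g : nrm (f - g) <= nrm f + nrm g.
Proof. by rewrite -(nrmN g) nrmD. Qed.

Lemma nrm_sum I (r : seq I) (P : pred I) (F : I -> {ffun G -> R^o}) :
  nrm (\sum_(i <- r | P i) F i) <= \sum_(i <- r | P i) nrm (F i).
Proof.
elim/big_rec2: _ => [|i y x _ H]; first by rewrite nrm0.
by rewrite (le_trans (nrmD _ _)) // lerD2l.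
Qed.

Lemma nrm_sum_nat m (F : nat -> {ffun G -> R^o}) c :
  (forall i, (i < m)%N -> nrm (F i) <= c) ->
  nrm (\sum_(0 <= i < m) F i) <= m%:R * c.
Proof.
elim: m => [|m IH] H; first by rewrite big_geq // nrm0 mul0r.
rewrite big_nat_recr //= -natr1 mulrDl mul1r.
apply: le_trans (nrmD _ _) _; rewrite lerD ?H // IH // => i im.
by rewrite H // ltnW.
Qed.

Lemma tauD u v f : tau u (tau v f) = tau (u + v) f.
Proof. by apply/ffunP => x; rewrite !ffunE addrA. Qed.

Lemma tau0 f : tau 0 f = f.
Proof. by apply/ffunP => x; rewrite !ffunE addr0. Qed.

Lemma tau_is_linear v : linear (tau v).
Proof. by move=> a f g; apply/ffunP => x; rewrite !ffunE. Qed.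

HB.instance Definition _ v :=
  GRing.isLinear.Build R {ffun G -> R^o} {ffun G -> R^o} _ (tau v) (tau_is_linear v).

Lemma ip_tau v f g : ip (tau v f) (tau v g) = ip f g.
Proof.
rewrite /ip [RHS](reindex_inj (addIr v)) /=.
by apply: eq_bigr => x _; rewrite !ffunE.
Qed.

Lemma ip_taul v f g : ip (tau v f) g = ip f (tau (- v) g).
Proof. by rewrite -(ip_tau (- v)) tauD addNr tau0. Qed.

Lemma nrm_tau v f : nrm (tau v f) = nrm f.
Proof. by rewrite /nrm ip_tau. Qed.

Lemma nrm_taunat e j f : nrm (tau (e *+ j) f - f) <= j%:R * nrm (tau e f - f).
Proof.
elim: j => [|j IH]; first by rewrite mulr0n tau0 subrr nrm0 mul0r.
have -> : tau (e *+ j.+1) f - f =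
    tau (e *+ j) (tau e f - f) + (tau (e *+ j) f - f).
  by rewrite linearB /= tauD -mulrSr addrA subrK.
by rewrite (le_trans (nrmD _ _)) // nrm_tau -natr1 mulrDl mul1r addrC lerD.
Qed.

Definition av s f : {ffun G -> R^o} := (size s)%:R^-1 *: \sum_(v <- s) tau v f.

Lemma av_is_linear s : linear (av s).
Proof.
move=> a f g; rewrite /av scalerA mulrC -scalerA -scalerDr; congr (_ *: _).
rewrite scaler_sumr -big_split; apply: eq_bigr => v _.
by rewrite linearP.
Qed.

HB.instance Definition _ s :=
  GRing.isLinear.Build R {ffun G -> R^o} {ffun G -> R^o} _ (av s) (av_is_linear s).

Lemma av_tau s v f : av s (tau v f) = tau v (av s f).
Proof.
rewrite linearZ linear_sum /=; congr (_ *: _).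
by apply: eq_bigr => w _; rewrite !tauD addrC.
Qed.

Lemma avC s t f : av s (av t f) = av t (av s f).
Proof.
rewrite {2}/av {2}/av linearZ linear_sum /=; congr (_ *: _).
by apply: eq_bigr => w _; rewrite av_tau.
Qed.

Lemma nrm_av_le s c f : 0 <= c -> (forall v, v \in s -> nrm (tau v f) <= c) ->
  nrm (av s f) <= c.
Proof.
move=> c0 H; rewrite /av nrmZ ger0_norm ?invr_ge0 ?ler0n //.
have {}H : nrm (\sum_(v <- s) tau v f) <= (size s)%:R * c.
  elim: s H => [|v s IH] H; first by rewrite big_nil nrm0 mul0r.
  rewrite big_cons /= -natr1 mulrDl mul1r; apply: le_trans (nrmD _ _) _.
  rewrite [leRHS]addrC lerD ?H ?mem_head // IH // => w ws.
  by rewrite H // in_cons ws orbT.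
have [->|s0] := eqVneq (size s) 0%N; first by rewrite invr0 mul0r.
by rewrite ler_pdivrMl // ltr0n lt0n.
Qed.

Lemma nrm_av s f : nrm (av s f) <= nrm f.
Proof. by apply: nrm_av_le; rewrite ?nrm_ge0 // => v _; rewrite nrm_tau. Qed.

Lemma avE s f x :
  (av s f x : R) = (size s)%:R^-1 * \sum_(v <- s) (f (x + v) : R).
Proof.
rewrite ffunE sum_ffunE; congr (_ * _); apply: eq_bigr => v _; exact: ffunE.
Qed.

Lemma av_le s f (c : R) x :
  (0 < size s)%N -> (forall y, (f y : R) <= c) -> (av s f x : R) <= c.
Proof.
move=> s0 H; rewrite avE ler_pdivrMl ?ltr0n // mulr_natl.
elim: s {s0} => [|v s IH]; first by rewrite big_nil mulr0n.
by rewrite big_cons mulrS lerD.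
Qed.

Lemma av_ge0 s f : (forall y, 0 <= (f y : R)) -> forall x, 0 <= (av s f x : R).
Proof.
by move=> H x; rewrite avE mulr_ge0 ?invr_ge0 ?ler0n // sumr_ge0.
Qed.

Lemma av_gt0 s f x :
  0 < (av s f x : R) -> exists2 v, v \in s & 0 < (f (x + v) : R).
Proof.
move=> H.
have [/hasP[v vs fv]|/hasPn nH] := boolP (has (fun v => 0 < (f (x + v) : R)) s).
  by exists v.
suff : (av s f x : R) <= 0 by rewrite leNgt H.
rewrite avE mulr_ge0_le0 ?invr_ge0 ?ler0n // big_seq.
by apply: sumr_le0 => v vs; rewrite leNgt nH.
Qed.

Lemma sum_av s f : (0 < size s)%N -> \sum_x (av s f x : R) = \sum_x (f x : R).
Proof.
move=> s0; under eq_bigr do rewrite avE; rewrite -mulr_sumr exchange_big /=.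
have E v : \sum_x (f (x + v) : R) = \sum_x (f x : R).
  by rewrite [RHS](reindex_inj (addIr v)).
rewrite (eq_bigr (fun=> \sum_x (f x : R))) => [|v _]; last exact: E.
rewrite big_const_seq count_predT iter_addr_0 -[X in _ * X]mulr_natl.
by rewrite mulKf // pnatr_eq0 -lt0n.
Qed.

Definition line e M : seq G := [seq e *+ j | j <- iota 0 M].

Lemma avline e M f : av (line e M) f =
  M%:R^-1 *: \sum_(0 <= j < M) tau (e *+ j) f.
Proof. by rewrite /av size_map size_iota /index_iota subn0 big_map. Qed.

Lemma telescope_tau e J f : \sum_(0 <= j < J) tau (e *+ j) (tau e f - f)
   = tau (e *+ J) f - f.
Proof.
elim: J => [|J IH]; first by rewrite big_geq // mulr0n tau0 subrr.
rewrite big_nat_recr //= IH linearB /= tauD -mulrSr.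
by rewrite addrC addrA subrK.
Qed.

(** Translating a mean over [M] consecutive points by one step only changes the two end terms. *)
Lemma line_smooth e M j h : (0 < M)%N ->
  nrm (tau (e *+ j) (av (line e M) h) - av (line e M) h)
    <= 2 * j%:R / M%:R * nrm h.
Proof.
move=> M0; apply: le_trans (nrm_taunat _ _ _) _.
have -> : tau e (av (line e M) h) - av (line e M) h =
    M%:R^-1 *: (tau (e *+ M) h - h).
  rewrite -av_tau -linearB /= avline; congr (_ *: _).
  exact: telescope_tau.
rewrite nrmZ ger0_norm ?invr_ge0 ?ler0n //.
have := nrmB (tau (e *+ M) h) h; rewrite nrm_tau.
set X := nrm _ => HX.
have Mi : 0 <= M%:R^-1 :> R by rewrite invr_ge0 ler0n.
have -> : 2 * j%:R / M%:R * nrm h = j%:R * (M%:R^-1 * (nrm h + nrm h)) by ring.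
by rewrite ler_wpM2l ?ler0n // ler_wpM2l.
Qed.

Lemma line_cancel_tau e J a h :
  nrm (\sum_(0 <= j < J) tau (e *+ j) (tau (e *+ a) h - h)) <= 2 * a%:R * nrm h.
Proof.
elim: a h => [|a IH] h.
  rewrite mulr0 mul0r big1 ?nrm0 // => j _.
  by rewrite mulr0n tau0 subrr linear0.
have E : tau (e *+ a.+1) h - h = (tau (e *+ a) (tau e h) - tau e h) + (tau e h - h).
  by rewrite addrA subrK tauD -mulrSr.
under eq_bigr do rewrite E linearD /=.
rewrite big_split /= telescope_tau; apply: le_trans (nrmD _ _) _.
have := IH (tau e h); rewrite nrm_tau; have := nrmB (tau (e *+ J) h) h; rewrite nrm_tau.
rewrite -natr1; set X := nrm _; set Y := nrm _; set Z := nrm h; lra.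
Qed.

(** Subtracting its mean over a segment makes the sum of a function along a longer segment
    telescope: only boundary terms remain, whatever the length [J]. *)
Lemma line_cancel e J M h : (0 < M)%N ->
  nrm (\sum_(0 <= j < J) tau (e *+ j) (h - av (line e M) h)) <= 2 * M%:R * nrm h.
Proof.
move=> M0.
have -> : \sum_(0 <= j < J) tau (e *+ j) (h - av (line e M) h) =
   - (M%:R^-1 *: \sum_(0 <= a < M) \sum_(0 <= j < J) tau (e *+ j) (tau (e *+ a) h - h)).
  rewrite exchange_big scaler_sumr -sumrN; apply: eq_bigr => j _ /=.
  transitivity (tau (e *+ j)
      (- (M%:R^-1 *: \sum_(0 <= a < M) (tau (e *+ a) h - h)))); last first.
    by rewrite linearN linearZ linear_sum.
  congr (tau _ _).
  rewrite avline big_split /= scalerDr opprD addrC; congr (_ + _).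
  rewrite sumr_const_nat subn0 -[- h *+ M]scaler_nat scalerA mulVf ?scale1r ?opprK //.
  by rewrite pnatr_eq0 -lt0n.
rewrite nrmN nrmZ ger0_norm ?invr_ge0 ?ler0n // ler_pdivrMl ?ltr0n //.
apply: nrm_sum_nat => a aM; apply: le_trans (line_cancel_tau _ _ _ _) _.
by rewrite ler_wpM2r ?nrm_ge0 // ler_wpM2l // ler_nat ltnW.
Qed.

End Translations.

(** * Cancellation along arithmetic progressions and parabolas *)

Lemma sum_nat_mul (V : nmodType) (q L : nat) (F : nat -> V) :
  \sum_(0 <= u < L) \sum_(0 <= j < q) F (q * u + j)%N = \sum_(0 <= i < q * L) F i.
Proof.
elim: L => [|L IH]; first by rewrite muln0 !big_geq.
rewrite big_nat_recr //= IH mulnS addnC [RHS](big_cat_nat (n := q * L)) ?leq_addr //=.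
congr (_ + _).
rewrite -{2}[(q * L)%N]add0n big_addn addKn.
by apply: eq_bigr => j _; rewrite addnC.
Qed.

Lemma sum_triangle (V : nmodType) (I : nat) (F : nat -> nat -> V) :
  \sum_(0 <= a < I) \sum_(0 <= u < a) F u a
  = \sum_(1 <= z < I) \sum_(0 <= u < I - z) F u (u + z)%N.
Proof.
elim: I => [|I IH]; first by rewrite !big_geq.
rewrite big_nat_recr //= IH; case: I {IH} => [|I]; first by rewrite !big_geq // addr0.
rewrite [RHS]big_nat_recr //= subSnn big_nat1 add0n.
rewrite [X in _ + X]big_nat_recl //= addrA [LHS]addrAC; congr (_ + _).
rewrite [X in _ + X](_ : _ = \sum_(1 <= z < I.+1) F (I.+1 - z)%N I.+1); last first.
  rewrite big_nat_rev /= add0n big_add1 /=.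
  by apply: eq_big_nat => z zI; congr (F _ _); lia.
rewrite -big_split /=; apply: eq_big_nat => z zI.
rewrite (_ : I.+2 - z = (I.+1 - z).+1)%N; last by lia.
by rewrite big_nat_recr //=; congr (_ + F _ _); lia.
Qed.

Lemma zmod_parabola (V : zmodType) (A B C D E : V) :
  A + C - (B + D + E) + (D - (A - B)) = C - E.
Proof.
rewrite !opprD !opprK !addrA [LHS](ACl (2*5*(1*7)*(3*8)*(4*6)))%AC /=.
by rewrite !(subrr, addNr, addr0).
Qed.

Lemma sum_if_ltn (V : nmodType) (c : V) (I Z : nat) :
  \sum_(0 <= z < I) (if (z < Z)%N then c else 0) = c *+ minn I Z.
Proof.
elim: I => [|I IH]; first by rewrite big_geq // min0n.
rewrite big_nat_recr //= IH /minn; case: ltnP => H1; case: ltnP => H2; try lia.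
- by rewrite mulrSr.
- by rewrite (_ : Z = I.+1) ?mulrSr //; lia.
- by rewrite addr0.
Qed.

Section Parabola.
Variables (R : rcfType) (G : finZmodType).
Implicit Types (f g h : {ffun G -> R^o}) (e : G).

(** The function is smooth at scale [M1], much larger than the step [q], so the sum along the
    progression is the [q]-th part of the sum over all points of a segment, where [line_cancel]
    applies. *)
Lemma ap_sum e (M1 M2 q L : nat) h : (0 < M1)%N -> (0 < M2)%N -> (0 < q)%N ->
  nrm (\sum_(0 <= u < L) tau (e *+ (q * u))
     (av (line e M1) (h - av (line e M2) h)))
  <= (4 * q%:R * L%:R / M1%:R + 2 * M2%:R / q%:R) * nrm h.
Proof.
move=> M10 M20 q0; set k := h - av (line e M2) h; set g := av _ k.
have nk : nrm k <= 2 * nrm h.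
  by apply: le_trans (nrmB _ _) _; have := nrm_av (line e M2) h; lra.
have gE : g = av (line e M1) h - av (line e M2) (av (line e M1) h).
  by rewrite /g /k linearB /= avC.
have E : q%:R *: \sum_(0 <= u < L) tau (e *+ (q * u)) g =
   \sum_(0 <= i < q * L) tau (e *+ i) g
   - \sum_(0 <= u < L) tau (e *+ (q * u)) (\sum_(0 <= j < q) (tau (e *+ j) g - g)).
  rewrite -sum_nat_mul -sumrB scaler_sumr; apply: eq_bigr => u _.
  have -> : \sum_(0 <= j < q) tau (e *+ (q * u + j)) g =
      tau (e *+ (q * u)) (\sum_(0 <= j < q) tau (e *+ j) g).
    by rewrite linear_sum; apply: eq_bigr => j _ /=; rewrite tauD mulrnDr.
  by rewrite -linearB sumrB subKr sumr_const_nat subn0 -[g *+ q]scaler_nat [RHS]linearZ.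
have qp : 0 < q%:R :> R by rewrite ltr0n.
have M1p : 0 < M1%:R :> R by rewrite ltr0n.
rewrite -(ler_pM2l qp) -[X in X * nrm _](ger0_norm (ltW qp)) -nrmZ E.
apply: le_trans (nrmB _ _) _.
have H1 : nrm (\sum_(0 <= i < q * L) tau (e *+ i) g) <= 2 * M2%:R * nrm h.
  rewrite gE; apply: le_trans (line_cancel _ _ _ _) _ => //.
  by rewrite ler_wpM2l ?mulr_ge0 ?ler0n // nrm_av.
have H2 : nrm (\sum_(0 <= u < L)
    tau (e *+ (q * u)) (\sum_(0 <= j < q) (tau (e *+ j) g - g))) <=
    L%:R * (q%:R * (2 * q%:R / M1%:R * nrm k)).
  apply: nrm_sum_nat => u _; rewrite nrm_tau; apply: nrm_sum_nat => j jq.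
  apply: le_trans (line_smooth _ _ _ _) _ => //.
  rewrite ler_wpM2r ?nrm_ge0 // ler_wpM2r ?invr_ge0 ?ler0n //.
  by rewrite ler_wpM2l // ler_nat ltnW.
apply: le_trans (lerD H1 H2) _.
have H3 : L%:R * (q%:R * (2 * q%:R / M1%:R * nrm k)) <=
   L%:R * (q%:R * (2 * q%:R / M1%:R * (2 * nrm h))).
  by rewrite !ler_wpM2l ?mulr_ge0 ?invr_ge0 ?ler0n.
apply: le_trans (lerD (lexx _) H3) _; rewrite le_eqVlt; apply/orP; left; apply/eqP.
by field; rewrite !pnatr_eq0 -!lt0n q0 M10.
Qed.

(** Van der Corput's method.  In the square of the sum, the inner product of the terms [u] and [u
    + z] only depends, up to a common translation, on the translate by [2 q z u] in the direction
    [ed], which is linear in [u]: for fixed [z] the sum over [u] is along a progression and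
    [ap_sum] applies.  The differences [z < Z] are estimated trivially. *)
Lemma parabola_sum e ed (M1 M2 q I Z : nat) h :
  (0 < M1)%N -> (0 < M2)%N -> (0 < q)%N -> (0 < Z)%N ->
  nrm (\sum_(0 <= u < I) tau (e *+ u - ed *+ (q * u ^ 2))
     (av (line ed M1) (h - av (line ed M2) h))) ^+ 2
  <= (12 * Z%:R * I%:R + 32 * q%:R * I%:R ^+ 3 / M1%:R
      + 4 * M2%:R * I%:R / (q%:R * Z%:R)) * nrm h ^+ 2.
Proof.
move=> M10 M20 q0 Z0; set g := av _ _.
pose p u := e *+ u - ed *+ (q * u ^ 2).
pose c u a : R := ip (tau (p u) g) (tau (p a) g).
have nh : 0 <= nrm h := nrm_ge0 h.
have ng : nrm g <= 2 * nrm h.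
  apply: le_trans (nrm_av _ _) _.
  by apply: le_trans (nrmB _ _) _; have := nrm_av (line ed M2) h; lra.
have cle u a : c u a <= 4 * nrm h ^+ 2.
  apply: le_trans (ler_norm _) _; apply: le_trans (cauchy_schwarz _ _) _.
  by rewrite !nrm_tau; have := nrm_ge0 g; nra.
have -> : nrm (\sum_(0 <= u < I) tau (p u) g) ^+ 2 =
    \sum_(0 <= a < I) c a a + 2 * \sum_(1 <= z < I) \sum_(0 <= u < I - z) c u (u + z)%N.
  rewrite -(sum_triangle I c) nrm_sqr ip_suml.
  under eq_bigr do rewrite ip_sumr.
  rewrite -/(\sum_(0 <= a < I) \sum_(0 <= u < I) c a u).
  elim: I => [|J IH]; first by rewrite !big_geq // mulr0 addr0.
  rewrite big_nat_recr //= (eq_bigr (fun a => \sum_(0 <= u < J) c a u + c a J)); last first.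
    by move=> a _; rewrite big_nat_recr.
  rewrite big_split /= IH !(big_nat_recr J) //=.
  have -> : \sum_(0 <= u < J) c J u = \sum_(0 <= u < J) c u J.
    by apply: eq_bigr => u _; rewrite /c ipC.
  ring.
(* Both terms are translated so that the second one no longer depends on [u]. *)
have E u z : c u (u + z)%N = ip (tau (ed *+ (2 * q * z * u)) g)
                               (tau (e *+ z - ed *+ (q * z ^ 2)) g).
  rewrite /c -(ip_tau (ed *+ (2 * q * z * u) - p u)) !tauD; congr (ip (tau _ g) (tau _ g)).
    by rewrite subrK.
  rewrite /p mulrnDr (_ : q * (u + z) ^ 2 = q * u ^ 2 + 2 * q * z * u + q * z ^ 2)%N; last lia.
  by rewrite !mulrnDr addrC zmod_parabola.
have {}E z : (Z <= z < I)%N -> \sum_(0 <= u < I - z) c u (u + z)%N <=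
    (16 * q%:R * I%:R ^+ 2 / M1%:R + 2 * M2%:R / (q%:R * Z%:R)) * nrm h ^+ 2.
  move=> /andP[Zz zI]; under eq_bigr do rewrite E.
  rewrite -ip_suml; apply: le_trans (ler_norm _) _.
  apply: le_trans (cauchy_schwarz _ _) _; rewrite nrm_tau.
  have q'0 : (0 < 2 * q * z)%N by rewrite !muln_gt0 q0 (leq_trans Z0 Zz).
  have := ap_sum ed (I - z) h M10 M20 q'0; rewrite -/g; set X := nrm (\sum_(0 <= i < _) _) => HX.
  have {HX} : X <= (8 * q%:R * I%:R ^+ 2 / M1%:R + M2%:R / (q%:R * Z%:R)) * nrm h.
    apply: le_trans HX _; rewrite ler_wpM2r // lerD //.
      rewrite ler_wpM2r ?invr_ge0 ?ler0n // -!natrM -natrX -!natrM ler_nat.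
      have : (I - z <= I)%N by apply: leq_subr.
      nia.
    rewrite -!natrM ler_pdivrMr ?ltr0n // mulrAC ler_pdivlMr ?ltr0n ?muln_gt0 ?q0 //.
    rewrite -!natrM ler_nat; nia.
  have X0 : 0 <= X by apply: nrm_ge0.
  set K := _ + _ => XK.
  have K2 : (16 * q%:R * I%:R ^+ 2 / M1%:R + 2 * M2%:R / (q%:R * Z%:R)) = 2 * K.
    by rewrite /K; ring.
  rewrite K2; apply: (@le_trans _ _ (K * nrm h * (2 * nrm h))); last first.
    by rewrite le_eqVlt; apply/orP; left; apply/eqP; ring.
  by rewrite ler_pM ?nrm_ge0.
have nh2 : 0 <= nrm h ^+ 2 by apply: sqr_ge0.
set K := (16 * q%:R * I%:R ^+ 2 / M1%:R + 2 * M2%:R / (q%:R * Z%:R)) in E.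
have K0 : 0 <= K by rewrite addr_ge0 // !mulr_ge0 ?invr_ge0 ?mulr_ge0 ?exprn_ge0 ?ler0n.
have H1 : \sum_(0 <= a < I) c a a <= I%:R * (4 * nrm h ^+ 2).
  rewrite mulr_natl -[X in _ *+ X]subn0 -sumr_const_nat.
  by apply: ler_sum_nat => a _.
have H2 : \sum_(1 <= z < I) \sum_(0 <= u < I - z) c u (u + z)%N <=
   (Z%:R * (I%:R * 4) + I%:R * K) * nrm h ^+ 2.
  apply: (@le_trans _ _ (\sum_(1 <= z < I)
     ((if (z < Z)%N then I%:R * 4 else 0) + K) * nrm h ^+ 2)).
    apply: ler_sum_nat => z /andP[z1 zI]; case: ifPn => zZ.
      rewrite mulrDl -[leLHS]addr0 lerD ?mulr_ge0 //.
      apply: (@le_trans _ _ (\sum_(0 <= u < I - z) 4 * nrm h ^+ 2)).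
        by apply: ler_sum_nat.
      rewrite sumr_const_nat subn0 -[_ *+ (I - z)]mulr_natl mulrA ler_wpM2r // ler_wpM2r //.
      by rewrite ler_nat leq_subr.
    by rewrite add0r E // zI andbT leqNgt.
  rewrite -mulr_suml ler_wpM2r // big_split /= lerD //; last first.
    by rewrite sumr_const_nat -[K *+ _]mulr_natl ler_wpM2r // ler_nat leq_subr.
  apply: (@le_trans _ _ (\sum_(0 <= z < I) if (z < Z)%N then I%:R * 4 else 0)).
    case: {1 3}I => [|J]; first by rewrite !big_geq.
    by rewrite [leRHS]big_nat_recl // big_add1 /= Z0 lerDr mulr_ge0.
  by rewrite sum_if_ltn -[_ *+ minn _ _]mulr_natl ler_wpM2r ?mulr_ge0 // ler_nat geq_minr.
apply: (le_trans (lerD H1 (ler_wpM2l (ler0n _ 2) H2))).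
have -> : I%:R * (4 * nrm h ^+ 2) + 2 * ((Z%:R * (I%:R * 4) + I%:R * K) * nrm h ^+ 2)
  = (4 * I%:R + 8 * Z%:R * I%:R + 2 * I%:R * K) * nrm h ^+ 2 by ring.
rewrite ler_wpM2r // -[leRHS]addrA lerD //.
  have : 1 <= Z%:R :> R by rewrite ler1n.
  have : 0 <= I%:R :> R by rewrite ler0n.
  nra.
by rewrite le_eqVlt; apply/orP; left; apply/eqP; rewrite /K; ring.
Qed.
End Parabola.

(** * Averages over a graph *)

Lemma sum_cyclic (V : nmodType) (I c : nat) (g : nat -> V) : (0 < I)%N ->
  \sum_(0 <= r < I) g ((c + r) %% I)%N = \sum_(0 <= u < I) g u.
Proof.
case: I => // I _; rewrite !big_mkord.
rewrite [RHS](reindex_inj (addrI (inZp c : 'I_I.+1))) /=.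
by apply: eq_bigr => r _; rewrite modnDml.
Qed.

Section Blocks.
Variables (k W : nat).
Implicit Types (w : {ffun 'I_k -> 'I_W}) (x : {ffun 'I_k -> nat}).

Definition upd x i n : {ffun 'I_k -> nat} := [ffun j => if j == i then n else x j].
Definition emb w : {ffun 'I_k -> nat} := [ffun j => val (w j)].

Lemma block_sum (V : nmodType) (F : {ffun 'I_k -> nat} -> V) (i : 'I_k) (I : nat) :
  (0 < I)%N -> (I %| W)%N ->
  (\sum_w F (emb w)) *+ I
  = \sum_w \sum_(0 <= u < I) F (upd (emb w) i (I * (w i %/ I) + u)%N).
Proof.
move=> I0 /dvdnP[m Wm].
have lt0 (n r : nat) : (n < W -> I * (n %/ I) + (n + r) %% I < W)%N.
  move=> nW; have := divn_eq n I; have := ltn_pmod (n + r) I0; have := ltn_pmod n I0.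
  move: nW; rewrite Wm; set p := (n %/ I)%N; set s := ((_ + _) %% I)%N.
  set s' := (_ %% I)%N => nW ? ? nE; have : (p < m)%N by nia.
  nia.
have lt (n : 'I_W) r : (I * (n %/ I) + (n + r) %% I < W)%N by apply: lt0.
(* Rotating the [i]-th coordinate by [r] inside its block is a permutation of the box. *)
pose sg r w : {ffun 'I_k -> 'I_W} :=
  [ffun j => if j == i then Ordinal (lt (w i) r) else w j].
have sg_inj r : injective (sg r).
  move=> w w' /ffunP E; apply/ffunP => j; have := E j; rewrite !ffunE.
  case: eqP => // -> /(congr1 val) /= {}E; apply: val_inj => /=.
  have Ed : (w i %/ I = w' i %/ I)%N.
    have := congr1 (fun n => n %/ I)%N E; rewrite ![(I * _)%N]mulnC !divnMDl //.
    by rewrite !(divn_small (ltn_pmod _ I0)) !addn0.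
  move: E; rewrite Ed => /addnI /eqP; rewrite eqn_modDr => /eqP Em.
  by rewrite (divn_eq (w i) I) (divn_eq (w' i) I) Ed Em.
transitivity (\sum_(0 <= r < I) \sum_w F (emb (sg r w))).
  rewrite -[X in _ *+ X]subn0 -sumr_const_nat; apply: eq_bigr => r _.
  exact: (reindex_inj (@sg_inj r)).
rewrite exchange_big /=; apply: eq_bigr => w _.
rewrite -(sum_cyclic (w i) (fun u => F (upd (emb w) i (I * (w i %/ I) + u)%N)) I0).
apply: eq_bigr => r _; congr F; apply/ffunP => j; rewrite !ffunE.
by case: eqP.
Qed.
End Blocks.

Section Average.
Variables (R : rcfType) (G : finZmodType) (k W : nat) (e : 'I_k -> G) (ed : G).
Variable y : {ffun 'I_k -> nat} -> nat.
Implicit Types (f g h : {ffun G -> R^o}) (x : {ffun 'I_k -> nat}).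
Implicit Types (w : {ffun 'I_k -> 'I_W}).

(** The graph of [y] over a box with one corner at [(W, ..., W)]; staying away from the origin
    keeps the slope of the cap of one sign, so that it can be counted in natural numbers. *)
Definition vec x : G := \sum_i e i *+ (W + x i) + ed *+ y x.
Definition graph : seq G := [seq vec (emb w) | w : {ffun 'I_k -> 'I_W}].

(** An average over the graph inherits a bound which holds on each of its arcs of length [I] in
    the [i]-th direction. *)
Lemma nrm_graph_block g i I (c : R) : (0 < I)%N -> (I %| W)%N -> 0 <= c ->
  (forall w, nrm (\sum_(0 <= u < I)
      tau (vec (upd (emb w) i (I * (w i %/ I) + u))) g) <= I%:R * c) ->
  nrm (av graph g) <= c.
Proof.
move=> I0 IW c0 H; rewrite /av nrmZ ger0_norm ?invr_ge0 ?ler0n //.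
rewrite size_image big_image /=.
have [->|n0] := eqVneq #|{ffun 'I_k -> 'I_W}| 0%N; first by rewrite invr0 mul0r.
rewrite ler_pdivrMl ?ltr0n ?lt0n //.
have Ip : 0 < I%:R :> R by rewrite ltr0n.
rewrite -(ler_pM2l Ip) -[X in X * nrm _](ger0_norm (ltW Ip)) -nrmZ scaler_nat.
have := @block_sum k W _ (fun x => tau (vec x) g) i I I0 IW => /= ->.
rewrite mulrCA; apply: le_trans (nrm_sum _ _ _) _.
rewrite mulr_natl -sumr_const; apply: ler_sum => w _; exact: H.
Qed.

Lemma vec_upd x i n : vec (upd x i n) =
  \sum_(j | j != i) e j *+ (W + x j) + e i *+ (W + n) + ed *+ y (upd x i n).
Proof.
rewrite /vec (bigD1 i) //= [X in X + _]addrC; congr (_ + _); rewrite !ffunE eqxx.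
by congr (_ + _); apply: eq_bigr => j /negbTE ji; rewrite ffunE ji.
Qed.

Lemma line_smooth2 a b M d h : (0 < M)%N -> (a <= b + d)%N -> (b <= a + d)%N ->
  nrm (tau (ed *+ a) (av (line ed M) h) - tau (ed *+ b) (av (line ed M) h))
   <= 2 * d%:R / M%:R * nrm h.
Proof.
move=> M0; wlog ab : a b / (b <= a)%N.
  move=> H; case: (leqP b a) => [ab|/ltnW ba] ad bd; first exact: H.
  by rewrite -nrmN opprB H.
move=> abd _; have -> : ed *+ a = ed *+ b + ed *+ (a - b) by rewrite -mulrnDr subnKC.
rewrite -tauD -linearB /= nrm_tau; apply: le_trans (line_smooth _ _ _ M0) _.
rewrite ler_wpM2r ?nrm_ge0 // ler_wpM2r ?invr_ge0 ?ler0n // ler_wpM2l // ler_nat.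
by lia.
Qed.

(** On an arc of length [L] the graph stays within [D] of a horizontal segment, which does not
    matter at the vertical scale [M]; along the segment, the sum of the differences by [j] steps
    telescopes. *)
Lemma graph_kills_horizontal i j L D M h : (0 < M)%N -> (0 < L)%N -> (L %| W)%N ->
  (forall w u, (u < L)%N ->
     let Y n := y (upd (emb w) i (L * (w i %/ L) + n)) in
     (Y u <= Y 0 + D)%N /\ (Y 0 <= Y u + D)%N) ->
  nrm (av graph (av (line ed M) (tau (e i *+ j) h - h)))
    <= (2 * j%:R / L%:R + 4 * D%:R / M%:R) * nrm h.
Proof.
move=> M0 L0 LW HY; set g := av (line ed M) _.
have c0 : 0 <= (2 * j%:R / L%:R + 4 * D%:R / M%:R) * nrm h.
  by rewrite mulr_ge0 ?nrm_ge0 // addr_ge0 // !mulr_ge0 ?invr_ge0 ?ler0n.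
apply: (nrm_graph_block (i := i) L0 LW c0) => w.
set Y := fun n => y (upd (emb w) i (L * (w i %/ L) + n)).
pose B := \sum_(j | j != i) e j *+ (W + emb w j) + e i *+ (W + L * (w i %/ L))
   + ed *+ Y 0.
have E u : (u < L)%N -> nrm (tau (vec (upd (emb w) i (L * (w i %/ L) + u))) g
   - tau B (tau (e i *+ u) g)) <= 4 * D%:R / M%:R * nrm h.
  move=> uL; have [H1 H2] := HY w u uL.
  rewrite vec_upd -/(Y u); set C := _ + e i *+ _.
  have -> : tau B (tau (e i *+ u) g) = tau C (tau (ed *+ Y 0) g).
    rewrite !tauD /B /C addnA [e i *+ (_ + u)]mulrnDr; congr (tau _ g).
    by rewrite !addrA [LHS](ACl (1*2*4*3))%AC.
  rewrite -tauD -linearB /= nrm_tau; apply: le_trans (line_smooth2 _ M0 H1 H2) _.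
  have := nrmB (tau (e i *+ j) h) h; rewrite nrm_tau.
  have -> : 4 * D%:R / M%:R * nrm h = 2 * D%:R / M%:R * (nrm h + nrm h) by ring.
  by move=> ?; rewrite ler_wpM2l // mulr_ge0 ?mulr_ge0 ?invr_ge0 ?ler0n.
apply: (@le_trans _ _ (nrm (\sum_(0 <= u < L)
    (tau (vec (upd (emb w) i (L * (w i %/ L) + u))) g - tau B (tau (e i *+ u) g)))
   + nrm (\sum_(0 <= u < L) tau B (tau (e i *+ u) g)))).
  by rewrite -[X in nrm X <= _](subrK (\sum_(0 <= u < L) tau B (tau (e i *+ u) g)))
     -sumrB nrmD.
rewrite -linear_sum /= nrm_tau mulrDl mulrDr addrC lerD //; last first.
  by apply: nrm_sum_nat.
have -> : \sum_(0 <= u < L) tau (e i *+ u) g = av (line ed M)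
    (\sum_(0 <= u < L) tau (e i *+ u) (tau (e i *+ j) h - h)).
  by rewrite [RHS]linear_sum; apply: eq_bigr => u _ /=; rewrite av_tau.
apply: le_trans (nrm_av _ _) _; apply: le_trans (line_cancel_tau _ _ _ _) _.
rewrite le_eqVlt; apply/orP; left; apply/eqP.
by field; rewrite pnatr_eq0 -lt0n.
Qed.

(** On arcs of length [I] the graph is within [D] of parabolas [- S u - q u ^ 2]; the error [D]
    does not matter at the vertical scale [M1], and the parabolas are handled by [parabola_sum],
    the linear term being absorbed in the direction of the translation. *)
Lemma graph_kills_vertical i (I Z q0 q1 D M1 M2 : nat) (c : R) h :
  (0 < I)%N -> (I %| W)%N -> (0 < M1)%N -> (0 < M2)%N -> (0 < Z)%N ->
  (0 < q0)%N -> 0 <= c ->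
  12 * Z%:R / I%:R + 32 * q1%:R * I%:R / M1%:R + 4 * M2%:R / (q0%:R * Z%:R * I%:R)
    <= c ^+ 2 ->
  (forall w, exists S q Y0 : nat, (q0 <= q <= q1)%N /\ forall u, (u < I)%N ->
     let Y := y (upd (emb w) i (I * (w i %/ I) + u)) in
     (Y + S * u + q * u ^ 2 <= Y0 + D)%N /\ (Y0 <= Y + S * u + q * u ^ 2 + D)%N) ->
  nrm (av graph (av (line ed M1) (h - av (line ed M2) h)))
    <= (c + 4 * D%:R / M1%:R) * nrm h.
Proof.
move=> I0 IW M10 M20 Z0 q00 c0 Hc HY; set k' := h - _; set g := av (line ed M1) _.
have nk : nrm k' <= 2 * nrm h.
  by apply: le_trans (nrmB _ _) _; have := nrm_av (line ed M2) h; lra.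
have c1 : 0 <= (c + 4 * D%:R / M1%:R) * nrm h.
  by rewrite mulr_ge0 ?nrm_ge0 // addr_ge0 // !mulr_ge0 ?invr_ge0 ?ler0n.
apply: (nrm_graph_block (i := i) I0 IW c1) => w.
have [S [q [Y0 [/andP[q0q qq1] {}HY]]]] := HY w.
have qp : (0 < q)%N by apply: leq_trans q0q.
set Y := fun n => y (upd (emb w) i (I * (w i %/ I) + n)).
pose C := \sum_(j | j != i) e j *+ (W + emb w j) + e i *+ (W + I * (w i %/ I)).
pose B := C + ed *+ Y0.
pose e' := e i - ed *+ S.
have E u : (u < I)%N -> nrm (tau (vec (upd (emb w) i (I * (w i %/ I) + u))) g
   - tau B (tau (e' *+ u - ed *+ (q * u ^ 2)) g)) <= 4 * D%:R / M1%:R * nrm h.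
  move=> uI; have [H1 H2] := HY u uI.
  rewrite vec_upd -/(Y u).
  pose C' := C + e i *+ u - ed *+ (S * u + q * u ^ 2).
  have -> : tau (\sum_(j | j != i) e j *+ (W + emb w j) +
     e i *+ (W + (I * (w i %/ I) + u)) + ed *+ Y u) g =
     tau C' (tau (ed *+ (Y u + S * u + q * u ^ 2)) g).
    rewrite tauD /C' -[(Y u + _ + _)%N]addnA [ed *+ (Y u + _)]mulrnDr [ed *+ Y u + _]addrC addrA subrK.
    by rewrite /C addnA [e i *+ (_ + u)]mulrnDr !addrA.
  have -> : tau B (tau (e' *+ u - ed *+ (q * u ^ 2)) g) = tau C' (tau (ed *+ Y0) g).
    rewrite !tauD /B /C' /e' mulrnBl mulrnDr -mulrnA opprD.
    by congr (tau _ g); rewrite !addrA [LHS](ACl (1*3*4*5*2))%AC.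
  rewrite -linearB /= nrm_tau; apply: le_trans (line_smooth2 _ M10 H1 H2) _.
  have -> : 4 * D%:R / M1%:R * nrm h = 2 * D%:R / M1%:R * (2 * nrm h) by ring.
  by rewrite ler_wpM2l // mulr_ge0 ?mulr_ge0 ?invr_ge0 ?ler0n.
apply: (@le_trans _ _ (nrm (\sum_(0 <= u < I)
    (tau (vec (upd (emb w) i (I * (w i %/ I) + u))) g
     - tau B (tau (e' *+ u - ed *+ (q * u ^ 2)) g)))
   + nrm (\sum_(0 <= u < I) tau B (tau (e' *+ u - ed *+ (q * u ^ 2)) g)))).
  by rewrite -[X in nrm X <= _](subrK (\sum_(0 <= u < I)
     tau B (tau (e' *+ u - ed *+ (q * u ^ 2)) g))) -sumrB nrmD.
rewrite -linear_sum /= nrm_tau mulrDl mulrDr addrC lerD //; last first.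
  by apply: nrm_sum_nat.
rewrite -(@ler_pXn2r _ 2) ?nnegrE ?mulr_ge0 ?nrm_ge0 ?ler0n //.
apply: le_trans (parabola_sum e' ed I h M10 M20 qp Z0) _.
rewrite !exprMn mulrA ler_wpM2r ?exprn_ge0 ?nrm_ge0 //.
have Ip : 0 < I%:R :> R by rewrite ltr0n.
apply: (le_trans _ (ler_wpM2l (exprn_ge0 2 (ltW Ip)) Hc)).
rewrite !mulrDr; apply: lerD; first apply: lerD.
- by rewrite le_eqVlt; apply/orP; left; apply/eqP; field; rewrite gt_eqF.
- have -> : I%:R ^+ 2 * (32 * q1%:R * I%:R / M1%:R) = 32 * q1%:R * I%:R ^+ 3 / M1%:R :> R by ring.
  rewrite !ler_wpM2r ?invr_ge0 ?exprn_ge0 ?ler0n // ler_wpM2l // ler_nat //.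
- have -> : I%:R ^+ 2 * (4 * M2%:R / (q0%:R * Z%:R * I%:R)) = 4 * M2%:R * I%:R / (q0%:R * Z%:R) :> R.
    by field; rewrite !gt_eqF ?ltr0n.
  rewrite ler_wpM2l ?mulr_ge0 ?ler0n // lef_pV2 ?posrE ?mulr_gt0 ?ltr0n //.
  by rewrite ler_wpM2r ?ler0n // ler_nat.
Qed.
End Average.

(** * The spherical cap as a discrete graph *)

(** Taylor expansion of [F = sqrt (r2 - (a + v) ^ 2)] at [v = 0], with slope [- p] and half second
    derivative [- s], proved algebraically by factoring the difference of the squares of [F] and
    of its expansion. *)
Lemma circle_parabola (R : realFieldType) (r2 a v F0 F p s : R) :
  F0 ^+ 2 = r2 - a ^+ 2 -> F ^+ 2 = r2 - (a + v) ^+ 2 ->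
  1 / 10 <= F0 -> 1 / 10 <= F -> F0 <= 1 / 4 -> 0 <= a <= 1 / 16 ->
  0 <= v <= 1 / 32 -> p = a / F0 -> s = (1 + p ^+ 2) / (2 * F0) ->
  [/\ 0 <= p, 2 <= s, s <= 10 & `|F - (F0 - p * v - s * v ^+ 2)| <= 240 * v ^+ 3].
Proof.
move=> E0 E h0 h1 h2 /andP[a0 a1] /andP[v0 v1] pE sE.
have F0p : 0 < F0 by lra.
have {}pE : p * F0 = a by rewrite pE; field; lra.
have {}sE : 2 * s * F0 = 1 + p ^+ 2 by rewrite sE; field; lra.
have p0 : 0 <= p by rewrite -(pmulr_lge0 _ F0p) pE.
have p1 : p <= 5 / 8 by nra.
have s2 : 2 <= s by nra.
have s10 : s <= 10 by nra.
split => //.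
have v2 : 0 <= v ^+ 2 <= v / 32 by apply/andP; split; nra.
have v3 : 0 <= v ^+ 3 by rewrite exprn_ge0.
set P := F0 - _ - _.
have P0 : 0 <= P by rewrite /P; nra.
have EP : (F - P) * (F + P) = - (2 * p * s + s ^+ 2 * v) * v ^+ 3.
  have -> : (F - P) * (F + P) = F ^+ 2 - P ^+ 2 by ring.
  have -> : P ^+ 2 = F0 ^+ 2 - 2 * (p * F0) * v + (p ^+ 2 - 2 * s * F0) * v ^+ 2
     + (2 * p * s + s ^+ 2 * v) * v ^+ 3 by rewrite /P; ring.
  by rewrite E E0 pE sE; ring.
have K0 : 0 <= 2 * p * s + s ^+ 2 * v by rewrite addr_ge0 ?mulr_ge0 ?sqr_ge0 //; lra.
have K : 2 * p * s + s ^+ 2 * v <= 24.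
  have : s ^+ 2 <= 100 by nra.
  have : p * s <= 25 / 4 by nra.
  have : s ^+ 2 * v <= 100 / 32 by nra.
  lra.
rewrite -(@ler_pM2r _ (F + P)); last by lra.
rewrite -[X in _ * X <= _](@ger0_norm _ (F + P)); last by lra.
rewrite -normrM EP mulNr normrN ger0_norm ?mulr_ge0 //.
apply: (@le_trans _ _ (24 * v ^+ 3)); first by rewrite ler_wpM2r.
have : 0 <= (F + P - 1 / 10) * v ^+ 3 by rewrite mulr_ge0 //; lra.
lra.
Qed.

Section Sphere.
Variables (R : realType) (k W N1 : nat) (t : R).
Implicit Types (x : {ffun 'I_k -> nat}) (w : {ffun 'I_k -> 'I_W}).

Definition sqsum x : R := \sum_i ((W + x i)%:R / N1%:R) ^+ 2.
Definition cap x : R := Num.sqrt (t ^+ 2 - sqsum x).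
(** Heights are counted in units of [N1 ^- 4], horizontal coordinates in units of [N1 ^- 1]: the
    rounding is then negligible at all the scales used. *)
Definition height x : nat := Num.truncn (N1%:R ^+ 4 * cap x).

Hypotheses (N10 : (0 < N1)%N) (WN : (1024 * k * W ^ 2 <= N1 ^ 2)%N) (k0 : (0 < k)%N).
Hypotheses (t1 : 1 / 8 <= t) (t2 : t <= 1 / 4).

Let Np : 0 < N1%:R :> R. Proof. by rewrite ltr0n. Qed.

Lemma coord_le n : (n < W)%N -> 0 <= ((W + n)%:R / N1%:R : R) <= 1 / 16.
Proof.
move=> nW; rewrite mulr_ge0 ?invr_ge0 ?ler0n //= ler_pdivrMr //.
have : (1024 * W ^ 2 <= N1 ^ 2)%N by nia.
have : (W + n <= 2 * W)%N by lia.
move=> H1 H2; have {}H2 : (32 * W <= N1)%N.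
  rewrite -(@leq_exp2r _ _ 2) //; nia.
have : (16 * (W + n) <= N1)%N by lia.
by rewrite -(@ler_nat R) natrM; lra.
Qed.

Lemma W_le : W%:R / N1%:R <= 1 / 32 :> R.
Proof.
have : (1024 * W ^ 2 <= N1 ^ 2)%N by nia.
move=> H2; have {}H2 : (32 * W <= N1)%N by rewrite -(@leq_exp2r _ _ 2) //; nia.
by rewrite ler_pdivrMr //; move: H2; rewrite -(@ler_nat R) natrM; lra.
Qed.

Lemma sqsum_le x : (forall i, (x i < W)%N) -> 0 <= sqsum x <= 1 / 256.
Proof.
move=> xW; rewrite sumr_ge0 /=; last by move=> i _; apply: sqr_ge0.
have H i : ((W + x i)%:R / N1%:R) ^+ 2 <= (256 * k%:R)^-1 :> R.
  have kp : 0 < k%:R :> R by rewrite ltr0n.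
  rewrite expr_div_n ler_pdivrMr ?exprn_gt0 // mulrC ler_pdivlMr ?mulr_gt0 //.
  have : (4 * W ^ 2 * (256 * k) <= N1 ^ 2)%N by lia.
  have : ((W + x i) ^ 2 <= 4 * W ^ 2)%N by have := xW i; nia.
  move=> H1 H2; rewrite -!natrX -!natrM ler_nat; nia.
apply: le_trans (ler_sum _ (fun i _ => H i)) _.
rewrite sumr_const card_ord -[_ *+ k]mulr_natl le_eqVlt; apply/orP; left; apply/eqP.
by field; rewrite pnatr_eq0 -lt0n.
Qed.

Lemma cap_bounds x : (forall i, (x i < W)%N) ->
  [/\ cap x ^+ 2 = t ^+ 2 - sqsum x, 1 / 10 <= cap x & cap x <= t].
Proof.
move=> /sqsum_le /andP[s0 s1]; have T : 1 / 64 <= t ^+ 2.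
  have -> : 1 / 64 = (1 / 8) ^+ 2 :> R by field.
  by rewrite ler_pXn2r ?nnegrE //; move: t1; lra.
have E : cap x ^+ 2 = t ^+ 2 - sqsum x by rewrite sqr_sqrtr //; lra.
have c0 : 0 <= cap x := sqrtr_ge0 _.
have t0 : 0 <= t by move: t1; lra.
by split => //; rewrite -(@ler_pXn2r _ 2) ?nnegrE ?E //; lra.

Qed.

Lemma upd_lt w i n : (n < W)%N -> forall j, (upd (emb w) i n j < W)%N.
Proof. by move=> nW j; rewrite !ffunE; case: eqP => //= _; apply: ltn_ord. Qed.

Lemma block_lt w i (I u : nat) : (0 < I)%N -> (I %| W)%N -> (u < I)%N ->
  (I * (w i %/ I) + u < W)%N.
Proof.
move=> I0 /dvdnP[m Wm] uI; have := ltn_ord (w i); have := divn_eq (w i) I.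
have := ltn_pmod (w i) I0; move: (nat_of_ord (w i)) => n; rewrite Wm.
set p := (_ %/ _)%N; set s := (_ %% _)%N => H1 -> H2.
have : (p < m)%N by nia.
nia.
Qed.

(** Counted in the units of the grid, the half second derivative of the cap is between [2 N1 ^ 2]
    and [10 N1 ^ 2], and the cubic remainder on an arc of length [I] is at most [240 N1 I ^ 3];
    rounding the three coefficients and the heights costs the rest of [D]. *)
Lemma height_vertical w i I : (0 < I)%N -> (I %| W)%N ->
  exists S q Y0 : nat, (N1 ^ 2 <= q <= 10 * N1 ^ 2)%N /\ forall u, (u < I)%N ->
     let Y := height (upd (emb w) i (I * (w i %/ I) + u)) in
     let D := (250 * (N1 * I ^ 3))%N in
     (Y + S * u + q * u ^ 2 <= Y0 + D)%N /\ (Y0 <= Y + S * u + q * u ^ 2 + D)%N.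
Proof.
move=> I0 IW; set c := (I * (w i %/ I))%N.
pose X u := upd (emb w) i (c + u).
have XW u : (u < I)%N -> forall j, (X u j < W)%N.
  by move=> uI; apply: upd_lt; apply: block_lt.
pose rest : R := \sum_(j | j != i) ((W + emb w j)%:R / N1%:R) ^+ 2.
have sE u : sqsum (X u) = rest + ((W + (c + u))%:R / N1%:R) ^+ 2.
  rewrite /sqsum (bigD1 i) //= [LHS]addrC !ffunE eqxx; congr (_ + _).
  by apply: eq_bigr => j /negbTE ji; rewrite !ffunE ji.
pose F u := cap (X u).
pose a : R := (W + c)%:R / N1%:R.
have FE u : (u < I)%N -> F u ^+ 2 = (t ^+ 2 - rest) - (a + u%:R / N1%:R) ^+ 2.
  move=> uI; have [-> _ _] := cap_bounds (XW u uI).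
  by rewrite sE /a addnA (natrD _ (W + c)) mulrDl opprD addrA.
have F0E := FE 0%N I0; rewrite mul0r addr0 in F0E.
have [_ f1 f2] := cap_bounds (XW 0%N I0).
pose p := a / F 0%N; pose s := (1 + p ^+ 2) / (2 * F 0%N).
have HW := W_le.
have IleW : (I <= W)%N by apply: dvdn_leq => //; have := block_lt w i I0 IW I0; lia.
have a01 : 0 <= a <= 1 / 16.
  by apply: coord_le; have := block_lt w i I0 IW I0; rewrite addn0.
have main u : (u < I)%N -> let v := u%:R / N1%:R in
  [/\ 0 <= p, 2 <= s, s <= 10 & `|F u - (F 0%N - p * v - s * v ^+ 2)| <= 240 * v ^+ 3].
  move=> uI v; have [_ g1 g2] := cap_bounds (XW u uI).
  apply: (circle_parabola F0E (FE u uI)) => //; first by apply: le_trans t2.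
  rewrite mulr_ge0 ?invr_ge0 ?ler0n //=; apply: le_trans HW.
  by rewrite ler_wpM2r ?invr_ge0 ?ler0n // ler_nat ltnW // (leq_trans uI).
have [p0 s2 s10 _] := main 0%N I0.
have N4 : 0 <= N1%:R ^+ 4 :> R by rewrite exprn_ge0 // ler0n.
have N3 : 0 <= N1%:R ^+ 3 :> R by rewrite exprn_ge0 // ler0n.
have N2 : 0 <= N1%:R ^+ 2 :> R by rewrite exprn_ge0 // ler0n.
have N2' : 1 <= N1%:R ^+ 2 :> R by rewrite -natrX ler1n expn_gt0 N10.
have /andP[S1 S2] := @truncn_itv _ (N1%:R ^+ 3 * p) (mulr_ge0 N3 p0).
have s0 : 0 <= s by lra.
have /andP[q1 q2] := @truncn_itv _ (N1%:R ^+ 2 * s) (mulr_ge0 N2 s0).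
set S := Num.truncn _ in S1 S2; set q := Num.truncn _ in q1 q2.
have F00 : 0 <= F 0%N by rewrite sqrtr_ge0.
have /andP[y1 y2] := @truncn_itv _ (N1%:R ^+ 4 * F 0%N) (mulr_ge0 N4 F00).
set Y0 := Num.truncn _ in y1 y2.
rewrite -natr1 in S2; rewrite -natr1 in q2; rewrite -natr1 in y2.
(* The integer parts of the slope, of the half second derivative and of the initial height. *)
exists S, q, Y0; split.
  rewrite -!(@ler_nat R) natrM !natrX; apply/andP; split; last by nra.
  by nra.
move=> u uI Y D; have [_ _ _] := main u uI.
have Fu0 : 0 <= F u by rewrite sqrtr_ge0.
have /andP[] := @truncn_itv _ (N1%:R ^+ 4 * F u) (mulr_ge0 N4 Fu0).
rewrite -/(height (X u)) -/Y -natr1 => Y1 Y2.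
set v := u%:R / N1%:R; rewrite ler_norml => /andP[E1 E2].
have uI' : u%:R <= I%:R :> R by rewrite ler_nat ltnW.
have u0 : 0 <= u%:R :> R by rewrite ler0n.
have u2 : 0 <= u%:R ^+ 2 :> R by rewrite exprn_ge0.
have I1 : 1 <= I%:R :> R by rewrite ler1n.
have N1' : 1 <= N1%:R :> R by rewrite ler1n.
have Dp : 250 * (N1%:R * I%:R ^+ 3) = D%:R :> R by rewrite /D natrM natrM natrX.
have uI2 : u%:R ^+ 2 <= I%:R ^+ 2 :> R by rewrite ler_pXn2r ?nnegrE.
have I3 : I%:R ^+ 2 <= I%:R ^+ 3 :> R by rewrite ler_weXn2l.
have I3' : I%:R <= I%:R ^+ 3 :> R by rewrite -[leLHS]expr1 ler_weXn2l.
have I3N : I%:R ^+ 3 <= N1%:R * I%:R ^+ 3 :> R by rewrite ler_peMl // exprn_ge0.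
have uI3 : N1%:R ^+ 4 * v ^+ 3 <= N1%:R * I%:R ^+ 3 :> R.
  have -> : N1%:R ^+ 4 * v ^+ 3 = N1%:R * u%:R ^+ 3 :> R.
    by rewrite /v; field; rewrite gt_eqF.
  by rewrite ler_wpM2l ?ler_pXn2r ?nnegrE //; lra.
have EF : N1%:R ^+ 4 * (F u - (F 0%N - p * v - s * v ^+ 2)) =
  N1%:R ^+ 4 * F u - N1%:R ^+ 4 * F 0%N + (N1%:R ^+ 3 * p) * u%:R +
   (N1%:R ^+ 2 * s) * u%:R ^+ 2 :> R by rewrite /v; field; rewrite gt_eqF.
have {}E1 : - (240 * (N1%:R * I%:R ^+ 3)) <=
    N1%:R ^+ 4 * (F u - (F 0%N - p * v - s * v ^+ 2)) by nra.
have {}E2 : N1%:R ^+ 4 * (F u - (F 0%N - p * v - s * v ^+ 2)) <=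
    240 * (N1%:R * I%:R ^+ 3) by nra.
rewrite EF in E1 E2.
have S1u := ler_wpM2r u0 S1; have S2u := ler_wpM2r u0 (ltW S2).
have q1u := ler_wpM2r u2 q1; have q2u := ler_wpM2r u2 (ltW q2).
clearbody D Y; by split; rewrite -(@ler_nat R) !natrD -Dp !natrM -expr2; lra.
Qed.

(** The cap is Lipschitz with constant [1], in fact flatter, as it stays near the pole. *)
Lemma height_horizontal w i L u : (0 < L)%N -> (L %| W)%N -> (u < L)%N ->
  let Y n := height (upd (emb w) i (L * (w i %/ L) + n)) in
  let D := (N1 ^ 3 * L + 1)%N in (Y u <= Y 0 + D)%N /\ (Y 0 <= Y u + D)%N.
Proof.
move=> L0 LW uL; set c := (L * (w i %/ L))%N => Y D.
pose X u := upd (emb w) i (c + u).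
have XW n : (n < L)%N -> forall j, (X n j < W)%N.
  by move=> nL; apply: upd_lt; apply: block_lt.
pose rest : R := \sum_(j | j != i) ((W + emb w j)%:R / N1%:R) ^+ 2.
have sE n : sqsum (X n) = rest + ((W + (c + n))%:R / N1%:R) ^+ 2.
  rewrite /sqsum (bigD1 i) //= [LHS]addrC !ffunE eqxx; congr (_ + _).
  by apply: eq_bigr => j /negbTE ji; rewrite !ffunE ji.
have [E0 f0 _] := cap_bounds (XW 0%N L0); have [E1 f1 _] := cap_bounds (XW u uL).
have := coord_le (block_lt w i L0 LW L0); have := coord_le (block_lt w i L0 LW uL).
set a : R := (W + (c + 0))%:R / N1%:R; set b : R := (W + (c + u))%:R / N1%:R.
move=> /andP[b0 b1] /andP[a0 a1].
have bE : b = a + u%:R / N1%:R by rewrite /b addnA natrD mulrDl /a addn0.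
rewrite sE -/a in E0; rewrite sE -/b in E1.
set v := u%:R / N1%:R in bE; have v0 : 0 <= v by rewrite mulr_ge0 ?invr_ge0 ?ler0n.
set F0 := cap (X 0%N) in E0 f0; set F := cap (X u) in E1 f1.
have EF : (F0 - F) * (F0 + F) = v * (a + b).
  have -> : (F0 - F) * (F0 + F) = F0 ^+ 2 - F ^+ 2 by ring.
  by rewrite E0 E1 bE; ring.
have FF : 0 < F0 + F by move: f0 f1; lra.
have F01 : 0 <= F0 - F.
  by rewrite -(pmulr_lge0 _ FF) EF mulr_ge0 // addr_ge0.
have F02 : F0 - F <= v.
  rewrite -(ler_pM2r FF) EF ler_wpM2l //; move: f0 f1 a1 b1; lra.
have N4 : 0 <= N1%:R ^+ 4 :> R by rewrite exprn_ge0 // ler0n.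
have vL : N1%:R ^+ 4 * v <= N1%:R ^+ 3 * L%:R.
  have -> : N1%:R ^+ 4 * v = N1%:R ^+ 3 * u%:R by rewrite /v; field; rewrite gt_eqF.
  by rewrite ler_wpM2l ?exprn_ge0 ?ler0n // ler_nat ltnW.
have F0p : 0 <= F0 by lra.
have Fp : 0 <= F by lra.
have /andP[] := @truncn_itv _ (N1%:R ^+ 4 * F0) (mulr_ge0 N4 F0p).
have /andP[] := @truncn_itv _ (N1%:R ^+ 4 * F) (mulr_ge0 N4 Fp).
rewrite -/(height (X 0%N)) -/(height (X u)) -/(Y 0%N) -/(Y u) -!natr1 => y1 y2 z1 z2.
have E1' := ler_wpM2l N4 F02; have E2' := mulr_ge0 N4 F01.
by split; rewrite -(@ler_nat R) /D !natrD natrM natrX; lra.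
Qed.
End Sphere.

(** * Comparison of the correlations at consecutive scales *)

Lemma nat_ratio_le (R : realFieldType) (a b c m : nat) :
  (0 < b)%N -> (0 < c)%N -> (a * c <= m * b)%N -> a%:R / b%:R <= m%:R / c%:R :> R.
Proof.
move=> b0 c0 H; rewrite ler_pdivrMr ?ltr0n // mulrAC ler_pdivlMr ?ltr0n //.
by rewrite -!natrM ler_nat.
Qed.

Lemma leq_pow2 (m a c b : nat) : (m <= 2 ^ c)%N -> (c + a <= b)%N -> (m * 2 ^ a <= 2 ^ b)%N.
Proof.
move=> mc cab; apply: leq_trans (leq_mul mc (leqnn _)) _.
by rewrite -expnD leq_exp2l.
Qed.

Section Adjoint.
Variables (R : rcfType) (G : finZmodType).
Implicit Types (f g h : {ffun G -> R^o}) (s : seq G).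

Lemma ip_av s f g : ip f (av s g) = ip (av (map -%R s) f) g.
Proof.
rewrite /av ipZr ipZl size_map ip_sumr ip_suml big_map; congr (_ * _).
by apply: eq_bigr => v _; rewrite ip_taul opprK.
Qed.

Lemma scale_av s f : (0 < size s)%N -> (size s)%:R *: av s f = \sum_(v <- s) tau v f.
Proof. by move=> s0; rewrite scalerA divff ?scale1r // pnatr_eq0 -lt0n. Qed.

Lemma ipBl f1 f2 g : ip (f1 - f2) g = ip f1 g - ip f2 g.
Proof. by rewrite -(scaleN1r f2) ipDl ipZl mulN1r. Qed.

Lemma ipBr f g1 g2 : ip f (g1 - g2) = ip f g1 - ip f g2.
Proof. by rewrite !(ipC f) ipBl. Qed.

Lemma nrm_avN s g : nrm (av (map -%R s) g) = nrm (av s g).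
Proof. by rewrite /nrm -ip_av avC ipC -ip_av. Qed.
End Adjoint.

Section Telescope.
Variables (R : realType) (G : finZmodType) (k n gam : nat).
Variables (e : 'I_k -> G) (ed : G) (t : R).
Implicit Types (f g h : {ffun G -> R^o}).

Let N1 := (2 ^ n)%N.
Let W := (2 ^ (n - gam))%N.
Hypotheses (k0 : (0 < k)%N) (gam_n : (gam <= n)%N) (kgam : (1024 * k <= 4 ^ gam)%N).

(** The cap is taken over a box of side [W], which is [2 ^- gam] in normalised units. *)
Definition sphere_pts : seq G := graph W e ed (height W N1 t).
(** With [hbox], the box of the scale [r]: vertical side [2 ^- (64 r)], horizontal sides [2 ^- (72
    r)] in normalised units.  Arcs of length [2 ^- (28 r)] see the curvature but have a cubic
    error [2 ^- (84 r)], far below [2 ^- (64 r)], which explains the exponents; the horizontal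
    sides are slightly shorter than the vertical one, so that on arcs of intermediate length [2 ^-
    (68 r)] the cap looks horizontal. *)
Definition vline r := line ed (2 ^ (4 * n - 64 * r)).
Definition hbox r : seq G :=
  [seq \sum_i e i *+ j i | j : {ffun 'I_k -> 'I_(2 ^ (n - 72 * r))}].
Definition smooth r f := av (vline r) (av (hbox r) f).

Lemma window_le : (1024 * k * W ^ 2 <= N1 ^ 2)%N.
Proof.
apply: (@leq_trans (4 ^ gam * W ^ 2)); first by rewrite leq_mul2r kgam orbT.
by rewrite /W /N1 -[4%N]/(2 ^ 2)%N -!expnM -expnD leq_exp2l //; lia.
Qed.

Lemma N10 : (0 < N1)%N. Proof. by rewrite expn_gt0. Qed.

Lemma dvd_W a : (gam <= a)%N -> (2 ^ (n - a) %| W)%N.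
Proof. by move=> ga; rewrite dvdn_exp2l //; lia. Qed.

Lemma four_pow r : (4 ^ r = 2 ^ (2 * r))%N.
Proof. by rewrite -[4%N]/(2 ^ 2)%N -expnM. Qed.

Hypotheses (t1 : 1 / 8 <= t) (t2 : t <= 1 / 4).

(** Arcs of length [2 ^- (28 r)], with the differences smaller than [2 ^- (32 r)] discarded in
    [parabola_sum].  The condition [5 <= r] is what makes the cubic error [1000 * 2 ^ (- 84 r)]
    smaller than [4 ^- r] times the side [2 ^- (64 (r + 1))] of the next box. *)
Lemma vertical_gain r h : (5 <= r)%N -> (gam <= 28 * r)%N -> (72 * r + 73 <= n)%N ->
  nrm (av sphere_pts (av (vline r.+1) (h - av (vline r) h)))
   <= 6 / 4 ^+ r * nrm h.
Proof.
move=> r5 gr rn; set I := (2 ^ (n - 28 * r))%N; set Z := (2 ^ (n - 32 * r))%N.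
have I0 : (0 < I)%N by rewrite expn_gt0.
have IW : (I %| W)%N by apply: dvd_W.
have H w := height_vertical (t := t) N10 window_le k0 t1 t2 w (Ordinal k0) I0 IW.
have c0 : 0 <= 5 / 4 ^+ r :> R by rewrite mulr_ge0 // invr_ge0 exprn_ge0.
have f4 : (4 ^ r)%:R = 4 ^+ r :> R by rewrite natrX.
apply: le_trans (graph_kills_vertical e ed (i := Ordinal k0) (Z := Z)
  (q0 := (N1 ^ 2)%N) (q1 := (10 * N1 ^ 2)%N) (c := 5 / 4 ^+ r)
  (D := (250 * (N1 * I ^ 3))%N) h I0 IW _ _ _ _ c0 _ H) _;
  rewrite ?expn_gt0 //.
  (* The three terms of the estimate have the sizes 12, 1 and 12 times [2 ^- (4 r)], and 25 is the
     square of 5. *)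
  have -> : (5 / 4 ^+ r) ^+ 2 = 12%:R / (2 ^ (4 * r))%:R + 1%:R / (2 ^ (4 * r))%:R
     + 12%:R / (2 ^ (4 * r))%:R :> R.
    rewrite (_ : (2 ^ (4 * r))%N = ((4 ^ r) ^ 2)%N); last first.
      by rewrite four_pow -expnM; congr (2 ^ _)%N; lia.
    by rewrite natrX f4; field; rewrite expf_eq0 pnatr_eq0 andbF.
  rewrite -!natrM; apply: lerD; first apply: lerD.
  - apply: nat_ratio_le; rewrite ?expn_gt0 // -mulnA leq_mul2l /= /I /Z.
    by rewrite -expnD leq_exp2l //; lia.
  - apply: nat_ratio_le; rewrite ?expn_gt0 // mul1n.
    rewrite /N1 /I -expnM.
    rewrite (_ : 32 * (10 * 2 ^ (n * 2)) * _ * _ =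
      320 * 2 ^ (n * 2 + (n - 28 * r) + 4 * r))%N; last by rewrite !expnD; ring.
    by apply: (@leq_pow2 _ _ 9) => //; lia.
  - apply: nat_ratio_le; rewrite ?muln_gt0 ?expn_gt0 //.
    rewrite -mulnA [(12 * _)%N](_ : _ = 4 * (3 * (N1 ^ 2 * Z * I)))%N; last by ring.
    rewrite leq_mul2l /= -expnD /N1 /I /Z -expnM -!expnD.
    by apply: (@leq_trans (2 ^ (n * 2 + (n - 32 * r) + (n - 28 * r))));
      [rewrite leq_exp2l //; lia | rewrite leq_pmull].
rewrite ler_wpM2r ?nrm_ge0 //.
have -> : 6 / 4 ^+ r = 5 / 4 ^+ r + 1%:R / (4 ^ r)%:R :> R.
  by rewrite f4; field; rewrite expf_eq0 pnatr_eq0 andbF.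
rewrite lerD2l -!natrM; apply: nat_ratio_le; rewrite ?expn_gt0 //.
rewrite mul1n four_pow /N1 /I -expnM.
rewrite (_ : _ * _ = 1000 * 2 ^ (n + (n - 28 * r) * 3 + 2 * r))%N; last first.
  by rewrite !expnD; ring.
by apply: (@leq_pow2 _ _ 10) => //; lia.
Qed.

(** Arcs of length [2 ^- (68 r)]: they are [2 ^ (4 r)] times longer than the displacement, and the
    height varies on them by [2 ^- (4 r)] times the vertical side of the box. *)
Lemma horizontal_gain r i j h : (5 <= r)%N -> (gam <= 28 * r)%N -> (72 * r + 73 <= n)%N ->
  (j <= 2 ^ (n - 72 * r))%N ->
  nrm (av sphere_pts (av (vline r) (tau (e i *+ j) h - h))) <= 10 / 4 ^+ r * nrm h.
Proof.
move=> r5 gr rn jM; set L := (2 ^ (n - 68 * r))%N.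
have L0 : (0 < L)%N by rewrite expn_gt0.
have LW : (L %| W)%N by apply: dvd_W; lia.
have H w u := @height_horizontal R k W N1 t N10 window_le k0 t1 t2 w i L u L0 LW.
have f4 : (4 ^ r)%:R = 4 ^+ r :> R by rewrite natrX.
apply: le_trans (graph_kills_horizontal e ed (i := i) (L := L) (D := (N1 ^ 3 * L + 1)%N)
  j h _ L0 LW (fun w u => H w u)) _; rewrite ?expn_gt0 //.
rewrite ler_wpM2r ?nrm_ge0 //.
have -> : 10 / 4 ^+ r = 2%:R / (4 ^ r)%:R + 8%:R / (4 ^ r)%:R :> R.
  by rewrite f4; field; rewrite expf_eq0 pnatr_eq0 andbF.
rewrite -!natrM; apply: lerD; apply: nat_ratio_le; rewrite ?expn_gt0 //.
  rewrite -mulnA leq_mul2l /=; apply: leq_trans (leq_mul jM (leqnn _)) _.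
  by rewrite four_pow -expnD leq_exp2l //; lia.
have H1 : (1 <= N1 ^ 3 * L)%N by rewrite muln_gt0 !expn_gt0.
apply: (@leq_trans (8 * (N1 ^ 3 * L) * 4 ^ r)).
  by rewrite leq_mul2r; apply/orP; right; lia.
rewrite -mulnA leq_mul2l /= /N1 /L four_pow -expnM -!expnD leq_exp2l //; lia.
Qed.

Lemma size_vline r : (0 < size (vline r))%N.
Proof. by rewrite size_map size_iota expn_gt0. Qed.

Lemma size_hbox r : (0 < size (hbox r))%N.
Proof. by rewrite size_image card_ffun !card_ord expn_gt0 expn_gt0. Qed.

Lemma smooth_linear r : linear (smooth r).
Proof. by move=> a f g; rewrite /smooth !linearP. Qed.

HB.instance Definition _ r :=
  GRing.isLinear.Build R {ffun G -> R^o} {ffun G -> R^o} _ (smooth r) (smooth_linear r).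

Lemma av_smooth s r f : av s (smooth r f) = smooth r (av s f).
Proof. by rewrite /smooth avC; congr (av _ _); rewrite avC. Qed.

Lemma smoothC r r' f : smooth r (smooth r' f) = smooth r' (smooth r f).
Proof. by rewrite {1}/smooth !av_smooth. Qed.

Lemma nrm_smooth r f : nrm (smooth r f) <= nrm f.
Proof. by apply: le_trans (nrm_av _ _) (nrm_av _ _). Qed.

(** The passage from [smooth r.+1 g] to its smoothing at scale [r] is split into a vertical
    average and then [k] horizontal translations, treated one coordinate after the other. *)
Lemma smooth_gain r g : (5 <= r)%N -> (gam <= 28 * r)%N -> (72 * r + 73 <= n)%N ->
  nrm (av sphere_pts (smooth r.+1 g - smooth r (smooth r.+1 g)))
   <= (6 + 10 * k%:R) / 4 ^+ r * nrm g.
Proof.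
move=> r5 gr rn; set u := smooth r.+1 g.
have nu : nrm u <= nrm g by apply: nrm_smooth.
have c0 : 0 <= 10 / 4 ^+ r :> R by rewrite mulr_ge0 // invr_ge0 exprn_ge0.
rewrite -[X in nrm (av _ X)](subrKA (av (vline r) u)) linearD /=.
apply: le_trans (nrmD _ _) _; rewrite mulrDl mulrDl; apply: lerD.
  have -> : u - av (vline r) u = av (vline r.+1) (av (hbox r.+1) g - av (vline r) (av (hbox r.+1) g)).
    by rewrite linearB /= [av (vline r.+1) (av (vline r) _)]avC.
  apply: le_trans (vertical_gain _ r5 gr rn) _.
  by rewrite ler_wpM2l ?nrm_av // mulr_ge0 // invr_ge0 exprn_ge0.
have -> : av (vline r) u - smooth r u = - (av (hbox r) (av (vline r) u) - av (vline r) u).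
  by rewrite opprB /smooth avC.
have E : av (hbox r) (av (vline r) u) - av (vline r) u
    = (size (hbox r))%:R^-1 *: \sum_(b <- hbox r) av (vline r) (tau b u - u).
  have n0 : (size (hbox r))%:R != 0 :> R by rewrite pnatr_eq0 -lt0n size_hbox.
  apply: (scalerI n0); rewrite scalerA divff // scale1r scalerBr.
  rewrite (scale_av (av (vline r) u) (size_hbox r)) scaler_nat -[X in _ *+ X]sum1_size.
  rewrite -sumrMnr -sumrB; apply: eq_bigr => b _; rewrite mulr1n linearB /=.
  by rewrite av_tau.
rewrite E linearN nrmN linearZ linear_sum /= nrmZ ger0_norm ?invr_ge0 ?ler0n //.
rewrite ler_pdivrMl ?ltr0n ?size_hbox //.
rewrite big_image /= size_image; apply: le_trans (nrm_sum _ _ _) _.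
rewrite [leRHS]mulr_natl -sumr_const; apply: ler_sum => j _.
suff H (s : seq 'I_k) :
    nrm (av sphere_pts (av (vline r) (tau (\sum_(i <- s) e i *+ j i) u - u)))
    <= (size s)%:R * (10 / 4 ^+ r * nrm u).
  apply: le_trans (H _) _; rewrite /index_enum -enumT size_enum_ord mulrA [k%:R * _]mulrA.
  rewrite [k%:R * 10]mulrC; apply: ler_wpM2l nu.
  by rewrite mulr_ge0 ?mulr_ge0 ?ler0n ?invr_ge0 ?exprn_ge0.
elim: s => [|i s IH].
  by rewrite big_nil tau0 subrr !linear0 nrm0 mul0r.
rewrite big_cons -tauD -[X in av (vline r) X](subrKA (tau (\sum_(i <- s) e i *+ j i) u)).
rewrite (linearD (av (vline r))) (linearD (av sphere_pts)) /=.
apply: le_trans (nrmD _ _) _.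
rewrite /= -natr1 mulrDl mul1r [leRHS]addrC lerD //.
apply: le_trans (horizontal_gain i _ r5 gr rn _) _; first by rewrite ltnW.
by rewrite nrm_tau.
Qed.

Definition corr f g : R := ip f (av sphere_pts g).

(** The composition of the smoothings at the scales [r, ..., r + m].  All finer smoothings are
    kept when the scale gets coarser, because the gain at scale [r] is only available for
    functions already smoothed at scale [r + 1]. *)
Fixpoint tower r m f := if m is m'.+1 then smooth r (tower r.+1 m' f) else smooth r f.

Lemma tower_smooth r m r' f : tower r m (smooth r' f) = smooth r' (tower r m f).
Proof.
elim: m r => [|m IH] r /=; first by rewrite smoothC.
by rewrite IH smoothC.
Qed.

Lemma nrm_tower r m f : nrm (tower r m f) <= nrm f.
Proof.
elim: m r => [|m IH] r /=; first exact: nrm_smooth.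
by apply: le_trans (nrm_smooth _ _) _.
Qed.

Lemma tower_le_smooth r m f : nrm (tower r m f) <= nrm (smooth r f).
Proof.
case: m => [|m]; first exact: lexx.
rewrite -[tower r m.+1 f]/(smooth r (tower r.+1 m f)) -tower_smooth.
exact: nrm_tower.
Qed.

(** Replacing the two arguments one after the other, and moving the spherical average to the
    argument which is replaced. *)
Lemma corr_step r (f g : {ffun G -> R^o}) (a : R) : (5 <= r)%N -> (gam <= 28 * r)%N ->
  (72 * r + 73 <= n)%N -> nrm f <= a -> nrm g <= a ->
  `|corr (smooth r.+1 f) (smooth r.+1 g)
    - corr (smooth r (smooth r.+1 f)) (smooth r (smooth r.+1 g))|
  <= 2 * (6 + 10 * k%:R) / 4 ^+ r * a ^+ 2.
Proof.
move=> r5 gr rn fa ga; set u := smooth r.+1 f; set v := smooth r.+1 g.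
have c0 : 0 <= (6 + 10 * k%:R) / 4 ^+ r :> R.
  by rewrite mulr_ge0 ?invr_ge0 ?exprn_ge0 // addr_ge0 ?mulr_ge0.
have a0 : 0 <= a by apply: le_trans fa; apply: nrm_ge0.
have -> : corr u v - corr (smooth r u) (smooth r v) =
   ip u (av sphere_pts (v - smooth r v)) + ip (av (map -%R sphere_pts) (u - smooth r u)) (smooth r v).
  by rewrite -ip_av /corr linearB /= ipBl ipBr addrA subrK.
apply: le_trans (ler_normD _ _) _.
have -> : 2 * (6 + 10 * k%:R) / 4 ^+ r * a ^+ 2 =
   a * ((6 + 10 * k%:R) / 4 ^+ r * a) + (6 + 10 * k%:R) / 4 ^+ r * a * a by ring.
apply: lerD; apply: le_trans (cauchy_schwarz _ _) _; apply: ler_pM; rewrite ?nrm_ge0 //.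
- exact: le_trans (nrm_smooth _ _) fa.
- by apply: le_trans (smooth_gain g r5 gr rn) _; rewrite ler_wpM2l.
- by rewrite nrm_avN; apply: le_trans (smooth_gain f r5 gr rn) _; rewrite ler_wpM2l.
- apply: le_trans (nrm_smooth _ _) _; exact: le_trans (nrm_smooth _ _) ga.
Qed.

(** The loss [4 ^- r'] times the square of the norm bound [(5/4) ^ r'] is summable: [25/16 < 2],
    which leaves [2 ^- r']. *)
Lemma corr_tower r m (f g : {ffun G -> R^o}) (K v : R) :
  (5 <= r)%N -> (gam <= 28 * r)%N -> (72 * (r + m) + 73 <= n)%N -> 0 <= K * v ->
  (forall r' : nat, (r' <= r + m + 1)%N -> nrm (smooth r' f) <= K * (5 / 4) ^+ r' * v) ->
  (forall r' : nat, (r' <= r + m + 1)%N -> nrm (smooth r' g) <= K * (5 / 4) ^+ r' * v) ->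
  `|corr (tower (r + m) 1 f) (tower (r + m) 1 g)
    - corr (tower r m.+1 f) (tower r m.+1 g)|
  <= 12 * (6 + 10 * k%:R) * (K * v) ^+ 2 / 2 ^+ r.
Proof.
set C := 12 * (6 + 10 * k%:R) * (K * v) ^+ 2.
have C0 : 0 <= C.
  by rewrite mulr_ge0 ?sqr_ge0 // mulr_ge0 // addr_ge0 ?mulr_ge0.
elim: m r => [|m IH] r r5 gr rn Kv Hf Hg.
  by rewrite addn0 subrr normr0 mulr_ge0 // invr_ge0 exprn_ge0.
have := IH r.+1; rewrite !addSnnS => {}IH.
have {}IH := IH (leqW r5) (leq_trans gr _) rn Kv Hf Hg.
rewrite -(subrKA (corr (tower r.+1 m.+1 f) (tower r.+1 m.+1 g))).
apply: le_trans (ler_normD _ _) _.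
have -> : C / 2 ^+ r = C / 2 ^+ r.+1 + C / 2 ^+ r.+1.
  by rewrite exprS; field; rewrite expf_eq0 pnatr_eq0 andbF.
apply: lerD; first by apply: IH; lia.
have E (h : {ffun G -> R^o}) : tower r.+1 m.+1 h = smooth r.+1 (tower r.+2 m h) by [].
rewrite [tower r _ f]/= [tower r _ g]/= -!/(tower _ _ _) !E.
have Hn (h : {ffun G -> R^o}) : 
   (forall r' : nat, (r' <= r + m.+1 + 1)%N -> nrm (smooth r' h) <= K * (5 / 4) ^+ r' * v) ->
   nrm (tower r.+2 m h) <= (5 / 4) ^+ r.+2 * (K * v).
  move=> H; apply: le_trans (tower_le_smooth _ _ _) _.
  by rewrite mulrCA mulrA; apply: H; lia.
apply: le_trans (corr_step r5 gr _ (Hn f Hf) (Hn g Hg)) _; first lia.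
rewrite exprMn -exprM mulnC exprM.
have -> : (5 / 4) ^+ 2 = 25 / 16 :> R by field.
have p4 : (4 : R) ^+ r = 2 ^+ r * 2 ^+ r by rewrite -exprMn; congr (_ ^+ _); ring.
have p2 : 0 < (2 : R) ^+ r by rewrite exprn_gt0.
have : (25 / 16) ^+ r <= 2 ^+ r :> R by rewrite lerXn2r ?nnegrE //; lra.
rewrite !(exprS _ r.+1) !(exprS _ r) p4 /C; set P := (25 / 16) ^+ r; set Q := 2 ^+ r in p2 * => PQ.
set D := (6 + 10 * k%:R); set V := (K * v) ^+ 2.
have D0 : 0 <= D * V.
  by rewrite mulr_ge0 ?sqr_ge0 // addr_ge0 ?mulr_ge0.
apply: (@le_trans _ _ ((D * V / Q) * (2 * (25 / 16) ^+ 2 * (P / Q)))).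
  by rewrite le_eqVlt; apply/orP; left; apply/eqP; field; lra.
apply: (@le_trans _ _ ((D * V / Q) * 6)); last first.
  by rewrite le_eqVlt; apply/orP; left; apply/eqP; field; lra.
rewrite ler_wpM2l ?(mulr_ge0 D0) ?invr_ge0 ?(ltW p2) //.
have : P / Q <= 1 by rewrite ler_pdivrMr // mul1r.
rewrite expr2; lra.
Qed.
End Telescope.

(** * Placing a measure of the tree on a finite torus *)

(* Lets the finite function and product types be recognised as finite abelian groups. *)
HB.saturate finfun_of.
HB.saturate prod.

Section Index.
Variables (d : nat).
Let D := {ffun 'I_d -> bool}.
Implicit Types (q : seq D) (i : 'I_d).

Lemma idx_lt q i : (idx q i < 2 ^ size q)%N.
Proof. by elim: q => //= b q IH; rewrite expnS; case: (b i) => /=; lia. Qed.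

Lemma idx_drop j q i : idx (drop j q) i = (idx q i %/ 2 ^ j)%N.
Proof.
elim: j q => [|j IH] q; first by rewrite drop0 expn0 divn1.
case: q => [|b q] /=; first by rewrite div0n.
rewrite IH expnS divnMA; congr (_ %/ _)%N; rewrite -muln2 divnMDl //.
by case: (b i) => //=; rewrite addn0.
Qed.

Lemma idx_inj p q : size p = size q -> idx p =1 idx q -> p = q.
Proof.
elim: p q => [|b p IH] [|c q] //= [spq] E.
have bc : b = c.
  apply/ffunP => i; have := congr1 odd (E i).
  by rewrite !oddD !odd_double !addFb !oddb.
rewrite bc; congr (_ :: _); apply: IH => // i.
have := E i; rewrite bc => /addIn; lia.
Qed.
End Index.

Lemma pow2_muln a b c : a = (b + c)%N -> (2 ^ a = 2 ^ b * 2 ^ c)%N.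
Proof. by move=> ->; rewrite expnD. Qed.

Lemma pow2_divn a b c : a = (b + c)%N -> (2 ^ a %/ 2 ^ c = 2 ^ b)%N.
Proof. by move=> ->; rewrite expnD mulnK ?expn_gt0. Qed.

(** An interval of length [M] of a cyclic group of [K * c] elements, possibly wrapping around,
    meets at most [M %/ c + 1] consecutive cells of length [c]. *)
Lemma cyclic_cell (x a c M K : nat) : (0 < c)%N -> (c %| M)%N -> (a < M)%N ->
  exists2 b, (b <= M %/ c)%N & (((x + a) %% (K * c)) %/ c = (x %/ c + b) %% K)%N.
Proof.
move=> c0 /dvdnP[m ->] aM; exists ((x %% c + a) %/ c)%N.
  rewrite mulnK // -ltnS ltn_divLR //; have := ltn_pmod x c0; nia.
by rewrite -modn_divl {1}(divn_eq x c) -addnA divnMDl.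
Qed.

Section Torus.
Variables (R : realType) (k n : nat).
Let d := k.+1.
Let DD := {ffun 'I_d -> bool}.
Let N1 := (2 ^ n)%N.
Let N4 := (2 ^ (4 * n))%N.
Implicit Types (q : seq DD).

(** There are [2 ^ n] points in each of the [k] horizontal directions and [2 ^ (4 n)] in the
    vertical one: the vertical mesh must resolve the height of the cap well beyond the depth [n]
    of the tree. *)
Definition torus : finZmodType := ({ffun 'I_k -> 'I_(2 ^ n).-1.+1} * 'I_(2 ^ (4 * n)).-1.+1)%type.

Definition eH (i : 'I_k) : torus := ([ffun j => if j == i then inZp 1 else 0], 0).
Definition eV : torus := (0, inZp 1).

Definition cH (x : torus) (i : 'I_k) : nat := x.1 i.
Definition cV (x : torus) : nat := x.2.

Lemma N1E : (2 ^ n).-1.+1 = N1. Proof. by rewrite prednK // expn_gt0. Qed.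
Lemma N4E : (2 ^ (4 * n)).-1.+1 = N4. Proof. by rewrite prednK // expn_gt0. Qed.

Lemma cHD x y i : cH (x + y) i = ((cH x i + cH y i) %% N1)%N.
Proof. by rewrite /cH /= ffunE /=; congr (_ %% _)%N; apply: N1E. Qed.

Lemma cVD x y : cV (x + y) = ((cV x + cV y) %% N4)%N.
Proof. by rewrite /cV /=; congr (_ %% _)%N; apply: N4E. Qed.

Definition shift (j : 'I_k -> nat) (a : nat) : torus := \sum_i eH i *+ j i + eV *+ a.

Lemma shiftE j a : shift j a = ([ffun i => inZp (j i)], inZp a) :> torus.
Proof.
have E1 i m : eH i *+ m = ([ffun l => if l == i then inZp m else 0], 0) :> torus.
  elim: m => [|m IH].
    rewrite mulr0n; congr pair; apply/ffunP => l; rewrite !ffunE; case: ifP => // _.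
    by apply: val_inj; rewrite /= mod0n.
  rewrite mulrS IH; congr pair; last by rewrite /= addr0.
  apply/ffunP => l; rewrite !ffunE; case: ifP => // _; last by rewrite addr0.
  by apply: val_inj; rewrite /= modnDm add1n.
have E2 m : eV *+ m = (0, inZp m) :> torus.
  elim: m => [|m IH].
    by rewrite mulr0n; congr pair; apply: val_inj; rewrite /= mod0n.
  rewrite mulrS IH; congr pair; first by rewrite /= addr0.
  by apply: val_inj; rewrite /= modnDm add1n.
rewrite /shift E2 (eq_bigr _ (fun i _ => E1 i (j i))).
have -> : \sum_i ([ffun l => if l == i then inZp (j i) else 0], 0) =
   ([ffun i => inZp (j i)], 0) :> torus.
  have H (r : seq 'I_k) : \sum_(i <- r) ([ffun l => if l == i then inZp (j i) else 0], 0) =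
    (\sum_(i <- r) [ffun l => if l == i then inZp (j i) else 0], 0) :> torus.
    elim: r => [|i r IH]; first by rewrite !big_nil.
    by rewrite !big_cons IH; congr pair; rewrite /= addr0.
  rewrite H; congr pair; apply/ffunP => l; rewrite sum_ffunE ffunE (bigD1 l) //= ffunE eqxx.
  by rewrite big1 ?addr0 // => i /negbTE il; rewrite ffunE eq_sym il.
by congr pair; rewrite /= ?addr0 ?add0r.
Qed.

Lemma cH_shift j a i : cH (shift j a) i = (j i %% N1)%N.
Proof. by rewrite shiftE /cH /= ffunE /=; congr (_ %% _)%N; apply: N1E. Qed.

Lemma cV_shift j a : cV (shift j a) = (a %% N4)%N.
Proof. by rewrite shiftE /cV /=; congr (_ %% _)%N; apply: N4E. Qed.

Lemma card_torus : #|torus| = (2 ^ (n * k) * N4)%N.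
Proof. by rewrite card_prod card_ffun !card_ord N1E N4E /N1 -expnM. Qed.

(** The last coordinate is the vertical one. *)
Definition horiz (i : 'I_k) : 'I_d := widen_ord (leqnSn k) i.

Definition grid_point q : torus :=
  shift (fun i => idx q (horiz i)) (idx q ord_max * 2 ^ (3 * n)).

Lemma cH_grid_point q i : size q = n -> cH (grid_point q) i = idx q (horiz i).
Proof. by move=> qn; rewrite cH_shift modn_small //; have := idx_lt q (horiz i); rewrite qn. Qed.

Lemma cV_grid_point q : size q = n -> cV (grid_point q) = (idx q ord_max * 2 ^ (3 * n))%N.
Proof.
move=> qn; rewrite cV_shift modn_small //.
have := idx_lt q ord_max; rewrite qn /N4 (_ : 4 * n = n + 3 * n)%N; last lia.
by rewrite [(2 ^ (n + 3 * n))%N]expnD ltn_pmul2r ?expn_gt0.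
Qed.

Variables (lam : R) (mu : seq DD -> R).
Hypothesis lam0 : 0 < lam.
Hypothesis mu_bound : forall q, (size q <= n)%N -> 0 <= mu q <= lam ^+ size q.
Hypothesis mu_add : forall q, (size q < n)%N -> \sum_i mu (i :: q) = mu q.

(** Normalised so that a measure of mass [1] has mean density [1] over the torus. *)
Definition density (phi : seq DD -> R) : {ffun torus -> R^o} :=
  [ffun x => #|torus|%:R * \sum_(q <- level DD n) mu q * phi q * (grid_point q == x)%:R].

Lemma sum_density phi : \sum_x (density phi x : R) =
  #|torus|%:R * \sum_(q <- level DD n) mu q * phi q.
Proof.
under eq_bigr do rewrite ffunE.
rewrite -mulr_sumr exchange_big /=; congr (_ * _); apply: eq_bigr => q _.
rewrite -mulr_sumr (bigD1 (grid_point q)) //= eqxx big1 ?addr0 ?mulr1 // => x.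
by rewrite eq_sym => /negbTE ->.
Qed.

(** The box at [x] meets at most [2 ^ (K - 72 r) + 1] cells of depth [K] in each horizontal
    direction and [2 ^ (K - 64 r) + 1] in the vertical one, each of mass at most [lam ^ K]. *)
Lemma box_mass K r (x : torus) : (72 * r <= K)%N -> (K <= n)%N ->
  \sum_(a < 2 ^ (4 * n - 64 * r)) \sum_(j : {ffun 'I_k -> 'I_(2 ^ (n - 72 * r))})
    \sum_(q <- level DD n) mu q * (grid_point q == x + shift (fun i => j i) a)%:R
  <= (((2 ^ (K - 72 * r)).+1 ^ k * (2 ^ (K - 64 * r)).+1)%:R) * lam ^+ K.
Proof.
move=> rK Kn.
have e1 : (n - 72 * r = (K - 72 * r) + (n - K))%N by lia.
have e4 : (4 * n - 64 * r = (K - 64 * r) + (4 * n - K))%N by lia.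
have e1' : (n = K + (n - K))%N by lia.
have e4' : (4 * n = K + (4 * n - K))%N by lia.
have e3 : (3 * n + (n - K) = 4 * n - K)%N by lia.
have l1 : (n - K <= n - 72 * r)%N by lia.
have l4 : (4 * n - K <= 4 * n - 64 * r)%N by lia.
have M1c1 := pow2_divn e1; have M4c4 := pow2_divn e4.
have N1c1 := pow2_muln e1'; have N4c4 := pow2_muln e4'.
have M1d := dvdn_exp2l 2 l1; have M4d := dvdn_exp2l 2 l4.
have M1N : (2 ^ (n - 72 * r) <= N1)%N by rewrite leq_exp2l // leq_subr.
have M4N : (2 ^ (4 * n - 64 * r) <= N4)%N by rewrite leq_exp2l // leq_subr.
clear e1 e4 e1' e4'; rewrite -/N1 in N1c1; rewrite -/N4 in N4c4.
move: M1c1 M4c4 N1c1 N4c4 M1d M4d M1N M4N.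
set M4 := (2 ^ (4 * n - 64 * r))%N; set M1 := (2 ^ (n - 72 * r))%N.
set c1 := (2 ^ (n - K))%N; set c4 := (2 ^ (4 * n - K))%N.
move=> M1c1 M4c4 N1c1 N4c4 M1d M4d M1N M4N.
(* The positions, relative to the cell of [x], of the cells that the box can meet. *)
pose B := ({ffun 'I_k -> 'I_(2 ^ (K - 72 * r)).+1} * 'I_(2 ^ (K - 64 * r)).+1)%type.
pose at_cell (b : B) (p : seq DD) := [forall i, (idx p (horiz i) == (cH x i %/ c1 + b.1 i) %% 2 ^ K)%N]
  && (idx p ord_max == (cV x %/ c4 + b.2) %% 2 ^ K)%N.
have HB : #|{: B}|%:R = (((2 ^ (K - 72 * r)).+1 ^ k * (2 ^ (K - 64 * r)).+1)%:R) :> R.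
  by rewrite card_prod card_ffun !card_ord.
rewrite -HB mulr_natl -sumr_const.
apply: (@le_trans _ _ (\sum_(b : B) \sum_(q <- level DD n) mu q * (at_cell b (drop (n - K) q))%:R)).
  under eq_bigr do rewrite exchange_big /=.
  rewrite exchange_big [leRHS]exchange_big /= big_seq [leRHS]big_seq.
  apply: ler_sum => q; rewrite mem_level => /eqP qn.
  have /andP[mu0 _] := mu_bound (eq_leq qn).
  under eq_bigr do rewrite -mulr_sumr; rewrite -!mulr_sumr ler_wpM2l //.
  have [[a0 [j0 E0]]|no] := pselect (exists (a : 'I_M4) (j : {ffun 'I_k -> 'I_M1}),
     grid_point q = x + shift (fun i => j i) a); last first.
    rewrite big1 ?sumr_ge0 // => a _; rewrite big1 // => j _.
    by case: eqP => // E; case: no; exists a, j.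
  have small i : (j0 i < N1)%N by apply: leq_trans (ltn_ord _) _.
  have smalla : (a0 < N4)%N by apply: leq_trans (ltn_ord _) _.
  have uniqE (a : 'I_M4) (j : {ffun 'I_k -> 'I_M1}) :
     grid_point q = x + shift (fun i => j i) a -> a = a0 /\ j = j0.
    rewrite E0 => /addrI E; split.
      apply: val_inj => /=; have := congr1 cV E; rewrite !cV_shift !modn_small //.
      by apply: leq_trans (ltn_ord _) _.
    apply/ffunP => i; apply: val_inj => /=; have := congr1 (cH^~ i) E.
    rewrite !cH_shift !modn_small //; by apply: leq_trans (ltn_ord _) _.
  rewrite (bigD1 a0) //= [X in _ + X]big1 ?addr0 => [|a aa0]; last first.
    rewrite big1 // => j _; case: eqP => // /uniqE[E _]; by rewrite E eqxx in aa0.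
  rewrite (bigD1 j0) //= [X in _ + X]big1 ?addr0 => [|j jj0]; last first.
    case: eqP => // /uniqE[_ E]; by rewrite E eqxx in jj0.
  rewrite E0 eqxx.
  have /choice[b1 Hb1] i : exists b : 'I_(2 ^ (K - 72 * r)).+1,
      ((cH x i + j0 i) %% N1 %/ c1 = (cH x i %/ c1 + b) %% 2 ^ K)%N.
    have [||b bM E] := @cyclic_cell (cH x i) (j0 i) c1 M1 (2 ^ K) _ _ (ltn_ord _).
    - by rewrite expn_gt0.
    - exact: M1d.
    rewrite M1c1 -ltnS in bM; exists (Ordinal bM).
    by rewrite [RHS]/= -E N1c1.
  have [b2 Hb2] : exists b : 'I_(2 ^ (K - 64 * r)).+1,
      ((cV x + a0) %% N4 %/ c4 = (cV x %/ c4 + b) %% 2 ^ K)%N.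
    have [||b bM E] := @cyclic_cell (cV x) a0 c4 M4 (2 ^ K) _ _ (ltn_ord _).
    - by rewrite expn_gt0.
    - exact: M4d.
    rewrite M4c4 -ltnS in bM; exists (Ordinal bM).
    by rewrite [RHS]/= -E N4c4.
  pose b0 : B := ([ffun i => b1 i], b2).
  have at0 : at_cell b0 (drop (n - K) q).
    apply/andP; split.
      apply/forallP => i; rewrite idx_drop -cH_grid_point // E0 cHD cH_shift (modn_small (small i)).
      by rewrite Hb1 /b0 /= ffunE.
    rewrite idx_drop -(@mulnK (idx q ord_max) (2 ^ (3 * n))) ?expn_gt0 //.
    rewrite -cV_grid_point // E0 cVD cV_shift (modn_small smalla) -divnMA -expnD.
    by rewrite e3 Hb2.
  by rewrite (bigD1 b0) //= at0 lerDl sumr_ge0.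
apply: ler_sum => b _.
rewrite (@sum_level_drop _ R n K mu (fun p => (at_cell b p)%:R) mu_add Kn) /= big_seq.
have bound p : p \in level DD K -> 0 <= mu p <= lam ^+ K.
  by rewrite mem_level => /eqP pK; have := @mu_bound p; rewrite pK => /(_ Kn).
have [[p0 [p0K at0]]|no] := pselect (exists p0, p0 \in level DD K /\ at_cell b p0); last first.
  rewrite big1 ?exprn_ge0 ?(ltW lam0) // => p pK.
  case: (boolP (at_cell b p)) => [H|_]; last by rewrite mulr0.
  by case: no; exists p.
rewrite -big_seq (bigD1_seq p0) ?uniq_level //= at0 mulr1.
rewrite big1_seq ?addr0; first by have /andP[] := bound p0 p0K.
move=> p /andP[pp0 pK]; case: (boolP (at_cell b p)) => [H|_]; last by rewrite mulr0.
case/eqP: pp0; apply: idx_inj.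
  by move: pK p0K; rewrite !mem_level => /eqP -> /eqP ->.
move: H at0 => /andP[/forallP H1 /eqP H2] /andP[/forallP H3 /eqP H4] i.
have [ik|ik] := ltnP i k.
  have -> : i = horiz (Ordinal ik) by apply: val_inj.
  by rewrite (eqP (H1 _)) (eqP (H3 _)).
have -> : i = ord_max by apply: val_inj; apply/eqP; rewrite eqn_leq -ltnS ltn_ord.
by rewrite H2 H4.
Qed.

(** [box_mass] divided by the number of points of the box: [2 ^ (K d)] cells of depth [K] fill the
    torus, whence the power of [2 ^ d * lam], and the cells that the box only meets in part
    account for the other factor. *)
Lemma smooth_density K r phi x : (72 * r <= K)%N -> (K <= n)%N ->
  (forall q, 0 <= phi q <= 1) ->
  (smooth n eH eV r (density phi) x : R) <=
    (1 + 2 ^+ (72 * r) / 2 ^+ K) ^+ k.+1 * (2 ^+ k.+1 * lam) ^+ K.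
Proof.
move=> rK Kn Hphi; rewrite /smooth avE.
under eq_bigr do rewrite avE.
rewrite /vline /line size_map size_iota /hbox size_image card_ffun !card_ord.
rewrite big_map -[X in iota 0 X]subn0 -/(index_iota 0 _) big_mkord.
under eq_bigr do rewrite big_image /=.
rewrite -mulr_sumr mulrA.
apply: (@le_trans _ _ ((2 ^ (4 * n - 64 * r))%:R^-1 * ((2 ^ (n - 72 * r)) ^ k)%:R^-1 *
  (#|torus|%:R * (((2 ^ (K - 72 * r)).+1 ^ k * (2 ^ (K - 64 * r)).+1)%:R * lam ^+ K)))).
  rewrite ler_wpM2l ?mulr_ge0 ?invr_ge0 ?ler0n //.
  apply: le_trans (ler_wpM2l (ler0n _ _) (box_mass x rK Kn)).
  rewrite mulr_sumr; apply: ler_sum => a _; rewrite mulr_sumr; apply: ler_sum => j _.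
  rewrite ffunE ler_wpM2l ?ler0n // big_seq [leRHS]big_seq; apply: ler_sum => q.
  rewrite mem_level => /eqP qn; have /andP[mu0 _] := mu_bound (eq_leq qn).
  have /andP[p0 p1] := Hphi q.
  rewrite (_ : x + _ + _ = x + shift (fun i => j i) a); last first.
    by rewrite /shift -addrA; congr (_ + _); rewrite addrC.
  by rewrite ler_wpM2r ?ler0n // ler_piMr.
have sub m l : (l <= m)%N -> (2 ^ (m - l))%:R = 2 ^+ m / 2 ^+ l :> R.
  move=> lm; rewrite natrX -[in RHS](subnK lm) exprD mulfK //.
have r4n : (64 * r <= 4 * n)%N by lia.
have rn : (72 * r <= n)%N by lia.
have rK' : (64 * r <= K)%N by lia.
have r64 : (64 * r <= 72 * r)%N by lia.
rewrite card_torus (natrM _ (2 ^ (n * k))) (natrM _ ((2 ^ (K - 72 * r)).+1 ^ k)).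
rewrite (natrX _ (2 ^ (n - 72 * r))) (natrX _ (2 ^ (K - 72 * r)).+1).
rewrite -(natr1 (2 ^ (K - 72 * r))%N) -(natr1 (2 ^ (K - 64 * r))%N).
rewrite (sub _ _ r4n) (sub _ _ rn) (sub _ _ rK) (sub _ _ rK').
rewrite (natrX _ 2 (n * k)) (natrX _ 2 (4 * n)) (exprM 2 n k).
set X := 2 ^+ n; set Y := 2 ^+ (4 * n); set P := 2 ^+ K; set u := 2 ^+ (72 * r).
set v := 2 ^+ (64 * r).
have Xp : 0 < X by rewrite exprn_gt0.
have Yp : 0 < Y by rewrite exprn_gt0.
have Pp : 0 < P by rewrite exprn_gt0.
have up : 0 < u by rewrite exprn_gt0.
have vp : 0 < v by rewrite exprn_gt0.
have vu : v <= u by rewrite ler_weXn2l ?ler1n.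
have lK : 0 <= lam ^+ K by rewrite exprn_ge0 // ltW.
apply: (@le_trans _ _ ((P + u) ^+ k * (P + v) * lam ^+ K)).
  rewrite le_eqVlt; apply/orP; left; apply/eqP.
  have -> : (P + u) ^+ k = (X / u)^-1 ^+ k * X ^+ k * (P / u + 1) ^+ k.
    by rewrite -!exprMn; congr (_ ^+ _); field; rewrite !gt_eqF.
  by rewrite exprVn; field; rewrite !gt_eqF ?exprn_gt0 ?divr_gt0.
rewrite exprMn -exprM mulnC exprM -/P mulrA ler_wpM2r // -exprMn exprSr.
have -> : (1 + u / P) * P = P + u by field; rewrite gt_eqF.
by rewrite ler_wpM2l ?lerD2l // exprn_ge0 // addr_ge0 // ltW.
Qed.
End Torus.

(** * Pointwise properties of smoothed functions *)

Section Pointwise.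
Variables (R : realType) (G : finZmodType).
Implicit Types (f g : {ffun G -> R^o}) (s : seq G).

Lemma nrm_le_sup f (c : R) : 0 <= c -> (forall x, 0 <= (f x : R) <= c) ->
  nrm f <= c * Num.sqrt #|G|%:R.
Proof.
move=> c0 H; rewrite -(@ler_pXn2r _ 2) ?nnegrE ?mulr_ge0 ?nrm_ge0 ?sqrtr_ge0 //.
rewrite nrm_sqr exprMn sqr_sqrtr ?ler0n // mulr_natr -sumr_const.
apply: ler_sum => x _; have /andP[a b] := H x.
by rewrite -expr2 ler_pXn2r ?nnegrE.
Qed.

(** Integrate [(c - f1) (c - av s f) >= 0], where averaging has not changed the sum of [f]. *)
Lemma corr_lower f1 f s (c : R) : (0 < size s)%N ->
  (forall x, 0 <= (f1 x : R) <= c) -> (forall x, (f x : R) <= c) -> 0 <= c ->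
  c * (\sum_x (f1 x : R) + \sum_x (f x : R) - c * #|G|%:R) <= ip f1 (av s f).
Proof.
move=> s0 H1 H c0; rewrite -(sum_av f s0) /ip.
rewrite (_ : c * #|G|%:R = \sum_(x : G) c); last by rewrite sumr_const mulr_natr.
rewrite -big_split /= -sumrB mulr_sumr; apply: ler_sum => x _.
have /andP[a b] := H1 x; have := av_le x s0 H.
set u := (f1 x : R) in a b *; set v := (av s f x : R) => Hv; nra.
Qed.

Lemma ip_gt0 f g : (forall x, 0 <= (f x : R)) -> (forall x, 0 <= (g x : R)) ->
  0 < ip f g -> exists x, 0 < (f x : R) /\ 0 < (g x : R).
Proof.
move=> f0 g0 H; have [//|no] := pselect (exists x, 0 < (f x : R) /\ 0 < (g x : R)).
suff : ip f g <= 0 by rewrite leNgt H.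
apply: sumr_le0 => x _; have := f0 x; rewrite le_eqVlt => /orP[/eqP <-|fx].
  by rewrite mul0r.
have := g0 x; rewrite le_eqVlt => /orP[/eqP <-|gx]; first by rewrite mulr0.
by case: no; exists x.
Qed.
End Pointwise.

Section Tower.
Variables (R : realType) (k n : nat).
Let G := torus k n.
Implicit Types (f g : {ffun G -> R^o}) (x : G).

Let sm := smooth n (@eH k n) (@eV k n) (R := R).
Let tw := tower n (@eH k n) (@eV k n) (R := R).

Lemma smooth_ge0 r f : (forall x, 0 <= (f x : R)) -> forall x, 0 <= (sm r f x : R).
Proof. by move=> f0; do 2!apply: av_ge0. Qed.

Lemma tower_ge0 r m f : (forall x, 0 <= (f x : R)) -> forall x, 0 <= (tw r m f x : R).
Proof.
elim: m r f => [|m IH] r f f0; first exact: smooth_ge0.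
by apply: smooth_ge0; apply: IH.
Qed.

Lemma smooth_le r f (c : R) : (forall x, (f x : R) <= c) -> forall x, (sm r f x : R) <= c.
Proof.
move=> fc x; apply: av_le; first exact: size_vline.
by move=> y; apply: av_le => //; apply: size_hbox.
Qed.

Lemma tower_le r m f (c : R) : (forall x, (f x : R) <= c) -> forall x, (tw r m f x : R) <= c.
Proof.
elim: m r f => [|m IH] r f fc; first exact: smooth_le.
by apply: smooth_le; apply: IH.
Qed.

Lemma sum_smooth r f : \sum_x (sm r f x : R) = \sum_x (f x : R).
Proof. by rewrite sum_av ?size_vline // sum_av ?size_hbox. Qed.

Lemma sum_tower r m f : \sum_x (tw r m f x : R) = \sum_x (f x : R).
Proof.
elim: m r f => [|m IH] r f; first exact: sum_smooth.
by rewrite /= sum_smooth IH.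
Qed.

Lemma smooth_gt0 r f x : 0 < (sm r f x : R) ->
  exists (j : 'I_k -> nat) (a : nat), [/\ forall i, (j i < 2 ^ (n - 72 * r))%N,
    (a < 2 ^ (4 * n - 64 * r))%N & 0 < (f (x + shift n j a) : R)].
Proof.
move=> H; have [v vm {}H] := @av_gt0 R G (vline n (eV k n) r) _ x H.
have [w wm {}H] := @av_gt0 R G (hbox n (@eH k n) r) _ _ H.
rewrite /vline /line in vm; rewrite /hbox in wm.
have [a] := mapP vm; rewrite mem_iota add0n => /andP[_ aM] vE.
have [j _ wE] := fintype.imageP wm.
exists (fun i : 'I_k => nat_of_ord ((j : {ffun 'I_k -> 'I_(2 ^ (n - 72 * r))}) i)), a; split => //.
by move: H; rewrite vE wE -addrA /shift [eV _ _ *+ _ + _]addrC.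
Qed.

Lemma shiftD j a j' a' :
  shift (k := k) n j a + shift n j' a' = shift n (fun i => j i + j' i)%N (a + a').
Proof.
rewrite /shift mulrnDr addrACA; congr (_ + _).
by rewrite -big_split; apply: eq_bigr => i _; rewrite mulrnDr.
Qed.

Lemma tower1_gt0 r f x : 0 < (tw r 1 f x : R) ->
  exists (j : 'I_k -> nat) (a : nat), [/\ forall i, (j i < 2 * 2 ^ (n - 72 * r))%N,
    (a < 2 * 2 ^ (4 * n - 64 * r))%N & 0 < (f (x + shift n j a) : R)].
Proof.
move=> H; have [j [a [Hj Ha {}H]]] := smooth_gt0 H.
have [j' [a' [Hj' Ha' {}H]]] := smooth_gt0 H.
have l1 : (n - 72 * r.+1 <= n - 72 * r)%N by rewrite leq_sub2l // leq_mul2l leqnSn.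
have l4 : (4 * n - 64 * r.+1 <= 4 * n - 64 * r)%N by rewrite leq_sub2l // leq_mul2l leqnSn.
exists (fun i => j i + j' i)%N, (a + a')%N; split.
- move=> i; rewrite mul2n -addnn -addSn leq_add ?Hj // ltnW // (leq_trans (Hj' i)) //.
  by rewrite leq_exp2l.
- by rewrite mul2n -addnn -addSn leq_add // ltnW // (leq_trans Ha') // leq_exp2l.
- by rewrite -shiftD addrA.
Qed.

End Tower.

(** * From congruences on the torus to displacements *)

(** The bounds leave no room for wrapping around. *)
Lemma eq_of_modn (N x j y b : nat) : (x + j = y + b %[mod N])%N ->
  (x < N)%N -> (j <= b)%N -> (y + b < N + j)%N -> (x + j = y + b)%N.
Proof.
move=> E xN jb yb; have H : (y + b = (y + b - j) + j)%N by lia.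
move: E; rewrite H => /eqP; rewrite eqn_modDr => /eqP.
by rewrite !modn_small //; lia.
Qed.

Section Pairs.
Variables (R : realType) (k n J gam : nat).
Let W := (2 ^ (n - gam))%N.
Hypotheses (k0 : (0 < k)%N) (kgam : (1024 * k <= 4 ^ gam)%N).

Lemma gam_ge5 : (5 <= gam)%N.
Proof.
have : (4 ^ 5 <= 4 ^ gam)%N.
  by apply: leq_trans kgam; rewrite -[(4 ^ 5)%N]/1024%N -[X in (X <= _)%N]muln1 leq_mul2l k0.
by rewrite leq_exp2l.
Qed.

Hypotheses (J0 : (0 < J)%N) (gamJ : (gam < 64 * J)%N) (Jn : (72 * J + 73 <= n)%N).

(** The point [x1] lies in the lower half of the torus and the displacements are much shorter, so
    there is no wrapping around; the error comes from the two boxes of the smoothing. *)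
Lemma horizontal_coord (x1 x2 j1 j2 w : nat) :
  (x2 + j1 = x1 + (W + w) + j2 %[mod 2 ^ n])%N ->
  (x2 < 2 ^ n)%N -> (x1 < 2 ^ n.-1)%N -> (w < W)%N ->
  (j1 < 2 * 2 ^ (n - 72 * J))%N -> (j2 < 2 * 2 ^ (n - 72 * J))%N ->
  `|(x2%:R - x1%:R) / 2 ^+ n - (W + w)%:R / (2 ^ n)%:R| <= (2 ^+ J)^-1 :> R.
Proof.
move=> E x2n x1n wW j1n j2n.
have g5 := gam_ge5.
have h1 : (2 ^ n = 2 * 2 ^ n.-1)%N by rewrite -expnS prednK //; lia.
have h2 : (16 * W <= 2 ^ n.-1)%N.
  rewrite /W -[16%N]/(2 ^ 4)%N -expnD leq_exp2l //; lia.
have h3 : (2 * 2 ^ (n - 72 * J) <= W)%N.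
  rewrite /W -expnS leq_exp2l //; lia.
have h4 : (2 ^ J * (2 * 2 ^ (n - 72 * J)) <= 2 ^ n)%N.
  rewrite -expnS -expnD leq_exp2l //; lia.
have {}E : (x2 + j1 = x1 + (W + w + j2))%N.
  apply: (eq_of_modn (N := (2 ^ n)%N)) => //; first by rewrite addnA.
    by apply: (leq_trans (ltnW j1n)); apply: leq_trans h3 _; rewrite -addnA leq_addr.
  clear E gamJ Jn; move: h1 h2 h3 x1n wW j1n j2n; clearbody W.
  move: (2 ^ n)%N (2 ^ n.-1)%N (2 ^ (n - 72 * J))%N => A B C; lia.
have p : 0 < 2 ^+ n :> R by rewrite exprn_gt0.
have pJ : 0 < 2 ^+ J :> R by rewrite exprn_gt0.
have -> : (x2%:R - x1%:R) / 2 ^+ n - (W + w)%:R / (2 ^ n)%:R = (j2%:R - j1%:R) / 2 ^+ n :> R.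
  have := congr1 (GRing.natmul (1 : R)) E; rewrite !natrD natrX => E'.
  rewrite -mulrBl; congr (_ / _); lra.
rewrite normrM normfV (gtr0_norm p) ler_pdivrMr // [leRHS]mulrC ler_pdivlMr //.
have b1 : 2 ^+ J * (2 * 2 ^ (n - 72 * J))%:R <= 2 ^+ n :> R.
  by rewrite -!natrX -natrM ler_nat.
apply: le_trans b1; rewrite mulrC ler_wpM2l ?(ltW pJ) //.
have c1 : j1%:R <= (2 * 2 ^ (n - 72 * J))%:R :> R by rewrite ler_nat ltnW.
have c2 : j2%:R <= (2 * 2 ^ (n - 72 * J))%:R :> R by rewrite ler_nat ltnW.
have c3 : 0 <= j1%:R :> R by rewrite ler0n.
have c4 : 0 <= j2%:R :> R by rewrite ler0n.
rewrite ler_norml; lra.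
Qed.

(** As in the horizontal directions, but the vertical displacement [y] is of order [1/10] to [1/4]
    of the torus: [x1] in the lower half still excludes wrapping around. *)
Lemma vertical_coord (x1 x2 a1 a2 y : nat) (c : R) :
  (x2 * 2 ^ (3 * n) + a1 = x1 * 2 ^ (3 * n) + y + a2 %[mod 2 ^ (4 * n)])%N ->
  (x2 < 2 ^ n)%N -> (x1 < 2 ^ n.-1)%N ->
  (a1 < 2 * 2 ^ (4 * n - 64 * J))%N -> (a2 < 2 * 2 ^ (4 * n - 64 * J))%N ->
  y = Num.truncn ((2 ^ n)%:R ^+ 4 * c) -> 1 / 10 <= c -> c <= 1 / 4 ->
  `|(x2%:R - x1%:R) / 2 ^+ n - c| <= (2 ^+ J)^-1 :> R.
Proof.
move=> E x2n x1n a1n a2n yE c1 c2.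
have n4 : (2 ^ n)%:R ^+ 4 = (2 ^ (4 * n))%:R :> R by rewrite !natrX -exprM mulnC.
have c0 : 0 <= c by lra.
have /andP[] := truncn_itv (mulr_ge0 (exprn_ge0 4 (ler0n R (2 ^ n))) c0).
rewrite -yE n4 -natr1 => y1 y2.
have l1 : (4 * n = n + 3 * n)%N by clear; lia.
have l1' : (4 * n = (n.-1 + 3 * n).+1)%N by move: Jn; clear; lia.
have l2 : (5 + (4 * n - 64 * J).+1 <= 4 * n)%N by move: Jn J0; clear; lia.
have l3 : (2 + (J + (4 * n - 64 * J).+1) <= 4 * n)%N by move: Jn J0; clear; lia.
have h1 : (2 ^ (4 * n) = 2 ^ n * 2 ^ (3 * n))%N by rewrite [in LHS]l1 expnD.
have h1' : (2 ^ (4 * n) = 2 * (2 ^ n.-1 * 2 ^ (3 * n)))%N.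
  by rewrite [in LHS]l1' expnS expnD.
have h2 : (32 * (2 * 2 ^ (4 * n - 64 * J)) <= 2 ^ (4 * n))%N.
  by rewrite -expnS -[32%N]/(2 ^ 5)%N -expnD leq_exp2l.
have h3 : (4 * (2 ^ J * (2 * 2 ^ (4 * n - 64 * J))) <= 2 ^ (4 * n))%N.
  by rewrite -expnS -expnD -[4%N in X in (X <= _)%N]/(2 ^ 2)%N -expnD leq_exp2l.
have N4p : 0 < (2 ^ (4 * n))%:R :> R by rewrite ltr0n expn_gt0.
have y4 : (4 * y <= 2 ^ (4 * n))%N by rewrite -(@ler_nat R) natrM; nra.
have y10 : (2 ^ (4 * n) < 10 * y.+1)%N by rewrite -(@ltr_nat R) natrM -natr1; nra.
have p3 : (0 < 2 ^ (3 * n))%N by rewrite expn_gt0.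
have {}E : (x2 * 2 ^ (3 * n) + a1 = x1 * 2 ^ (3 * n) + (y + a2))%N.
  apply: (eq_of_modn (N := (2 ^ (4 * n))%N)).
  - by rewrite addnA.
  - by rewrite h1 ltn_pmul2r.
  - move: h2 y10 a1n; move: (2 ^ (4 * n))%N (2 ^ (4 * n - 64 * J))%N.
    by clear; move=> A B; lia.
  have : (x1 * 2 ^ (3 * n) < 2 ^ n.-1 * 2 ^ (3 * n))%N by rewrite ltn_pmul2r.
  rewrite addnA; move: h1' h2 y4 a2n; move: (2 ^ (4 * n))%N (2 ^ (4 * n - 64 * J))%N.
  move: (2 ^ n.-1 * 2 ^ (3 * n))%N (x1 * _)%N.
  by clear; move=> A B C F; lia.
have p : 0 < 2 ^+ n :> R by rewrite exprn_gt0.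
have pJ : 0 < 2 ^+ J :> R by rewrite exprn_gt0.
have -> : (x2%:R - x1%:R) / 2 ^+ n - c =
   ((y%:R - (2 ^ (4 * n))%:R * c) + (a2%:R - a1%:R)) / (2 ^ (4 * n))%:R.
  have := congr1 (GRing.natmul (1 : R)) E; rewrite !natrD !natrM.
  have := congr1 (GRing.natmul (1 : R)) h1; rewrite natrM (natrX _ 2 n).
  set P3 := (2 ^ (3 * n))%:R; set P4 := (2 ^ (4 * n))%:R => P4E E'.
  have P3p : 0 < P3 by rewrite ltr0n expn_gt0.
  have -> : y%:R - P4 * c + (a2%:R - a1%:R) = (x2%:R - x1%:R) * P3 - P4 * c by lra.
  by rewrite P4E; field; rewrite !gt_eqF.
rewrite normrM normfV (gtr0_norm N4p) ler_pdivrMr // [leRHS]mulrC ler_pdivlMr //.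
have b1 : 4 * (2 ^+ J * (2 * 2 ^ (4 * n - 64 * J))%:R) <= (2 ^ (4 * n))%:R :> R.
  by rewrite -natrX -!natrM ler_nat.
apply: le_trans b1; rewrite mulrC mulrCA ler_wpM2l ?(ltW pJ) //.
have c1' : a1%:R <= (2 * 2 ^ (4 * n - 64 * J))%:R :> R by rewrite ler_nat ltnW.
have c2' : a2%:R <= (2 * 2 ^ (4 * n - 64 * J))%:R :> R by rewrite ler_nat ltnW.
have c5 : 1 <= (2 * 2 ^ (4 * n - 64 * J))%:R :> R by rewrite ler1n muln_gt0 expn_gt0.
have c3 : 0 <= a1%:R :> R by rewrite ler0n.
have c4 : 0 <= a2%:R :> R by rewrite ler0n.
rewrite ler_norml; lra.
Qed.
End Pairs.

(** * Positivity of the correlation and the resulting pair of nodes *)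

(** The arithmetic of the lower bound: [A] and [B] are the correlations at the fine and at the
    coarse scale, [S] and [g * m0] the integrals of the two densities over [g] points, each at
    most [1 + eta]. *)
Lemma main_term (R : realFieldType) (S g m0 rho eta e0 A B bound : R) :
  0 < g -> 0 <= eta -> 1 - rho < m0 -> rho + eta <= e0 / 4 ->
  g * (e0 - rho - eta) <= S -> 0 < e0 / 4 * g ->
  (1 + eta) * (S + g * m0 - (1 + eta) * g) <= B -> bound <= e0 / 4 * g ->
  - bound <= A - B -> 0 < A.
Proof.
move=> g0 h0 Hm Hs HS e0g HB Hb HA.
have H1 : e0 / 2 * g <= S + g * m0 - (1 + eta) * g.
  have : 0 < g * (m0 - (1 - rho)) by rewrite mulr_gt0 // subr_gt0.
  have : 0 <= g * (e0 / 4 - (rho + eta)) by rewrite mulr_ge0 ?subr_ge0 // ltW.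
  lra.
have : 0 <= eta * (S + g * m0 - (1 + eta) * g) by rewrite mulr_ge0 //; lra.
lra.
Qed.

Section Discrete.
Variables (R : realType) (k n gam r0 m K0 : nat) (t lam rho eta : R).
Let d := k.+1.
Let DD := {ffun 'I_d -> bool}.
Let W := (2 ^ (n - gam))%N.
Let N1 := (2 ^ n)%N.
Let J := (r0 + m)%N.
Let G := torus k n.
Hypotheses (k0 : (0 < k)%N) (kgam : (1024 * k <= 4 ^ gam)%N).
Hypotheses (t1 : 1 / 8 <= t) (t2 : t <= 1 / 4).
Hypotheses (r5 : (5 <= r0)%N) (gamr : (gam <= 28 * r0)%N) (Jn : (72 * J + 73 <= n)%N).
Hypotheses (rK0 : (72 * r0 <= K0)%N) (K0n : (K0 <= n)%N).
Hypotheses (lam0 : 0 < lam) (eta0 : 0 < eta).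
Let th := 2 ^+ d * lam.
Let e0 : R := (2 ^+ d)^-1.
Hypothesis th1 : th <= 1 + eta.
Hypothesis th72 : th ^+ 72 <= 5 / 4.
Hypothesis thK : (1 + 2 ^+ (72 * r0) / 2 ^+ K0) ^+ d * th ^+ K0 <= 1 + eta.
Hypothesis small : rho + eta <= e0 / 4.
Hypothesis r0_large : 12 * (6 + 10 * k%:R) * (2 ^+ d) ^+ 2 / 2 ^+ r0 <= e0 / 4.
Variable mu : seq DD -> R.
Hypothesis mu_bound : forall q, (size q <= n)%N -> 0 <= mu q <= lam ^+ size q.
Hypothesis mu_add : forall q, (size q < n)%N -> \sum_i mu (i :: q) = mu q.
Hypothesis mu_root : 1 - rho < mu [::].

Let sp := sphere_pts n gam (@eH k n) (eV k n) t.
Let sm := smooth n (@eH k n) (@eV k n) (R := R).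
Let tw := tower n (@eH k n) (@eV k n) (R := R).

Let f : {ffun G -> R^o} := density n mu (fun=> 1).
(* The indicator of the corner subcube of depth 1, from which the displacements considered do not
   wrap around the torus. *)
Let corner (q : seq DD) : R := (drop n.-1 q == [:: [ffun=> false]])%:R.
Let f1 : {ffun G -> R^o} := density n mu corner.

Lemma n_gt0 : (0 < n)%N.
Proof. by apply: leq_trans Jn; rewrite addnS. Qed.

Lemma n_large r : (r <= J.+1)%N -> (72 * r <= n)%N.
Proof.
move=> rJ; apply: leq_trans Jn; apply: (@leq_trans (72 * J.+1)); first by rewrite leq_mul2l rJ orbT.
by rewrite mulnS addnC leq_add2l.
Qed.

Lemma gam_le : (gam <= n)%N.
Proof.
apply: leq_trans gamr _; apply: leq_trans (n_large (r := r0) _); last by rewrite /J leqW ?leq_addr.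
by rewrite leq_mul2r orbT.
Qed.

Lemma J_gt0 : (0 < J)%N.
Proof. by rewrite /J addn_gt0 (leq_trans _ r5). Qed.

Lemma gam_lt_J : (gam < 64 * J)%N.
Proof.
apply: leq_ltn_trans gamr _; apply: (@leq_ltn_trans (28 * J)).
  by rewrite leq_mul2l leq_addr orbT.
by rewrite ltn_mul2r J_gt0.
Qed.

Lemma corner01 q : 0 <= corner q <= 1.
Proof. by rewrite /corner; case: eqP => _ /=; rewrite ?lexx ?ler01. Qed.

Lemma density_ge0 phi : (forall q, 0 <= phi q <= 1) ->
  forall x, 0 <= (density n mu phi x : R).
Proof.
move=> Hphi x; rewrite ffunE mulr_ge0 ?ler0n // big_seq sumr_ge0 // => q.
rewrite mem_level => /eqP qn; have /andP[a _] := mu_bound (eq_leq qn).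
by have /andP[b _] := Hphi q; rewrite !mulr_ge0.
Qed.

Lemma density_gt0 phi x : (forall q, 0 <= phi q <= 1) -> 0 < (density n mu phi x : R) ->
  exists q, [/\ size q = n, 0 < mu q, 0 < phi q & grid_point n q = x].
Proof.
move=> Hphi; rewrite ffunE => H.
have [//|no] := pselect (exists q, [/\ size q = n, 0 < mu q, 0 < phi q & grid_point n q = x]).
suff E : \sum_(q <- level DD n) mu q * phi q * (grid_point n q == x)%:R = 0.
  by move: H; rewrite E mulr0 ltxx.
rewrite big_seq big1 // => q; rewrite mem_level => /eqP qn.
have /andP[a _] := mu_bound (eq_leq qn); have /andP[b _] := Hphi q.
have [pq|] := eqVneq (grid_point n q) x; last by rewrite mulr0.
move: a b; rewrite !le_eqVlt => /orP[/eqP <-|a]; first by rewrite !mul0r.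
move=> /orP[/eqP <-|b]; first by rewrite mulr0 mul0r.
by case: no; exists q.
Qed.

Lemma one01 (q : seq DD) : 0 <= (1 : R) <= 1. Proof. by rewrite ler01 lexx. Qed.

Lemma smooth_f_le r phi x : (forall q, 0 <= phi q <= 1) -> (r <= J.+1)%N ->
  (sm r (density n mu phi) x : R) <= 2 ^+ d * (5 / 4) ^+ r.
Proof.
move=> Hphi rJ; have rn := n_large rJ.
apply: le_trans (smooth_density lam0 mu_bound mu_add x (leqnn _) rn Hphi) _.
rewrite divff ?expf_eq0 ?pnatr_eq0 ?andbF // -/th exprM.
have -> : (1 + 1 : R) = 2 by ring.
have th0 : 0 <= th by rewrite /th mulr_ge0 ?exprn_ge0 // ltW.
by rewrite ler_wpM2l ?exprn_ge0 // lerXn2r ?nnegrE ?divr_ge0 // exprn_ge0.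
Qed.

Lemma nrm_smooth_f r phi : (forall q, 0 <= phi q <= 1) -> (r <= J + 1)%N ->
  nrm (sm r (density n mu phi)) <= 2 ^+ d * (5 / 4) ^+ r * Num.sqrt #|G|%:R.
Proof.
rewrite addn1 => Hphi rJ; apply: nrm_le_sup => [|x].
  by rewrite mulr_ge0 ?exprn_ge0 // divr_ge0.
rewrite smooth_f_le // andbT; apply: smooth_ge0; exact: density_ge0.
Qed.

Lemma tower_f_le phi x : (forall q, 0 <= phi q <= 1) ->
  (tw r0 m.+1 (density n mu phi) x : R) <= 1 + eta.
Proof.
move=> Hphi; rewrite /tw [tower _ _ _ _ _ _]/= -tower_smooth; apply: tower_le => y.
exact: le_trans (smooth_density lam0 mu_bound mu_add y rK0 K0n Hphi) thK.
Qed.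

Lemma mass_f : \sum_x (f x : R) = #|G|%:R * mu [::].
Proof.
rewrite /f sum_density; congr (_ * _).
have := @sum_level_drop DD R n 0 mu (fun=> 1) mu_add (leq0n _).
by rewrite /= big_seq1 mulr1.
Qed.

(** The other [2 ^ d - 1] subcubes of depth [1] carry at most [lam] each, and [2 ^ d * lam] is at
    most [1 + eta]: a nearly full cube has nearly full corners. *)
Lemma mass_f1 : #|G|%:R * (e0 - rho - eta) <= \sum_x (f1 x : R).
Proof.
rewrite /f1 sum_density ler_wpM2l ?ler0n // /corner.
pose phi (p : seq DD) : R := (p == [:: [ffun=> false]])%:R.
have n1 : (n - 1 = n.-1)%N by rewrite subn1.
have := @sum_level_drop DD R n 1 mu phi mu_add n_gt0.
rewrite n1 /phi => ->; rewrite sum_levelS /= big_seq1.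
rewrite (bigD1 [ffun=> false]) //= eqxx mulr1 big1 ?addr0 => [|i ii]; last first.
  by case: eqP => [[E]|]; [rewrite E eqxx in ii | rewrite mulr0].
have := mu_add (q := [::]) n_gt0; rewrite (bigD1 [ffun=> false]) //= => E.
have H : \sum_(i | i != [ffun=> false]) mu [:: i] <= (2 ^+ d - 1) * lam.
  have -> : 2 ^+ d - 1 = #|[pred i : DD | i != [ffun=> false]]|%:R :> R.
    have := cardC1 ([ffun=> false] : DD); rewrite card_ffun card_bool card_ord => C.
    have -> : #|[pred i : DD | i != [ffun=> false]]| = (2 ^ d).-1.
      by rewrite -C; apply: eq_card => i; rewrite !inE.
    by rewrite -natrX -subn1 natrB ?expn_gt0.
  rewrite mulr_natl -sumr_const; apply: ler_sum => i _.
  by have /andP[_] := mu_bound (q := [:: i]) n_gt0; rewrite expr1.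
have th' : (2 ^+ d - 1) * lam = th - e0 * th.
  by rewrite /th /e0 mulrBl mul1r mulKf // expf_eq0 pnatr_eq0 andbF.
have e01 : 0 < e0 <= 1.
  by rewrite invr_gt0 exprn_gt0 //= invf_le1 ?exprn_gt0 // exprn_ege1 // ler1n.
have thp : 0 < th by rewrite mulr_gt0 // exprn_gt0.
rewrite th' in H; move/andP: e01 => [e0p e0le].
have H1 : 0 <= (1 - e0) * (1 + eta - th) by rewrite mulr_ge0 ?subr_ge0.
have H2 : 0 <= e0 * eta by rewrite mulr_ge0 // ltW.
move: mu_root E H; lra.
Qed.

(** The correlation is bounded below at the coarse scale [r0] by [corr_lower], and [corr_tower]
    carries this bound to the fine scale [J]. *)
Lemma corr_pos : 0 < ip (tw J 1 f1) (av sp (tw J 1 f)).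
Proof.
have kg := gam_le.
have v0 : 0 <= 2 ^+ d * Num.sqrt #|G|%:R :> R by rewrite mulr_ge0 ?exprn_ge0 ?sqrtr_ge0.
have := @corr_tower R G k n gam (@eH k n) (eV k n) t k0 kg kgam t1 t2 r0 m f1 f
  (2 ^+ d) (Num.sqrt #|G|%:R) r5 gamr Jn v0
  (fun r' h => nrm_smooth_f corner01 h) (fun r' h => nrm_smooth_f one01 h).
rewrite -/J -/tw /corr -/sp exprMn sqr_sqrtr ?ler0n //.
have sp0 : (0 < size sp)%N.
  rewrite size_image card_ffun !card_ord expn_gt0 expn_gt0 //.
have := @corr_lower R G (tw r0 m.+1 f1) (tw r0 m.+1 f) sp (1 + eta) sp0.
have eta1 : 0 <= 1 + eta by rewrite addr_ge0 // ltW.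
move=> /(_ _ _ eta1); rewrite !sum_tower mass_f => low.
have {}low := low (fun x => _) (fun x => tower_f_le x one01).
have {}low : (1 + eta) * (\sum_x (f1 x : R) + #|G|%:R * mu [::] - (1 + eta) * #|G|%:R) <=
   ip (tw r0 m.+1 f1) (av sp (tw r0 m.+1 f)).
  apply: low => x; rewrite tower_f_le ?andbT //; last exact: corner01.
  by apply: tower_ge0; apply: density_ge0; apply: corner01.
have m1 := mass_f1; set g := #|G|%:R in low m1 *.
have g0 : 0 < g by rewrite ltr0n; apply/card_gt0P; exists 0.
rewrite ler_norml => /andP[H _].
have e01 : 0 < e0 by rewrite invr_gt0 exprn_gt0.
have H2 : 12 * (6 + 10 * k%:R) * ((2 ^+ d) ^+ 2 * g) / 2 ^+ r0 <= e0 / 4 * g.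
  have -> : 12 * (6 + 10 * k%:R) * ((2 ^+ d) ^+ 2 * g) / 2 ^+ r0 =
    12 * (6 + 10 * k%:R) * (2 ^+ d) ^+ 2 / 2 ^+ r0 * g by ring.
  by rewrite ler_wpM2r // ltW.
have e0g : 0 < e0 / 4 * g by rewrite mulr_gt0 // divr_gt0.
exact: (main_term g0 (ltW eta0) mu_root small m1 e0g low H2 H).
Qed.

(** A positive correlation yields a point where both smoothed densities are positive, hence two
    charged nodes whose difference is, up to the boxes of scale [J], a point of the discrete cap.
    *)
Lemma discrete_pair : exists (q1 q2 : seq DD) (u : 'I_d -> R),
  [/\ size q1 = n /\ 0 < mu q1, size q2 = n /\ 0 < mu q2, \sum_i u i ^+ 2 = t ^+ 2 &
      forall i, `|((idx q2 i)%:R - (idx q1 i)%:R) / 2 ^+ n - u i| <= (2 ^+ J)^-1].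
Proof.
have f0 := density_ge0 one01; have f10 := density_ge0 corner01.
have [||x [H1 H2]] := @ip_gt0 R G (tw J 1 f1) (av sp (tw J 1 f)) _ _ corr_pos.
- exact: tower_ge0.
- by apply: av_ge0; apply: tower_ge0.
have [j1 [a1 [Hj1 Ha1 {}H1]]] := tower1_gt0 H1.
have [v vsp {}H2] := av_gt0 H2.
have [j2 [a2 [Hj2 Ha2 {}H2]]] := tower1_gt0 H2.
have [w _ vE] := fintype.imageP vsp.
have [q1 [q1n mu1 cq1 E1]] := density_gt0 corner01 H1.
have [q2 [q2n mu2 _ E2]] := density_gt0 one01 H2.
pose y := height W N1 t (emb w).
have {}vE : v = shift n (fun i => (W + emb w i)%N) y by rewrite vE.
have E : grid_point n q2 + shift n j1 a1 = grid_point n q1 + shift n (fun i => (W + emb w i)%N) y + shift n j2 a2.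
  by rewrite E1 E2 -vE [LHS](ACl (1*4*2*3))%AC.
have low1 i : (idx q1 i < 2 ^ n.-1)%N.
  move: cq1; rewrite /corner; case: eqP => [c1 _|]; last by rewrite ltxx.
  have p : (0 < 2 ^ n.-1)%N by rewrite expn_gt0.
  have : (idx q1 i %/ 2 ^ n.-1 = 0)%N by rewrite -idx_drop c1 /= ffunE.
  by rewrite ltnNge => E0; rewrite -(divn_gt0 _ p) E0.
have wW i : (emb w i < W)%N by rewrite ffunE; apply: ltn_ord.
have J0 := J_gt0; have gamJ := gam_lt_J.
have g5 := gam_ge5 k0 kgam.
have gn := gam_le.
have N10 : (0 < N1)%N by rewrite expn_gt0.
have [capE cap1 cap2] := @cap_bounds R k W N1 t N10 (window_le k0 gn kgam) k0 t1 t2 (emb w) wW.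
(* The point of the sphere of radius [t] above the base point of the discrete cap: its last
   coordinate is the exact height instead of the rounded one. *)
pose u (i : 'I_d) : R := if insub (val i) is Some l then (W + emb w l)%:R / N1%:R else cap W N1 t (emb w).
have uL (l : 'I_k) : u (horiz l) = (W + emb w l)%:R / N1%:R.
  by rewrite /u /= insubT // => lk; congr ((W + emb w _)%:R / _); apply: val_inj.
have uV : u ord_max = cap W N1 t (emb w) by rewrite /u /= insubF // ltnn.
exists q1, q2, u; split => //.
  rewrite big_ord_recr /= uV capE (eq_bigr (fun l => ((W + emb w l)%:R / N1%:R) ^+ 2)).
    by rewrite -/(sqsum R W N1 (emb w)) addrC subrK.
  by move=> l _; rewrite -/(horiz l) uL.
move=> i; have [ik|ik] := ltnP i k.
  have -> : i = horiz (Ordinal ik) by apply: val_inj.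
  set l := Ordinal ik; rewrite uL.
  apply: (horizontal_coord R k0 kgam J0 gamJ Jn _ _ _ (wW l) (Hj1 l) (Hj2 l)) => //.
  - have := congr1 (fun x => cH x l) E; rewrite (cHD (grid_point n q2)) (cHD (_ + _) (shift n j2 a2)) (cHD (grid_point n q1)) !cH_grid_point // !cH_shift.
    by rewrite !modnDmr !modnDml.
  - by have := idx_lt q2 (horiz l); rewrite q2n.
have -> : i = ord_max by apply: val_inj; apply/eqP; rewrite eqn_leq -ltnS ltn_ord.
rewrite uV; apply: (vertical_coord J0 Jn _ _ (low1 ord_max) Ha1 Ha2 (y := y)) => //.
- have := congr1 (@cV k n) E; rewrite (cVD (grid_point n q2)) (cVD (_ + _) (shift n j2 a2)) (cVD (grid_point n q1)) !cV_grid_point // !cV_shift.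
  by rewrite !modnDmr !modnDml.
- by have := idx_lt q2 ord_max; rewrite q2n.
- exact: le_trans t2.
Qed.
End Discrete.

(** * Choice of the parameters *)

Lemma bernoulli_upper (R : realFieldType) (x : R) n : 0 <= x <= 1 ->
  (1 + x) ^+ n <= 1 + 4 ^+ n * x.
Proof.
move=> /andP[x0 x1]; elim: n => [|n IH]; first by rewrite !expr0 mul1r lerDl.
have p1 : 1 <= 4 ^+ n :> R by rewrite exprn_ege1 // ler1n.
rewrite !exprS; set P := 4 ^+ n in IH p1 *; set Y := (1 + x) ^+ n in IH *.
have H1 : (1 + x) * Y <= (1 + x) * (1 + P * x) by rewrite ler_wpM2l // addr_ge0.
have H2 : 0 <= (P - 1) * x by rewrite mulr_ge0 // subr_ge0.
have H3 : 0 <= (P * x) * (1 - x) by rewrite !mulr_ge0 ?subr_ge0 // (le_trans _ p1).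
have H4 : 0 <= P * x by rewrite mulr_ge0 // (le_trans _ p1).
lra.
Qed.

(** The order of choice: [gam] makes the cap flat, then [r0] makes the total change of the
    correlation over the scales finer than [r0] small, then [K0] makes the cells of depth [K0]
    fine compared with the boxes of scale [r0], then [delta], which decides how close [s] must be
    to [d], is small compared with [4 ^- K0]. *)
Lemma constants (R : realType) (k : nat) (d := k.+1) (e0 : R := (2 ^+ d)^-1) :
  exists (gam r0 K0 : nat) (delta : R),
  [/\ (1024 * k <= 4 ^ gam)%N, (5 <= r0)%N, (gam <= 28 * r0)%N & (72 * r0 <= K0)%N] /\
  [/\ 0 < delta, delta <= 1, 12 * (6 + 10 * k%:R) * (2 ^+ d) ^+ 2 / 2 ^+ r0 <= e0 / 4 &
   forall th : R, 0 <= th <= 1 + delta -> [/\ th <= 1 + e0 / 8, th ^+ 72 <= 5 / 4 &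
     (1 + 2 ^+ (72 * r0) / 2 ^+ K0) ^+ d * th ^+ K0 <= 1 + e0 / 8]].
Proof.
pose gam := (k + 5)%N; pose Cn := (48 * (6 + 10 * k) * 2 ^ (3 * d))%N.
pose r0 := (Cn + gam + 5)%N; pose K0 := (72 * r0 + (3 * d + 5))%N.
pose delta : R := e0 / 32 / 4 ^+ K0.
have p2 (n : nat) : 0 < 2 ^+ n :> R by rewrite exprn_gt0.
have p4 : 1 <= 4 ^+ K0 :> R by rewrite exprn_ege1 // ler1n.
have e0p : 0 < e0 by rewrite invr_gt0.
have e01 : e0 <= 1 by rewrite invf_le1 // exprn_ege1 // ler1n.
have delta0 : 0 < delta by rewrite !divr_gt0 // (lt_le_trans _ p4).
have delta1 : delta <= e0 / 32.
  by rewrite ler_pdivrMr ?(lt_le_trans _ p4) // ler_peMr // divr_ge0 // ltW.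
exists gam, r0, K0, delta; split; first split.
- rewrite /gam expnD mulnC leq_mul2r orbC; apply/orP; left.
  by apply: ltnW; apply: ltn_expl.
- by rewrite /r0 leq_addl.
- by rewrite /r0 -addnA addnCA; apply: (leq_trans (leq_addr (Cn + 5) gam)); rewrite leq_pmull.
- by rewrite /K0 leq_addr.
split => //; first lra.
  have H : (Cn <= 2 ^ r0)%N.
    apply: ltnW; apply: (leq_trans (ltn_expl Cn (isT : 1 < 2)%N)).
    by rewrite leq_exp2l // /r0 -addnA leq_addr.
  have {}H : 48 * (6 + 10 * k%:R) * (2 ^+ d) ^+ 3 <= 2 ^+ r0 :> R.
    move: H; rewrite -(@ler_nat R) natrX natrM natrM natrD natrM natrX.
    by rewrite -exprM [(3 * d)%N]mulnC.
  rewrite ler_pdivrMr //.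
  apply: (@le_trans _ _ (e0 / 4 * (48 * (6 + 10 * k%:R) * (2 ^+ d) ^+ 3))).
    by rewrite le_eqVlt; apply/orP; left; apply/eqP; rewrite /e0; field; rewrite gt_eqF.
  by rewrite ler_wpM2l // divr_ge0 // ltW.
move=> th /andP[th0 thle].
have thK : th ^+ K0 <= 1 + e0 / 32.
  apply: (@le_trans _ _ ((1 + delta) ^+ K0)); first by rewrite lerXn2r ?nnegrE //; lra.
  apply: le_trans (bernoulli_upper _ _) _; first by apply/andP; split; lra.
  by rewrite lerD2l /delta mulrCA divff ?mulr1 // gt_eqF // (lt_le_trans _ p4).
split; first lra.
- apply: (@le_trans _ _ ((1 + delta) ^+ 72)); first by rewrite lerXn2r ?nnegrE //; lra.
  apply: (@le_trans _ _ ((1 + delta) ^+ K0)).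
    by rewrite ler_weXn2l ?lerDl ?ltW // /K0 /r0; lia.
  apply: le_trans (bernoulli_upper _ _) _; first by apply/andP; split; lra.
  rewrite /delta mulrCA divff ?mulr1 ?gt_eqF ?(lt_le_trans _ p4) //; lra.
have -> : 2 ^+ (72 * r0) / 2 ^+ K0 = (2 ^+ (3 * d + 5))^-1 :> R.
  by rewrite /K0 exprD invfM mulrA divff ?mul1r // gt_eqF.
have Hx : (1 + (2 ^+ (3 * d + 5))^-1) ^+ d <= 1 + e0 / 32 :> R.
  apply: le_trans (bernoulli_upper _ _) _.
    by rewrite invr_ge0 ltW //= invf_le1 // exprn_ege1 // ler1n.
  rewrite lerD2l le_eqVlt; apply/orP; left; apply/eqP.
  have -> : 4 ^+ d = 2 ^+ d * 2 ^+ d :> R by rewrite -exprMn; congr (_ ^+ _); ring.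
  rewrite (_ : 3 * d + 5 = d + d + d + 5)%N; last by lia.
  by rewrite /e0 !exprD; field; rewrite gt_eqF.
have a0 : 0 <= (1 + (2 ^+ (3 * d + 5))^-1) ^+ d :> R.
  by rewrite exprn_ge0 // addr_ge0 // invr_ge0 ltW.
have b0 : 0 <= th ^+ K0 by rewrite exprn_ge0.
apply: le_trans (ler_pM a0 b0 Hx thK) _; nra.
Qed.

(** * Passage to the limit *)

Lemma sqr_perturb (R : realFieldType) (z u h : R) :
  -1 <= z <= 1 -> h <= 2 -> `|z - u| <= h -> `|z ^+ 2 - u ^+ 2| <= 4 * h.
Proof.
move=> /andP[z0 z1] h2; rewrite [`|z - u| <= h]ler_norml => /andP[a b].
have -> : z ^+ 2 - u ^+ 2 = (z - u) * (z + u) by ring.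
have : `|(z - u) * (z + u)| <= h * 4.
  by rewrite normrM ler_pM // ler_norml; apply/andP; split; lra.
by rewrite [h * 4]mulrC.
Qed.

(** [discrete_pair] for the measure given by [frostman] at a depth [n] large enough to see the
    scale [2 ^- N]. *)
Lemma cube_pair (R : realType) (k gam r0 K0 N : nat) (Q : dyadic_cube k.+1)
  (A : set 'rV[R]_k.+1) (t lam rho eta : R) : (0 < k)%N ->
  [/\ (1024 * k <= 4 ^ gam)%N, (5 <= r0)%N, (gam <= 28 * r0)%N & (72 * r0 <= K0)%N] ->
  1 / 8 <= t -> t <= 1 / 4 -> 0 < lam -> 0 < eta ->
  [/\ 2 ^+ k.+1 * lam <= 1 + eta, (2 ^+ k.+1 * lam) ^+ 72 <= 5 / 4 &
   (1 + 2 ^+ (72 * r0) / 2 ^+ K0) ^+ k.+1 * (2 ^+ k.+1 * lam) ^+ K0 <= 1 + eta] ->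
  rho + eta <= 2 ^- k.+1 / 4 ->
  12 * (6 + 10 * k%:R) * (2 ^+ k.+1) ^+ 2 / 2 ^+ r0 <= 2 ^- k.+1 / 4 :> R ->
  A `<=` cube_set R Q -> 1 - rho < tree_content lam (digits Q) A [::] ->
  exists x1 x2, [/\ A x1, A x2 &
    `|\sum_i ((x2 0 i - x1 0 i) / side R Q) ^+ 2 - t ^+ 2| <= 8 * k.+1%:R / 2 ^+ N].
Proof.
move=> k0 [H1 H2 H3 H4] t1 t2 lam0 eta0 [H5 H6 H7] H8 H9 AQ HA.
pose n := (72 * (r0 + N) + 73 + K0)%N.
have Jn : (72 * (r0 + N) + 73 <= n)%N by rewrite leq_addr.
have K0n : (K0 <= n)%N by rewrite leq_addl.
have [mu [mu1 mu2 mu3 mu4]] := @frostman R _ lam _ (digits Q) lam0 A n.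
have [q1 [q2 [u [[q1n m1] [q2n m2] uE ub]]]] := @discrete_pair R k n gam r0 N K0 t lam rho eta
  k0 H1 t1 t2 H2 H3 Jn H4 K0n lam0 eta0 H5 H6 H7 H8 H9 mu mu1 mu2 (lt_le_trans HA mu3).
have [x1 Ax1 x1q] := mu4 q1 q1n m1; have [x2 Ax2 x2q] := mu4 q2 q2n m2.
exists x1, x2; split => //.
have pn (l : nat) : 0 < 2 ^+ l :> R by rewrite exprn_gt0.
have s0 : 0 < side R Q := side_gt0 R Q.
have Nn : (2 : R) ^- n <= 2 ^- N.
  rewrite lef_pV2 ?posrE // ler_weXn2l ?ler1n //; rewrite /n; clear; lia.
have NJ : (2 : R) ^- (r0 + N) <= 2 ^- N.
  by rewrite lef_pV2 ?posrE // ler_weXn2l ?ler1n // leq_addl.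
have pN : 0 < (2 : R) ^- N by rewrite invr_gt0.
have pN1 : (2 : R) ^- N <= 1 by rewrite invf_le1 // exprn_ege1 // ler1n.
rewrite -uE -sumrB; apply: le_trans (ler_norm_sum _ _ _) _.
apply: (@le_trans _ _ (\sum_(i < k.+1) 8 / 2 ^+ N)); last first.
  by rewrite sumr_const card_ord -[_ *+ k.+1]mulr_natl mulrCA mulrA.
apply: ler_sum => i _.
have zE : (x2 0 i - x1 0 i) / side R Q = ncoord Q x2 i - ncoord Q x1 i.
  by rewrite /ncoord; field; rewrite gt_eqF.
rewrite zE.
have /andP[c1 c1'] := cell_itv n i (AQ _ Ax1).
have /andP[c2 c2'] := cell_itv n i (AQ _ Ax2).
rewrite -idx_code ?x1q in c1 c1'; try exact: AQ.
rewrite -idx_code ?x2q in c2 c2'; try exact: AQ.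
rewrite -(natr1 (idx q1 i)) in c1'; rewrite -(natr1 (idx q2 i)) in c2'.
have /andP[y1 y1'] := ncoord_itv i (AQ _ Ax1).
have /andP[y2 y2'] := ncoord_itv i (AQ _ Ax2).
have -> : 8 / 2 ^+ N = 4 * (2 * 2 ^- N) :> R by ring.
apply: sqr_perturb; [|by move: pN1; clear; lra|].
  by move: y1 y1' y2 y2'; clear => *; apply/andP; split; lra.
have {}ub := le_trans (ub i) NJ.
set a := ((idx q2 i)%:R - (idx q1 i)%:R) / 2 ^+ n in ub.
have : `|ncoord Q x2 i - ncoord Q x1 i - a| <= 2 ^- n.
  rewrite -(ler_pM2r (pn n)) mulVf ?gt_eqF // -{1}(gtr0_norm (pn n)) -normrM.
  have -> : (ncoord Q x2 i - ncoord Q x1 i - a) * 2 ^+ n = 2 ^+ n * ncoord Q x2 i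
      - 2 ^+ n * ncoord Q x1 i - ((idx q2 i)%:R - (idx q1 i)%:R).
    by rewrite /a; field; rewrite gt_eqF.
  move: c1 c1' c2 c2'; clear; rewrite ler_norml => *; apply/andP; split; lra.
move: ub Nn; clear; rewrite !ler_norml => /andP[? ?] ? /andP[? ?]; apply/andP; split; lra.
Qed.

Lemma cube_compact (R : realType) (d : nat) (Q : dyadic_cube d) : compact (cube_set R Q).
Proof.
pose I i := `[side R Q * (dyadic_index Q i)%:~R, side R Q * (dyadic_index Q i + 1)%:~R]%classic.
have -> : cube_set R Q = [set v | forall i, I i (v ord0 i)].
  by apply/seteqP; split=> x H i; have := H i; rewrite /I /= in_itv.
by apply: rV_compact => i; apply: segment_compact.
Qed.

Lemma borel_suslin (R : realType) (d : nat) (E : set 'rV[R]_d) : borel_set E -> suslin E.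
Proof.
apply: smallest_suslin => A oA; split; first exact: open_suslin.
by apply: closed_suslin; apply: open_closedC.
Qed.

(** Applying [cube_pair] to the sets given by [bounded_approx] yields pairs of points whose
    distances tend to [t]; by compactness of the cube they converge along an ultrafilter, to
    points of [E] by [bounded_part_limit]. *)
Lemma dense_cube_distances (R : realType) (k gam r0 K0 : nat) (Q : dyadic_cube k.+1)
  (E : set 'rV[R]_k.+1) (t s rho eta : R) (lam := 2 `^ (- s)) : (0 < k)%N ->
  [/\ (1024 * k <= 4 ^ gam)%N, (5 <= r0)%N, (gam <= 28 * r0)%N & (72 * r0 <= K0)%N] ->
  1 / 8 <= t -> t <= 1 / 4 -> 1 <= s -> 0 < eta ->
  [/\ 2 ^+ k.+1 * lam <= 1 + eta, (2 ^+ k.+1 * lam) ^+ 72 <= 5 / 4 &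
   (1 + 2 ^+ (72 * r0) / 2 ^+ K0) ^+ k.+1 * (2 ^+ k.+1 * lam) ^+ K0 <= 1 + eta] ->
  rho + eta <= 2 ^- k.+1 / 4 ->
  12 * (6 + 10 * k%:R) * (2 ^+ k.+1) ^+ 2 / 2 ^+ r0 <= 2 ^- k.+1 / 4 :> R ->
  borel_set E ->
  (((1 - rho) * side R Q `^ s)%:E < dyadic_content s (E `&` cube_set R Q))%E ->
  distance_set E (side R Q * t).
Proof.
move=> k0 Hc t1 t2 s1 eta0 Hth Hrho Hr0 /borel_suslin[F [cF EF]] HQ.
have lam0 : 0 < lam by rewrite powR_gt0.
have s0 : 0 < side R Q := side_gt0 R Q.
pose h (S : set 'rV[R]_k.+1) := tree_content lam (digits Q) (S `&` cube_set R Q) [::].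
have hE : 1 - rho < h (suslin_op F).
  have := lt_le_trans HQ (dyadic_content_le Q E s1).
  by rewrite lte_fin mulrC ltr_pM2l ?powR_gt0 // -EF.
have hcup (S : nat -> set 'rV[R]_k.+1) c : (forall n, S n `<=` S n.+1) ->
    (forall n, h (S n) <= c) -> h (\bigcup_n S n) <= c.
  move=> mono Hn; rewrite /h setI_bigcupl; apply: tree_content_bigcup => // n.
  by apply: setSI.
have [b Hb] := bounded_approx hcup hE.
have /choice[xy Hxy] N : exists xy : 'rV[R]_k.+1 * 'rV[R]_k.+1,
    [/\ (bounded_part F b N `&` cube_set R Q) xy.1,
        (bounded_part F b N `&` cube_set R Q) xy.2 &
    `|\sum_i ((xy.2 0 i - xy.1 0 i) / side R Q) ^+ 2 - t ^+ 2| <= 8 * k.+1%:R / 2 ^+ N].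
  have [x [y [Hx Hy Hd]]] := @cube_pair R k gam r0 K0 N Q _ t lam rho eta k0 Hc t1 t2 lam0
    eta0 Hth Hrho Hr0 (@subIsetr _ _ _) (Hb N).
  by exists (x, y).
have [U [UU Uoo]] := @ultraFilterLemma nat \oo _.
have PU : ProperFilter U by apply: ultra_proper.
have Uge n : U [set m | (n <= m)%N] by apply: Uoo; exists n.
have [x Qx cx] := compact_ultra_cvg UU (@cube_compact R _ Q) (fun N => (let: And3 a _ _ := Hxy N in a).2).
have [y Qy cy] := compact_ultra_cvg UU (@cube_compact R _ Q) (fun N => (let: And3 _ a _ := Hxy N in a).2).
have Ex : E x.
  by rewrite EF; apply: (bounded_part_limit UU Uge cF (fun N => (let: And3 a _ _ := Hxy N in a).1) cx).
have Ey : E y.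
  by rewrite EF; apply: (bounded_part_limit UU Uge cF (fun N => (let: And3 _ a _ := Hxy N in a).1) cy).
pose g (z : 'rV[R]_k.+1 * 'rV[R]_k.+1) := \sum_i ((z.2 0 i - z.1 0 i) / side R Q) ^+ 2.
have cg : g (xy N) @[N --> U] --> g (x, y).
  apply: cvg_big => [|i _]; first exact: add_continuous.
  have cc (z : nat -> 'rV[R]_k.+1) (p : 'rV[R]_k.+1) : z @ U --> p -> z N 0 i @[N --> U] --> p 0 i.
    move=> cz S HS; exact: (cz ((fun M : 'rV[R]_k.+1 => M 0 i) @^-1` S) (@coord_continuous R 1 k.+1 0 i p S HS)).
  have c1 : (((xy N).2 0 i - (xy N).1 0 i) / side R Q) @[N --> U] -->
      ((y 0 i - x 0 i) / side R Q).
    by apply: cvgM; [apply: cvgB; [exact: cc cy | exact: cc cx] | exact: cvg_cst].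
  by rewrite expr2; under eq_fun do rewrite expr2; apply: cvgM.
have gE : g (x, y) = t ^+ 2.
  apply/eqP; rewrite -subr_eq0 -normr_eq0 eq_le normr_ge0 andbT.
  apply/ler_addgt0Pr => e e0; rewrite add0r.
  have [M HM] : exists M : nat, 8 * k.+1%:R / 2 ^+ M <= e.
    exists (Num.truncn (8 * k.+1%:R / e)).
    rewrite ler_pdivrMr ?exprn_gt0 // [e * _]mulrC -ler_pdivrMr //.
    apply: ltW; apply: lt_le_trans (truncnS_gt _) _.
    by have := ltn_expl (Num.truncn (8 * k.+1%:R / e)) (isT : 1 < 2)%N; rewrite -(@ler_nat R) natrX.
  apply: (@closed_cvg _ _ U _ (fun N => `|g (xy N) - t ^+ 2|) (fun z => z <= e)).
  - exact: closed_le.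
  - apply: filterS (Uge M) => N /= MN; have [_ _ H] := Hxy N.
    apply: le_trans H (le_trans _ HM).
    by rewrite ler_wpM2l ?mulr_ge0 // lef_pV2 ?posrE ?exprn_gt0 // ler_weXn2l ?ler1n.
  - by apply: cvg_norm; apply: cvgB => //; apply: cvg_cst.
exists (y, x) => //=.
have t0 : 0 <= t by lra.
rewrite /enorm -[RHS](@ger0_norm _ (side R Q * t)) ?mulr_ge0 ?(ltW s0) //.
rewrite -sqrtr_sqr exprMn -gE; congr (Num.sqrt _).
rewrite /g mulr_sumr; apply: eq_bigr => i _ /=; rewrite !mxE.
by field; rewrite gt_eqF.
Qed.

Theorem theorem1p2 (R : realType) (d : nat) (hd : (2 <= d)%N) :
  exists rho0 : R, 0 < rho0 < 1 /\
  forall rho : R, 0 < rho < rho0 ->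
  exists a b eps : R,
    [/\ 0 < a, a < b, b < 1, 0 < eps &
    forall (E : set 'rV[R]_d) (s : R),
      E `<=` unit_cube R d ->
      borel_set E ->
      d%:R - eps < s ->
      (0 < hausdorff_measure s E)%E ->
      \bigcup_(Q in dense_cubes rho E s)
        [set t | side R Q * a <= t <= side R Q * b]
      `<=` distance_set E].
Proof.
case: d hd => [//|k]; rewrite ltnS => k0.
pose e0 : R := 2 ^- k.+1.
have e0p : 0 < e0 by rewrite invr_gt0 exprn_gt0.
have e01 : e0 <= 1 by rewrite invf_le1 ?exprn_gt0 // exprn_ege1 // ler1n.
exists (e0 / 8); split; first by apply/andP; split; lra.
move=> rho /andP[rho0 rho1].
have [gam [r0 [K0 [delta [Hnat [delta0 delta1 Hr0 Hth]]]]]] := constants R k.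
have ln2 : 0 < ln (2 : R) by rewrite ln_gt0 // ltr1n.
(* The last value is chosen so that [2 ^ eps = 1 + delta]. *)
exists (1 / 8), (1 / 4), (ln (1 + delta) / ln 2); split; [lra | lra | lra | |].
  by rewrite divr_gt0 // ln_gt0 // ltrDl.
move=> E s _ bE ds _ t [Q [_ HQ] /= /andP[ta tb]].
have s0 : 0 < side R Q := side_gt0 R Q.
have eps1 : ln (1 + delta) / ln 2 <= 1.
  by rewrite ler_pdivrMr // mul1r ler_ln ?posrE //; lra.
have s1 : 1 <= s.
  have : 2 <= k.+1%:R :> R by rewrite ler_nat.
  lra.
have -> : t = side R Q * (t / side R Q) by field; rewrite gt_eqF.
apply: (@dense_cube_distances R k gam r0 K0 Q E (t / side R Q) s rho (e0 / 8)) => //.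
- by rewrite ler_pdivlMr // mulrC.
- by rewrite ler_pdivrMr // mulrC.
- lra.
- apply: Hth; rewrite mulr_ge0 ?exprn_ge0 ?powR_ge0 //=.
  rewrite -powR_mulrn // -powRD; last by rewrite pnatr_eq0 implybT.
  have -> : 1 + delta = 2 `^ (ln (1 + delta) / ln 2).
    by rewrite /powR pnatr_eq0 divfK ?gt_eqF // lnK ?posrE //; lra.
  by rewrite ler_powR ?ler1n // ltW //; lra.
- rewrite -/e0; lra.
Qed.
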